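(* Let $\psi_1,\psi_2:\mathbb{N}\to\mathbb{R}^+$ be approximating functions, $\bm\theta=(\theta_1,\theta_2)\in\mathbb{R}^2$, let $I\subseteq\mathbb{R}$ be an interval, $f\in C^{(3)}(I)$, and suppose $\mathcal{C}_f=\{(x,f(x)):x\in I\}$ is a non-degenerate curve. Then $|\mathcal{C}_f\cap \mathcal{A}(\psi_1, \psi_2,\bm\theta)|_{\mathcal{C}_f}$ is zero if $\sum_{q=1}^{\infty}\psi_1(q)\psi_2(q) < \infty$, and $\mathcal{C}_f\cap \mathcal{A}(\psi_1, \psi_2,\bm\theta)$ has full measure in $\mathcal{C}_f$ (its complement in $\mathcal{C}_f$ has measure zero) if $\sum_{q=1}^{\infty}\psi_1(q)\psi_2(q) = \infty$.
   Context: An approximating function is a monotonic function $\psi:\mathbb{N}\to\mathbb{R}^+$ with $\psi(q)\to 0$ as $q\to\infty$. For $\bm\theta\in\mathbb{R}^2$, $\mathcal{A}(\psi_1,\psi_2,\bm\theta)$ is the set of $(x_1,x_2)\in\mathbb{R}^2$ such that $\|qx_1-\theta_1\|<\psi_1(q)$ and $\|qx_2-\theta_2\|<\psi_2(q)$ hold simultaneously for infinitely many $q\in\mathbb{N}$, where $\|\cdot\|$ is the distance to the nearest integer. $|\cdot|_{\mathcal{C}_f}$ denotes the Lebesgue measure induced on the curve $\mathcal{C}_f$. A planar curve is non-degenerate if the set of its points at which the curvature vanishes has one-dimensional Lebesgue measure zero. *)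

(* Defs.v *)
From HB Require Import structures.
From mathcomp Require Export all_boot all_order all_algebra.
From mathcomp Require Export all_classical all_reals all_analysis.
Export Order.TTheory GRing.Theory Num.Theory.
Export numFieldNormedType.Exports.

Set Implicit Arguments.
Unset Strict Implicit.
Unset Printing Implicit Defensive.

Local Open Scope classical_set_scope.
Local Open Scope ring_scope.

Section DiophantineApproximation.
Context {R : realType}.
Implicit Types (psi : nat -> R) (theta : R * R).

(* The natural numbers here are 1, 2, ...: nothing is required of [psi 0]. *)
Definition monotonic psi : Prop :=
  (forall m n, (0 < m)%N -> (m <= n)%N -> psi m <= psi n) \/
  (forall m n, (0 < m)%N -> (m <= n)%N -> psi n <= psi m).

Definition approximating_function psi : Prop :=
  [/\ forall q, (0 < q)%N -> 0 < psi q,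
      monotonic psi
    & psi @ \oo --> (0 : R)].

Definition dist_int (x : R) : R :=
  inf [set `|x - m%:~R| | m in [set: int]].

Definition approximable psi1 psi2 theta : set (R * R) :=
  [set x | infinite_set [set q : nat |
     [/\ (0 < q)%N,
         dist_int (q%:R * x.1 - theta.1) < psi1 q
       & dist_int (q%:R * x.2 - theta.2) < psi2 q]]].

End DiophantineApproximation.

Section PlanarCurves.
Context {R : realType}.
Implicit Types (I : set R) (f : R -> R).

(* Difference quotients are taken inside [I], hence one-sided at the endpoints
   that belong to [I]; values of [f] outside [I] play no role. *)
Definition diff_quot f (x y : R) : R := (f y - f x) / (y - x).

Definition derivable_in I f (x : R) : Prop :=
  cvg (diff_quot f x @ within I x^').

Definition deriv_in I f (x : R) : R :=
  lim (diff_quot f x @ within I x^').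

Definition derivn_in I (n : nat) f : R -> R := iter n (deriv_in I) f.

Definition Ck_in (k : nat) I f : Prop :=
  (forall i, (i < k)%N -> forall x, I x -> derivable_in I (derivn_in I i f) x)
  /\ {within I, continuous (derivn_in I k f)}.

Definition curve I f : set (R * R) := [set (x, f x) | x in I].

Definition speed I f (x : R) : R := Num.sqrt (1 + deriv_in I f x ^+ 2).

(* Arc length on the curve, i.e. integration of ds = sqrt (1 + f'^2) dx over
   the abscissae of the points of [S] lying on the curve. *)
Definition curve_measure I f (S : set (R * R)) : \bar R :=
  (\int[lebesgue_measure]_(x in [set x | I x /\ S (x, f x)])
     (speed I f x)%:E)%E.

(* |f''| / (1 + f'^2)^(3/2) *)
Definition curvature I f (x : R) : R :=
  `|derivn_in I 2 f x| / speed I f x ^+ 3.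

Definition nondegenerate I f : Prop :=
  curve_measure I f [set (x, f x) | x in [set x | I x /\ curvature I f x = 0]]
  = 0%E.

End PlanarCurves.

(* Main.v *)
Require Import Defs.
From mathcomp Require Import zify ring lra measurable_realfun.
Set Implicit Arguments.
Unset Strict Implicit.
Unset Printing Implicit Defensive.
Local Open Scope classical_set_scope.
Local Open Scope ring_scope.

(* Lift a curve point x to the primitive integer vectors (q, a, b), measured by the three
   quantities q, a - q x and the tangential deviation b - q f(x) - f'(x) (a - q x), together with
   the dual norms.  Where f'' <> 0 the deviation of a fixed vector behaves like a quadratic
   polynomial, and two vectors that are both short at a point span a short dual vector (and
   conversely).  A maximal-function argument alternating between a lattice and its dual therefore
   shows that the points carrying a short vector have small measure; at all other points every
   real target is close to an integer vector.

   Convergence: at a good point the lattice packs the solutions of height about 2^t, which bounds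
   the number of arcs covering the 2^t-th level set; the bounds are summable, so Borel-Cantelli
   applies.  Divergence: at a good point there is a rational point of height about 2^t near the
   curve, i.e. a ubiquitous system; choosing pairwise disjoint balls level by level gives a fixed
   proportion of every interval, hence full measure by Lebesgue density.  When psi1 > psi2 this is
   applied to the inverse function.  The points with f'' = 0 are null by hypothesis, and those
   with f' = 0, f'' <> 0 are countable, so countably many rational intervals suffice. *)

(** * Outer measure and the maximal function *)

Section outer_lebesgue.
Local Open Scope ereal_scope.
Context {R : realType}.
Notation mu := (@lebesgue_measure R).
Implicit Types (A B D : set R).

(** Bad sets and level sets are handled without measurability: upper bounds are for the outer
    measure, and a measurable hull enters only where additivity and the maximal inequality need one.
    The quantities (q, a - q x, tau) arise from (q, a, b) by a unipotent matrix, so cross products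
    are computed by their minors: two vectors in a box of size e give a dual vector in a box of size
    2 e^2, and conversely. This squaring drives the alternation: from size z^8 the next box may be
    given size (z / (4 K))^8, with an exceptional set of order z, and the loss 30 from the maximal
    inequality is absorbed. After about log Y0 rounds the height bound drops below 1 and no vector
    is left, so the final bound is free of Y0. The shifts theta do not affect the homogeneous
    lattice; they enter only through coverings by translated boxes. For divergence the obstacle is
    irregular psi: the covering radii are proportional to 1 / (4^t M_t), where M_t is the larger psi
    at level t, and need not shrink, so only levels where 3^t M_t is a record are used. *)

Lemma mu_le A B : A `<=` B -> mu A <= mu B.
Proof. by move=> AB; exact: le_outer_measure. Qed.

Lemma mu_bigcup (F : nat -> set R) : mu (\bigcup_n F n) <= \sum_(0 <= n <oo) mu (F n).
Proof. exact: (outer_measure_sigma_subadditive (wlength idfun)^*%mu F). Qed.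

Lemma mu_setU A B : mu (A `|` B) <= mu A + mu B.
Proof. exact: (outer_measureU2 (wlength idfun)^*%mu A B). Qed.

Lemma mu_measurable_hull A : exists V, [/\ measurable V, A `<=` V & mu V = mu A].
Proof.
have [G [oG AG GA]] := outer_measure_Gdelta A.
exists (\bigcap_i G i); split => //.
by apply: bigcapT_measurable => i; exact: open_measurable.
Qed.

Lemma mu_cc (a b : R) : (a <= b)%R -> mu `[a, b] = (b - a)%:E.
Proof.
by move=> ab; rewrite lebesgue_measure_itv/= lte_fin; case: ltgtP ab => // ->; rewrite subrr.
Qed.

Lemma mu_le_cc A (a b : R) : (a <= b)%R -> A `<=` `[a, b] -> mu A <= (b - a)%:E.
Proof. by move=> ab sA; rewrite -(mu_cc ab); exact: mu_le. Qed.

(** Around each point of [D] the ball of radius 6/5 ell contains [D] and has length 12/5 ell, so [V]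
    fills at least 5/24 > 1/5 of it. *)
Lemma HL_of_dense D V (ell : R) : measurable V -> measurable D ->
  (0 < ell)%R -> (forall x y, D x -> D y -> (`|x - y| <= ell)%R) ->
  (ell / 2)%:E <= mu (D `&` V) ->
  D `<=` [set x | (1/5)%:E < HL_maximal (\1_V : R -> R) x].
Proof.
move=> mV mD l0 diam dens x Dx /=.
set r : R := (6/5 * ell)%R.
have r0 : (0 < r)%R by rewrite /r; lra.
apply: (@lt_le_trans _ _ (iavg (\1_V : R -> R) (ball x r))); last first.
  by apply: ereal_sup_ubound; exists r => //=; rewrite in_itv/= r0.
rewrite /iavg lebesgue_measure_ball ?ltW//.
under eq_integral do rewrite abse_EFin ger0_norm//.
rewrite integral_indic//; last exact: measurable_ball.
have : mu (D `&` V) <= mu (V `&` ball x r).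
  apply: mu_le => y [Dy Vy]; split => //; rewrite /ball/=.
  by apply: (le_lt_trans (diam _ _ Dx Dy)); rewrite /r; lra.
move=> /(le_trans dens) h.
rewrite inver mulrn_eq0/= gt_eqF//.
apply: lt_le_trans; last first.
  apply: lee_wpmul2l; last exact: h.
  by rewrite lee_fin invr_ge0 mulrn_wge0// ltW.
rewrite -EFinM lte_fin ltr_pdivlMl; last by rewrite mulrn_wgt0.
by rewrite /r -mulr_natl; lra.
Qed.

Lemma HL_indic_bound V : measurable V ->
  mu [set x | (1/5)%:E < HL_maximal (\1_V : R -> R) x] <= 15%:E * mu V.
Proof.
move=> mV.
have := @maximal_inequality R (\1_V : R -> R) (1/5)%R
  (locally_integrable_indic openT mV) ltac:(lra).
move=> /le_trans; apply.
under eq_integral do rewrite abse_EFin ger0_norm//.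
rewrite integral_indic// setIT.
by apply: lee_wpmul2r => //; rewrite lee_fin; lra.
Qed.

Lemma mu_setID_cover B (F : nat -> set R) (P : set nat) V :
  measurable V -> (forall n, P n -> measurable (F n)) ->
  (forall n m, P n -> P m -> n <> m -> F n `&` F m `<=` V) ->
  (forall n, P n -> F n `<=` B) ->
  \sum_(0 <= n <oo | n \in P) mu (F n `\` V) <= mu B.
Proof.
move=> mV mF dF FB.
rewrite -(@measure_bigcup _ _ _ mu P (fun n => F n `\` V)).
- by apply: mu_le => x [n Pn [Fx _]]; exact: (FB n).
- by move=> n Pn; apply: measurableD => //; exact: mF.
- apply/trivIsetP => n m Pn Pm /eqP nm; rewrite -subset0 => x [[Fx Vx] [Fmx _]].
  by apply: Vx; exact: (dF n m).
Qed.

(* Every interval is shrunk by a factor lam; those mostly outside V are controlled by disjointness, the others lie where the maximal function of V is large. *)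
Lemma shrunk_intervals_bound (a b lam : R) (D : set R) (P : set nat) (x z : nat -> R) :
  (a <= b)%R -> (3 <= lam)%R ->
  (forall n, P n -> [/\ (a <= x n <= b)%R, (0 <= z n)%R & (lam * z n <= b - a)%R]) ->
  (forall n m t, P n -> P m -> n <> m -> (a <= t <= b)%R ->
     (`|t - x n| <= lam * z n)%R -> (`|t - x m| <= lam * z m)%R -> D t) ->
  mu (\bigcup_(n in P) [set t | (a <= t <= b)%R /\ (`|t - x n| <= 3 * z n)%R])
   <= (12 * (b - a) / lam)%:E + 15%:E * mu D.
Proof.
move=> ab lam3 hP hD.
have [V [mV DV <-]] := mu_measurable_hull D.
(* The interval enlarged by [lam] and clipped to [a, b]. Its centre lies in [a, b] and
   [lam * z n <= b - a], so clipping leaves length at least [lam * z n]. *)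
pose sg n : set R := `[Order.max a (x n - lam * z n)%R, Order.min b (x n + lam * z n)%R]%classic.
have sgP n t : sg n t <-> ((a <= t <= b)%R /\ (`|t - x n| <= lam * z n)%R).
  rewrite /sg/= in_itv/= ge_max le_min ler_distl.
  split=> [/andP[/andP[-> ->] /andP[-> ->]]//|[/andP[-> ->] /andP[-> ->]]//].
have msg n : measurable (sg n) by exact: measurable_itv.
pose ell n : R := (Order.min b (x n + lam * z n)%R - Order.max a (x n - lam * z n)%R)%R.
have ellz n : P n -> (lam * z n <= ell n)%R.
  move=> /hP[/andP[ax xb] z0 zab]; rewrite /ell.
  have l0 : (0 <= lam * z n)%R by apply: mulr_ge0 => //; lra.
  by rewrite /Order.min /Order.max; case: ifPn => ?; case: ifPn => ?; lra.
have musg n : P n -> mu (sg n) = (ell n)%:E.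
  move=> Pn; rewrite mu_cc// -subr_ge0; apply: le_trans (ellz _ Pn).
  by have [_ z0 _] := hP _ Pn; apply: mulr_ge0 => //; lra.
pose T n := [set t | (a <= t <= b)%R /\ (`|t - x n| <= 3 * z n)%R].
pose P1 : set nat := [set n | P n /\ mu (sg n `&` V) < (ell n / 2)%:E].
pose P2 : set nat := [set n | P n /\ (ell n / 2)%:E <= mu (sg n `&` V) /\ (0 < ell n)%R].
pose P3 : set nat := [set n | P n /\ ell n = 0%R].
have PP n : P n -> [\/ P1 n, P2 n | P3 n].
  move=> Pn; have [h|h] := ltP (mu (sg n `&` V)) (ell n / 2)%:E; first by constructor.
  have : (0 <= ell n)%R.
    by apply: le_trans (ellz _ Pn); have [_ z0 _] := hP _ Pn; apply: mulr_ge0 => //; lra.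
  by rewrite le_eqVlt => /predU1P[e|e]; [constructor 3|constructor 2].
have -> : \bigcup_(n in P) T n =
  (\bigcup_(n in P1) T n `|` \bigcup_(n in P3) T n) `|` \bigcup_(n in P2) T n.
  apply/seteqP; split=> [t [n Pn Tt]|t].
    by case: (PP _ Pn) => h; [left; left|right|left; right]; exists n.
  by move=> [[[n [Pn _] Tt]|[n [Pn _] Tt]]|[n [Pn _] Tt]]; exists n.
have TS n : P n -> T n `<=` sg n.
  move=> Pn t [tab tx]; apply/sgP; split=> //; apply: (le_trans tx).
  by have [_ z0 _] := hP _ Pn; apply: ler_wpM2r.
apply: (le_trans (mu_setU _ _)); apply: leeD; last first.
  apply: le_trans (HL_indic_bound mV); apply: mu_le => t [n [Pn [h l0]] Tt].
  apply: (HL_of_dense mV (msg n) l0 _ h); last exact: TS.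
  move=> u v; rewrite /sg/= !in_itv/= => /andP[u1 u2] /andP[v1 v2].
  by rewrite /ell ler_distl; lra.
have mT n : P n -> mu (T n) <= (6 * z n)%:E.
  move=> Pn; have [_ z0 _] := hP _ Pn.
  have -> : (6 * z n = (x n + 3 * z n) - (x n - 3 * z n))%R by lra.
  apply: mu_le_cc; first lra.
  by move=> t [_]; rewrite ler_distl/= in_itv/=.
have lam0 : (0 < lam)%R by lra.
have mu3 : mu (\bigcup_(n in P3) T n) = 0.
  apply/eqP; rewrite -measure_le0 bigcup_mkcond.
  apply: (le_trans (mu_bigcup _)).
  rewrite eseries0// => n _ _; case: ifPn => [|_]; last by rewrite measure0.
  rewrite inE => -[Pn e0]; apply/eqP; rewrite -measure_le0.
  apply: (le_trans (mT _ Pn)); rewrite lee_fin.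
  have := ellz _ Pn; rewrite e0 pmulr_rle0//; lra.
apply: (le_trans (mu_setU _ _)); rewrite mu3 adde0 bigcup_mkcond.
apply: (le_trans (mu_bigcup _)).
apply: (@le_trans _ _ (\sum_(0 <= n <oo | n \in P1) (12 / lam)%:E * mu (sg n `\` V))).
  rewrite [leRHS]eseries_mkcond; apply: lee_nneseries => [//|n _].
  case: ifPn => [|_]; last by rewrite measure0.
  (* In [P1] at least half of [sg n] lies outside [V], so 12 / lam times that outer part pays for
     the small interval; the outer parts are disjoint. *)
  rewrite inE => -[Pn h]; apply: (le_trans (mT _ Pn)).
  have -> : (6 * z n = 12 / lam * (lam * z n / 2))%R by field; apply/eqP; lra.
  rewrite EFinM; apply: lee_wpmul2l; first by rewrite lee_fin divr_ge0//; lra.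
  have e : (ell n)%:E = mu (sg n `\` V) + mu (sg n `&` V).
    by rewrite -(musg _ Pn); exact: (@measureDI _ _ _ mu _ _ (msg n) mV).
  have lz := ellz _ Pn.
  have [r hr] : exists r : R, mu (sg n `&` V) = r%:E.
    exists (fine (mu (sg n `&` V))); rewrite fineK// ge0_fin_numE//.
    exact: (lt_trans h (ltry _)).
  have [s hs] : exists s : R, mu (sg n `\` V) = s%:E.
    exists (fine (mu (sg n `\` V))); rewrite fineK// ge0_fin_numE//.
    apply: le_lt_trans (ltry (ell n)); rewrite -(musg _ Pn).
    by apply: mu_le => ? [].
  move: e h; rewrite hr hs -EFinD lte_fin lee_fin => -[]; lra.
rewrite nneseriesZl//.
have -> : (12 * (b - a) / lam)%R = (12 / lam * (b - a))%R by field; apply/eqP; lra.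
rewrite (EFinM (12 / lam) (b - a)); apply: lee_wpmul2l; first by rewrite lee_fin divr_ge0//; lra.
rewrite -(mu_cc ab).
apply: mu_setID_cover => //.
- move=> n m [Pn _] [Pm _] nm t [/sgP[t1 t2] /sgP[_ t3]].
  by apply: DV; exact: (hD n m).
- by move=> n [Pn _] t /sgP[]; rewrite /= in_itv.
Qed.

End outer_lebesgue.

(** * Sublevel sets of quadratic-like functions *)

Section sublevel.
Context {R : realType}.
Implicit Types (x y z t : R).

Lemma half_diameter_point (S : set R) (a b x1 : R) :
  (forall t, S t -> a <= t <= b) -> S x1 ->
  exists2 x2, S x2 & forall t, S t -> `|t - x1| <= 2 * `|x2 - x1|.
Proof.
move=> Sab Sx1.
pose T := [set `|t - x1| | t in S].
have T0 : T !=set0 by exists `|x1 - x1|; exists x1.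
have ubT : has_ubound T.
  exists (b - a) => _ [t St <-].
  have /andP[? ?] := Sab _ St; have /andP[? ?] := Sab _ Sx1.
  by rewrite ler_distl; lra.
have [h|h] := leP (sup T) 0.
  exists x1 => // t St; rewrite subrr normr0 mulr0.
  by apply: le_trans h; apply: ub_le_sup => //; exists t.
have [_ [x2 Sx2 <-] h2] := @sup_adherent _ T (sup T / 2) ltac:(lra) (conj T0 ubT).
exists x2 => // t St.
have : `|t - x1| <= sup T by apply: ub_le_sup => //; exists t.
lra.
Qed.

(** Two nearly extremal points of [S], at distance z, bound k z^2 + |g1 x| z through the lower
    growth estimate. Enlarging the distance by [lam] multiplies this by at most [lam^2], which the
    upper estimate turns into smallness at level [rho]; hence the hypothesis on [lam ^+ 2]. *)
Lemma sublevel_interval (a b c C k eps rho lam G0 G1 : R) (g g1 : R -> R) (S : set R) :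
  0 < c -> c <= C -> 0 <= k -> 0 < eps -> 3 <= lam ->
  lam ^+ 2 * (4 * C * eps) <= c * rho -> 0 < G0 -> 0 < G1 ->
  (forall x y, a <= x <= b -> a <= y <= b -> 0 <= g1 x * g1 y -> `|g1 x| <= `|g1 y| ->
     c * (k * `|y - x| ^+ 2 + `|g1 x| * `|y - x|) <= `|g y - g x|) ->
  (forall x y, a <= x <= b -> a <= y <= b ->
     `|g y - g x| <= C * (k * `|y - x| ^+ 2 + `|g1 x| * `|y - x|)) ->
  (forall x y, a <= x <= b -> a <= y <= b ->
     c * (k * `|y - x|) <= `|g1 y - g1 x| <= C * (k * `|y - x|)) ->
  (forall t, S t -> [/\ a <= t <= b, `|g t| < eps * G0 & `|g1 t| < eps * G1]) ->
  (forall x y, S x -> S y -> 0 <= g1 x * g1 y) ->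
  S !=set0 ->
  exists x z, [/\ S x, 0 <= z, (forall t, S t -> `|t - x| <= 3 * z),
    (forall t, a <= t <= b -> `|t - x| <= lam * z ->
       `|g t| < rho * G0 /\ `|g1 t| < rho * G1)
    & c * (k * z ^+ 2 + `|g1 x| * z) <= 2 * eps * G0].
Proof.
move=> c0 cC k0 e0 lam3 hlam G00 G10 L1 L2 L3 hS side [x1 Sx1].
have C0 : 0 < C by exact: lt_le_trans cC.
have [c0' C0' e0' G00' G10'] := And5 (ltW c0) (ltW C0) (ltW e0) (ltW G00) (ltW G10).
have lam0 : 0 <= lam by exact: le_trans lam3.
have erho : 36 * eps <= rho.
  have : 9 <= lam ^+ 2 by nra.
  move=> h; have : 9 * (4 * C * eps) <= c * rho.
    by apply: le_trans hlam; apply: ler_wpM2r => //; nra.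
  move=> h2; have Ce : 0 < C * eps by exact: mulr_gt0.
  have r0 : 0 <= rho by rewrite -(pmulr_rge0 _ c0); lra.
  have : C * (36 * eps) <= C * rho by nra.
  by rewrite ler_pM2l.
have e36 : eps <= rho / 36 by move: erho; clear; lra.
have rho0 : 0 < rho by apply: lt_le_trans erho; rewrite mulr_gt0.
have [x2 Sx2 hx2] := @half_diameter_point S a b x1 (fun t St => let: And3 h _ _ := hS t St in h) Sx1.
(* The lower estimate must start from the end with smaller [|g1|]. If that is [x2], the ends are
   exchanged, and radius 2 z around [x1] becomes 3 z around [x]. *)
have [x [y [Sx Sy xy1 xyz hx]]] : exists x y, [/\ S x, S y, `|g1 x| <= `|g1 y|,
    `|y - x| = `|x2 - x1| & `|x1 - x| <= `|x2 - x1|].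
  have [h|h] := leP `|g1 x1| `|g1 x2|.
    by exists x1, x2; split => //; rewrite subrr normr0.
  by exists x2, x1; split => //; [exact: ltW|rewrite distrC|rewrite distrC].
set z := `|x2 - x1| in hx2 xyz hx.
have z0 : 0 <= z by rewrite /z.
have [xab gx g1x] := hS _ Sx.
have [yab gy g1y] := hS _ Sy.
have low : c * (k * z ^+ 2 + `|g1 x| * z) <= 2 * eps * G0.
  have := L1 x y xab yab (side _ _ Sx Sy) xy1; rewrite xyz.
  have := ler_normB (g y) (g x); lra.
have kz : c * (k * z) <= 2 * eps * G1.
  have /andP[] := L3 x y xab yab; rewrite xyz.
  have := ler_normB (g1 y) (g1 x); lra.
exists x, z; split=> //.
  move=> t St; have := hx2 t St; have := ler_distD x1 t x; lra.
move=> t tab tx; set h := `|t - x| in tx.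
have h0 : 0 <= h by rewrite /h.
have lz : 0 <= lam * z by exact: mulr_ge0.
have hh : h ^+ 2 <= lam ^+ 2 * z ^+ 2 by rewrite -exprMn ler_pXn2r// nnegrE.
have gg0 : 0 <= `|g1 x| by [].
have hl : h <= lam ^+ 2 * z.
  apply: (le_trans tx); apply: ler_wpM2r => //; rewrite expr2 ler_peMl//.
  by apply: le_trans lam3; rewrite ler1n.
have up : k * h ^+ 2 + `|g1 x| * h <= lam ^+ 2 * (k * z ^+ 2 + `|g1 x| * z).
  have : k * h ^+ 2 <= k * (lam ^+ 2 * z ^+ 2) by apply: ler_wpM2l.
  have : `|g1 x| * h <= `|g1 x| * (lam ^+ 2 * z) by apply: ler_wpM2l.
  by clear; lra.
have l20 : 0 <= lam ^+ 2 by exact: sqr_ge0.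
have key : C * (lam ^+ 2 * (2 * eps)) <= c * rho / 2 by move: hlam; clear; lra.
split.
  have := L2 x t xab tab; rewrite -/h => d.
  have : c * `|g t - g x| <= c * (rho * G0 / 2).
    have : c * `|g t - g x| <= c * (C * (lam ^+ 2 * (k * z ^+ 2 + `|g1 x| * z))).
      by apply: ler_wpM2l => //; apply: (le_trans d); apply: ler_wpM2l.
    move=> /le_trans; apply.
    have -> : c * (C * (lam ^+ 2 * (k * z ^+ 2 + `|g1 x| * z))) =
      C * lam ^+ 2 * (c * (k * z ^+ 2 + `|g1 x| * z)) by ring.
    apply: le_trans (_ : C * lam ^+ 2 * (2 * eps * G0) <= _).
      by apply: ler_wpM2l => //; apply: mulr_ge0.
    have : C * (lam ^+ 2 * (2 * eps)) * G0 <= c * rho / 2 * G0 by apply: ler_wpM2r.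
    by clear; lra.
  rewrite ler_pM2l// => d2.
  have : `|g t| <= `|g t - g x| + `|g x| by have := ler_normD (g t - g x) (g x); rewrite subrK.
  have : eps * G0 <= rho / 36 * G0 by apply: ler_wpM2r.
  have : 0 < rho * G0 by apply: mulr_gt0.
  by move: gx d2; clear; lra.
have /andP[_] := L3 x t xab tab; rewrite -/h => d.
have : c * `|g1 t - g1 x| <= c * (rho * G1 / 6).
  have : c * `|g1 t - g1 x| <= c * (C * (k * (lam * z))).
    by apply: ler_wpM2l => //; apply: (le_trans d); do 2 apply: ler_wpM2l => //.
  move=> /le_trans; apply.
  have -> : c * (C * (k * (lam * z))) = C * lam * (c * (k * z)) by ring.
  apply: le_trans (_ : C * lam * (2 * eps * G1) <= _).
    by apply: ler_wpM2l => //; apply: mulr_ge0.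
  have e1 : lam <= lam ^+ 2 / 3 by move: lam3; clear; nra.
  have e2 : C * lam * (2 * eps) <= C * (lam ^+ 2 / 3) * (2 * eps).
    by apply: ler_wpM2r; [exact: mulr_ge0|exact: ler_wpM2l].
  have : C * lam * (2 * eps) * G1 <= c * rho / 6 * G1.
    by apply: ler_wpM2r => //; move: key e2; clear; lra.
  by clear; lra.
rewrite ler_pM2l// => d2.
have : `|g1 t| <= `|g1 t - g1 x| + `|g1 x| by have := ler_normD (g1 t - g1 x) (g1 x); rewrite subrK.
have : eps * G1 <= rho / 36 * G1 by apply: ler_wpM2r.
have : 0 < rho * G1 by apply: mulr_gt0.
by move: g1x d2; clear; lra.
Qed.

End sublevel.

(** * Curved arcs and the forms of a lattice vector *)

Section curved.
Context {R : realType}.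
Variables (f f1 : R -> R).

Definition remainder (x y : R) : R := f y - f x - f1 x * (y - x).

(** Stands for f'' of sign [s], bounded and bounded away from 0, but phrased by Taylor remainders so
    that it passes to the inverse function without second derivatives. *)
Definition curved (a b s c C : R) : Prop :=
  [/\ a < b, s * s = 1, 0 < c, c <= 1 <= C
    & forall x y, a <= x <= b -> a <= y <= b ->
        c * (y - x) ^+ 2 <= s * remainder x y <= C * (y - x) ^+ 2].

Variables (a b s c C : R).
Hypothesis hcur : curved a b s c C.

Lemma curved_sign : s = 1 \/ s = -1.
Proof.
have [_ ss _ _ _] := hcur.
have /eqP : (s - 1) * (s + 1) = 0 by ring: ss.
by rewrite mulf_eq0 subr_eq0 addr_eq0 => /orP[/eqP|/eqP]; [left|right].
Qed.

Lemma curved_remainder x y : a <= x <= b -> a <= y <= b ->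
  `|remainder x y| <= C * (y - x) ^+ 2.
Proof.
move=> xab yab; have [_ _ c0 _ /(_ x y xab yab)] := hcur.
have := sqr_ge0 (y - x); move: (_ ^+ 2) (remainder x y) => e r e0.
have ce : 0 <= c * e by apply: mulr_ge0 => //; lra.
by case: curved_sign => ->; rewrite ler_norml; lra.
Qed.

(** The remainders from [x] and from [y] add up to (f1 y - f1 x)(y - x). *)
Lemma curved_slope x y : a <= x <= b -> a <= y <= b ->
  2 * c * (y - x) ^+ 2 <= s * (f1 y - f1 x) * (y - x) <= 2 * C * (y - x) ^+ 2.
Proof.
move=> xab yab; have [_ _ c0 _ h] := hcur.
have := h x y xab yab; have := h y x yab xab.
have -> : s * (f1 y - f1 x) * (y - x) = s * remainder x y + s * remainder y x.
  by rewrite /remainder; ring.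
have -> : (x - y) ^+ 2 = (y - x) ^+ 2 by ring.
lra.
Qed.

Lemma curved_slope_abs x y : a <= x <= b -> a <= y <= b ->
  2 * c * `|y - x| <= `|f1 y - f1 x| <= 2 * C * `|y - x|.
Proof.
move=> xab yab; have := curved_slope xab yab.
have [->|xy] := eqVneq y x; first by rewrite !subrr normr0 !mulr0 lexx.
have n0 : 0 < `|y - x| by rewrite normr_gt0 subr_eq0.
have [_ _ c0 _ _] := hcur.
rewrite -[(y - x) ^+ 2]real_normK ?num_real// => /andP[h1 h2].
have E : s * (f1 y - f1 x) * (y - x) = `|f1 y - f1 x| * `|y - x|.
  rewrite -normrM; have <- : `|s * (f1 y - f1 x) * (y - x)| = `|(f1 y - f1 x) * (y - x)|.
    by rewrite -mulrA normrM; case: curved_sign => ->; rewrite ?normrN normr1 mul1r.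
  rewrite ger0_norm//; apply: le_trans h1; apply: mulr_ge0; [lra|exact: sqr_ge0].
rewrite E in h1 h2.
apply/andP; split; rewrite -(ler_pM2r n0).
  by move: h1; rewrite expr2 !mulrA.
by move: h2; rewrite expr2 !mulrA.
Qed.

Section tau.
Variables (q u v : R).
(** Formally alpha' = - q and tau' = - f'' alpha, so [tau] behaves like a quadratic polynomial with
    [alpha] in the role of its derivative. *)
Definition alpha (x : R) := u - q * x.
Definition tau (x : R) := v - q * f x - f1 x * alpha x.
Hypothesis q0 : 0 < q.

Lemma tauB x y : tau y - tau x = q * remainder y x - (f1 y - f1 x) * alpha x.
Proof. by rewrite /tau /remainder /alpha; ring. Qed.

(** The hypotheses on [alpha] say that it moves away from 0 between [x] and [y]; then the remainder
    and the slope term have the same sign and nothing cancels. *)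
Lemma tau_lower x y : a <= x <= b -> a <= y <= b ->
  0 <= alpha x * alpha y -> `|alpha x| <= `|alpha y| ->
  c * (q * `|y - x| ^+ 2 + `|alpha x| * `|y - x|) <= `|tau y - tau x|.
Proof.
move=> xab yab side le; have [_ _ c0 _ h] := hcur.
have [->|yx] := eqVneq y x; first by rewrite !subrr normr0 expr0n/= !mulr0 addr0 mulr0.
have yx0 : y - x != 0 by rewrite subr_eq0.
have /andP[h1 _] := h y x yab xab.
have /andP[h2 _] := curved_slope xab yab.
have ay : alpha y = alpha x - q * (y - x) by rewrite /alpha; ring.
rewrite real_normK ?num_real//.
have se : s * (tau y - tau x) = q * (s * remainder y x) + s * (f1 y - f1 x) * (- alpha x).
  by rewrite tauB; ring.
have abss : s * (tau y - tau x) <= `|tau y - tau x|.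
  by case: curved_sign => ->; rewrite ?mul1r ?mulN1r ?ler_norm// -normrN ler_norm.
apply: le_trans abss; rewrite se.
have qr : c * (q * (y - x) ^+ 2) <= q * (s * remainder y x).
  have -> : (y - x) ^+ 2 = (x - y) ^+ 2 by ring.
  by rewrite mulrCA ler_pM2l.
rewrite mulrDr; apply: lerD => //.
move: yx0 ay side le h2 q0 c0; clear; move: (y - x) (alpha x) (alpha y) (s * (f1 y - f1 x)) => e A B k eN0 -> side le h2 q0 c0; move: side le h2.
rewrite expr2 mulrA => side le h2.
have kk : 0 < e -> 2 * c * e <= k by move=> e0; move: h2; rewrite ler_pM2r.
have kk' : e < 0 -> k <= 2 * c * e by move=> e0; move: h2; rewrite ler_nM2r.
have [A0|A0|A0] := ltgtP A 0; last by rewrite A0 normr0 !mul0r oppr0 !mulr0.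
- have [e0|e0|e00] := ltgtP e 0; last by rewrite e00 eqxx in eN0.
  + exfalso; move: le; rewrite (ltr0_norm A0).
    have h3 : A - q * e <= 0 by rewrite -(nmulr_rge0 _ A0).
    rewrite (ler0_norm h3); have : q * e < 0 by rewrite pmulr_rlt0.
    lra.
  + rewrite (ltr0_norm A0) (gtr0_norm e0).
    have A0' : 0 <= - A by rewrite oppr_ge0 ltW.
    have := ler_wpM2r A0' (kk e0).
    have : 0 <= c * (- A * e) by rewrite mulr_ge0 ?(ltW c0)// mulr_ge0// ltW.
    lra.
- have [e0|e0|e00] := ltgtP e 0; last by rewrite e00 eqxx in eN0.
  + rewrite (gtr0_norm A0) (ltr0_norm e0).
    have A0' : - A <= 0 by rewrite oppr_le0 ltW.
    have := ler_wnM2r A0' (kk' e0).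
    have : 0 <= c * (A * - e) by rewrite mulr_ge0 ?(ltW c0)// mulr_ge0// ?oppr_ge0 ltW.
    lra.
  + exfalso; move: le; rewrite (gtr0_norm A0).
    have h3 : 0 <= A - q * e by rewrite -(pmulr_rge0 _ A0).
    rewrite (ger0_norm h3); have : 0 < q * e by rewrite mulr_gt0.
    lra.
Qed.

Lemma tau_upper x y : a <= x <= b -> a <= y <= b ->
  `|tau y - tau x| <= 2 * C * (q * `|y - x| ^+ 2 + `|alpha x| * `|y - x|).
Proof.
move=> xab yab; have [_ _ c0 /andP[c1 C1] _] := hcur.
have h1 := curved_remainder yab xab.
have /andP[_ h2] := curved_slope_abs xab yab.
rewrite tauB real_normK ?num_real//.
apply: le_trans (ler_normB _ _) _; rewrite !normrM (gtr0_norm q0).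
have : q * `|remainder y x| <= q * (C * (y - x) ^+ 2).
  by rewrite ler_pM2l// (_ : (y - x) ^+ 2 = (x - y) ^+ 2)//; ring.
have : `|f1 y - f1 x| * `|alpha x| <= 2 * C * `|y - x| * `|alpha x| by apply: ler_wpM2r.
have : 0 <= q * (C * (y - x) ^+ 2).
  by apply: mulr_ge0; [exact: ltW|apply: mulr_ge0; [lra|exact: sqr_ge0]].
lra.
Qed.

Lemma alpha_diff x y : c * (q * `|y - x|) <= `|alpha y - alpha x| <= 2 * C * (q * `|y - x|).
Proof.
have [_ _ c0 /andP[c1 C1] _] := hcur.
have -> : alpha y - alpha x = q * (x - y) by rewrite /alpha; ring.
rewrite normrM distrC (gtr0_norm q0).
have : 0 <= q * `|x - y| by apply: mulr_ge0 => //; exact: ltW.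
move=> X0; apply/andP; split; first exact: ler_piMl.
by apply: ler_peMl => //; lra.
Qed.

End tau.

Section dual.
Variables (c0 c1 c2 : R).
(** A dual vector is a line c0 + c1 X + c2 Y = 0; [Fd] is its value on the curve and [Fd1] the
    derivative of that. The pair obeys the same estimates as ([tau], [alpha]). *)
Definition Fd (x : R) := c0 + c1 * x + c2 * f x.
Definition Fd1 (x : R) := c1 + c2 * f1 x.
Hypothesis c20 : 0 <= c2.

Lemma FdB x y : Fd y - Fd x = Fd1 x * (y - x) + c2 * remainder x y.
Proof. by rewrite /Fd /Fd1 /remainder; ring. Qed.

(** Cancellation is excluded as for [tau]; when [c2 = 0] the function is affine and only the linear
    term remains. *)
Lemma Fd_lower x y : a <= x <= b -> a <= y <= b ->
  0 <= Fd1 x * Fd1 y -> `|Fd1 x| <= `|Fd1 y| ->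
  c * (c2 * `|y - x| ^+ 2 + `|Fd1 x| * `|y - x|) <= `|Fd y - Fd x|.
Proof.
move=> xab yab side le; have [_ ss cc0 /andP[c1' C1] h] := hcur.
have [c2z|c2n0] := eqVneq c2 0.
  rewrite FdB c2z !mul0r add0r addr0 normrM.
  by rewrite ler_piMl.
have c2p : 0 < c2 by rewrite lt_def c2n0.
have /andP[h1 _] := h x y xab yab.
have /andP[h2 _] := curved_slope xab yab.
rewrite real_normK ?num_real//.
have se : s * (Fd y - Fd x) = Fd1 x * (s * (y - x)) + c2 * (s * remainder x y).
  by rewrite FdB; ring.
have abss : s * (Fd y - Fd x) <= `|Fd y - Fd x|.
  by case: curved_sign => ->; rewrite ?mul1r ?mulN1r ?ler_norm// -normrN ler_norm.
apply: le_trans abss; rewrite se addrC mulrDr; apply: lerD; last first.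
  by rewrite mulrCA ler_pM2l.
have m1 : 2 * c * c2 * (y - x) ^+ 2 <= (Fd1 y - Fd1 x) * (s * (y - x)).
  have -> : (Fd1 y - Fd1 x) * (s * (y - x)) = c2 * (s * (f1 y - f1 x) * (y - x)).
    by rewrite /Fd1; ring.
  by rewrite -(ler_pM2l c2p) in h2; lra.
have nse : `|y - x| = `|s * (y - x)|.
  by rewrite normrM; case: curved_sign => ->; rewrite ?normrN normr1 mul1r.
have sse : (y - x) ^+ 2 = (s * (y - x)) ^+ 2 by rewrite exprMn [s ^+ 2]expr2 ss mul1r.
rewrite nse; move: m1 side le; rewrite sse.
move: (s * (y - x)) (Fd1 x) (Fd1 y) => e A B m1 side le.
have [->|e0] := eqVneq e 0; first by rewrite normr0 !mulr0.
have e2 : 0 < 2 * c * c2 * e ^+ 2 by apply: mulr_gt0; [apply: mulr_gt0 => //; exact: mulr_gt0|rewrite exprn_even_gt0].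
have p : 0 < (B - A) * e by lra.
have [A0|A0|->] := ltgtP A 0; last by rewrite normr0 !mul0r mulr0.
- have B0 : B <= 0 by rewrite -(nmulr_rge0 _ A0).
  move: le; rewrite (ltr0_norm A0) (ler0_norm B0) => le.
  have e1 : e < 0.
    rewrite ltNge; apply/negP => e1.
    have BA : B - A <= 0 by lra.
    by have := mulr_le0_ge0 BA e1; rewrite leNgt p.
  rewrite (ltr0_norm e1) mulrNN; apply: ler_piMl => //.
  by rewrite nmulr_rge0// ltW.
- have B0 : 0 <= B by rewrite -(pmulr_rge0 _ A0).
  move: le; rewrite (gtr0_norm A0) (ger0_norm B0) => le.
  have e1 : 0 < e.
    rewrite ltNge; apply/negP => e1.
    have BA : 0 <= B - A by lra.
    by have := mulr_ge0_le0 BA e1; rewrite leNgt p.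
  rewrite (gtr0_norm e1); apply: ler_piMl => //.
  by rewrite mulr_ge0// ltW.
Qed.

Lemma Fd_upper x y : a <= x <= b -> a <= y <= b ->
  `|Fd y - Fd x| <= 2 * C * (c2 * `|y - x| ^+ 2 + `|Fd1 x| * `|y - x|).
Proof.
move=> xab yab; have [_ _ cc0 /andP[c1' C1] _] := hcur.
have h1 := curved_remainder xab yab.
rewrite FdB real_normK ?num_real//.
apply: le_trans (ler_normD _ _) _; rewrite !normrM (ger0_norm c20).
have h := ler_wpM2l c20 h1; rewrite [leRHS]mulrCA in h.
have p1 : 0 <= `|Fd1 x| * `|y - x| by apply: mulr_ge0.
have p2 : 0 <= c2 * (y - x) ^+ 2 by apply: mulr_ge0 => //; exact: sqr_ge0.
move: p1 p2 C1 h; clear; move: (c2 * _ ^+ 2) (`|Fd1 x| * _) => X Y Y0 X0 C1 h.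
have : Y <= C * Y by exact: ler_peMl.
have : 0 <= C * Y by apply: mulr_ge0 => //; lra.
have : 0 <= C * X by apply: mulr_ge0 => //; lra.
lra.
Qed.

Lemma Fd1_diff x y : a <= x <= b -> a <= y <= b ->
  c * (c2 * `|y - x|) <= `|Fd1 y - Fd1 x| <= 2 * C * (c2 * `|y - x|).
Proof.
move=> xab yab; have [_ _ cc0 /andP[c1' C1] _] := hcur.
have := curved_slope_abs xab yab.
have -> : Fd1 y - Fd1 x = c2 * (f1 y - f1 x) by rewrite /Fd1; ring.
rewrite normrM (ger0_norm c20) => /andP[h1 h2].
have : 0 <= `|y - x| by [].
have := ler_wpM2l c20 h1; have := ler_wpM2l c20 h2.
have : 0 <= c2 * `|y - x| by apply: mulr_ge0.
move=> p; have : 0 <= c * (c2 * `|y - x|) by apply: mulr_ge0 => //; lra.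
lra.
Qed.

End dual.

End curved.

(** * One step of the alternation, common to lattice and dual *)

Section nondivergence_step.
Context {R : realType} (T : countType).
Notation mu := (@lebesgue_measure R).
Variables (idx : T -> Prop) (cond : R -> T -> Prop) (g g1 : T -> R -> R) (k : T -> R).
Variables (a b c C eps rho lam G0 G1 : R) (D : set R).

Definition small (e : R) (w : T) (x : R) : Prop :=
  [/\ cond e w, `|g w x| < e * G0 & `|g1 w x| < e * G1].

Hypotheses (ab : a < b) (c0 : 0 < c) (cC : c <= C) (e0 : 0 < eps) (lam3 : 3 <= lam)
  (hlam : lam ^+ 2 * (4 * C * eps) <= c * rho) (G00 : 0 < G0) (G10 : 0 < G1).
Hypothesis k0 : forall w, idx w -> 0 <= k w.
Hypothesis condS : forall w, cond eps w -> cond rho w.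
Hypothesis L1 : forall w x y, idx w -> a <= x <= b -> a <= y <= b ->
  0 <= g1 w x * g1 w y -> `|g1 w x| <= `|g1 w y| ->
  c * (k w * `|y - x| ^+ 2 + `|g1 w x| * `|y - x|) <= `|g w y - g w x|.
Hypothesis L2 : forall w x y, idx w -> a <= x <= b -> a <= y <= b ->
  `|g w y - g w x| <= C * (k w * `|y - x| ^+ 2 + `|g1 w x| * `|y - x|).
Hypothesis L3 : forall w x y, idx w -> a <= x <= b -> a <= y <= b ->
  c * (k w * `|y - x|) <= `|g1 w y - g1 w x| <= C * (k w * `|y - x|).
Hypothesis short : forall w (x z : R), idx w -> a <= x <= b -> 0 <= z -> cond eps w ->
  c * (k w * z ^+ 2 + `|g1 w x| * z) <= 2 * eps * G0 ->
  (forall t, a <= t <= b -> `|t - x| <= lam * z ->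
     `|g w t| < rho * G0 /\ `|g1 w t| < rho * G1) ->
  lam * z <= b - a.
Hypothesis excl : forall w w' (t : R), idx w -> idx w' -> w <> w' -> a <= t <= b ->
  small rho w t -> small rho w' t -> D t.

(** Sublevel sets can surround two zeros of a quadratic; cutting by the sign of [g1] gives pieces
    where the lower growth estimate applies. *)
Let S (sd : bool) (w : T) : set R :=
  [set x | [/\ a <= x <= b, small eps w x & if sd then 0 <= g1 w x else g1 w x <= 0]].

(** Each short vector yields one interval, and on its [lam]-fold enlargement the vector is still
    short at level [rho]. Hence two enlargements can meet only inside [D], as the bound for shrunk
    intervals requires. *)
Lemma nondivergence_side (sd : bool) :
  (mu [set x | exists2 w, idx w & S sd w x] <=
   (12 * (b - a) / lam)%:E + 15%:E * mu D)%E.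
Proof.
pose P : set nat := [set n | exists w, [/\ pickle w = n, idx w & S sd w !=set0]].
have H n : exists xz : R * R, P n -> exists w, [/\ pickle w = n, idx w, cond eps w,
   a <= xz.1 <= b & [/\ 0 <= xz.2, lam * xz.2 <= b - a,
    forall t, S sd w t -> `|t - xz.1| <= 3 * xz.2 &
    forall t, a <= t <= b -> `|t - xz.1| <= lam * xz.2 ->
      `|g w t| < rho * G0 /\ `|g1 w t| < rho * G1]].
  have [[w [wn iw Sw]]|nP] := pselect (P n); last by exists (0, 0).
  have [x [z [Sx z0 S3 Sl low]]] := @sublevel_interval R a b c C (k w) eps rho lam G0 G1
    (g w) (g1 w) (S sd w) c0 cC (k0 iw) e0 lam3 hlam G00 G10
    (fun x y => L1 iw) (fun x y => L2 iw) (fun x y => L3 iw)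
    ltac:(by move=> t [? [_ ? ?] _]) ltac:(by move=> x y [_ _]; case: (sd) => hx [_ _] hy;
      [exact: mulr_ge0|exact: mulr_le0]) Sw.
  have [xab [cw _ _] _] := Sx.
  by exists (x, z) => _; exists w; split=> //; split=> //; exact: (short iw xab).
have [xz hxz] := choice H.
apply: le_trans (@shrunk_intervals_bound R a b lam D P (fun n => (xz n).1)
   (fun n => (xz n).2) (ltW ab) lam3 _ _).
- apply: mu_le => x [w iw Sx]; exists (pickle w); first by exists w; split => //; exists x.
  have [_ ] : P (pickle w) /\ P (pickle w) by split; exists w; split => //; exists x.
  move=> /hxz[w' [/(pcan_inj pickleK) -> iw' _ _ [_ _ h _]]]; split; last exact: h.
  by case: Sx.
- by move=> n /hxz[w [_ _ _ ? [? ? _ _]]].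
- move=> n m t /hxz[w [wn iw cw _ [_ _ _ hw]]] /hxz[w' [wm iw' cw' _ [_ _ _ hw']]] nm tab tn tm.
  apply: (excl iw iw') => //.
  + by move=> ww; apply: nm; rewrite -wn -wm ww.
  + by have [? ?] := hw t tab tn; split => //; exact: condS.
  + by have [? ?] := hw' t tab tm; split => //; exact: condS.
Qed.

Lemma nondivergence_step :
  (mu [set x | (a <= x <= b)%R /\ exists2 w, idx w & small eps w x] <=
   2%:E * ((12 * (b - a) / lam)%:E + 15%:E * mu D))%E.
Proof.
have -> : [set x | a <= x <= b /\ exists2 w, idx w & small eps w x] =
  [set x | exists2 w, idx w & S true w x] `|` [set x | exists2 w, idx w & S false w x].
  apply/seteqP; split=> x /=.
    move=> [xab [w iw sw]]; have [h|h] := leP 0 (g1 w x).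
      by left; exists w.
    by right; exists w => //; split => //; exact: ltW.
  by move=> [] [w iw [xab sw _]]; split => //; exists w.
apply: (le_trans (mu_setU _ _)); rewrite (_ : 2%:E = 1%:E + 1%:E)%E -?EFinD//.
rewrite EFinD ge0_muleDl// mul1e; apply: leeD; exact: nondivergence_side.
Qed.

End nondivergence_step.

(** * Primitive integer vectors *)

Section vectors.

Notation vec := (int * int * int)%type.

Definition vdot (u w : vec) : int := u.1.1 * w.1.1 + u.1.2 * w.1.2 + u.2 * w.2.
Definition vscale (k : int) (w : vec) : vec := (k * w.1.1, k * w.1.2, k * w.2).
Definition cross (w w' : vec) : vec :=
  (w.1.2 * w'.2 - w.2 * w'.1.2, w.2 * w'.1.1 - w.1.1 * w'.2, w.1.1 * w'.1.2 - w.1.2 * w'.1.1).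
(** A Bezout witness instead of a gcd: pairing with it reads off the factor between parallel
    vectors. *)
Definition primitive (w : vec) : Prop := exists u, vdot u w = 1.

(** Expansion of the triple product u x (w x w') as (u . w') w - (u . w) w'. *)
Lemma cross0_parallel (u w w' : vec) : cross w w' = (0, 0, 0) ->
  vscale (vdot u w) w' = vscale (vdot u w') w.
Proof.
case: u w w' => [[u0 u1] u2] [[q a] b] [[q' a'] b']; rewrite /cross/= => -[/= h0 h1 h2].
rewrite /vscale/vdot/=; congr (_, _, _); apply/eqP; rewrite -subr_eq0; apply/eqP.
- transitivity (- u1 * (q * a' - a * q') + u2 * (b * q' - q * b')); first ring.
  by rewrite h1 h2 !mulr0 addr0.
- transitivity (u0 * (q * a' - a * q') - u2 * (a * b' - b * a')); first ring.
  by rewrite h0 h2 !mulr0 subr0.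
- transitivity (- u0 * (b * q' - q * b') + u1 * (a * b' - b * a')); first ring.
  by rewrite h0 h1 !mulr0 addr0.
Qed.

Lemma abs1_int (d : int) : `|d|%N = 1%N -> d = 1 \/ d = -1.
Proof. by case: d => [n|n] /= => [->|[->]]; [left|right]. Qed.

Lemma primitive_parallel (w w' : vec) : primitive w -> primitive w' ->
  cross w w' = (0, 0, 0) -> w' = w \/ w' = vscale (-1) w.
Proof.
move=> [u uw] [u' uw'] cr.
have := cross0_parallel u cr; rewrite uw => e.
have {}e : w' = vscale (vdot u w') w.
  by rewrite -e /vscale !mul1r; case: (w') => [[? ?] ?].
have : vdot u' w' = vdot u w' * vdot u' w by rewrite [in LHS]e /vdot/vscale/=; ring.
rewrite uw' => /esym h.
have : (vdot u w' %| 1)%Z by apply/dvdzP; exists (vdot u' w); rewrite mulrC.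
rewrite dvdz1 => /eqP/abs1_int[] k; rewrite e k; [left|by right].
by rewrite /vscale !mul1r; case: (w) => [[? ?] ?].
Qed.

Lemma primitive_decomp (w : vec) : w <> (0, 0, 0) ->
  exists k w0, [/\ primitive w0, w = vscale k w0 & k != 0].
Proof.
case: w => [[q a] b] wn0.
have [u [v e1]] := Bezoutz q a.
have [s [t e2]] := Bezoutz (gcdz q a) b.
set d := gcdz (gcdz q a) b in e2.
have d0 : d != 0.
  apply/negP; rewrite /d gcdz_eq0 gcdz_eq0 => /andP[/andP[/eqP q0 /eqP a0] /eqP b0].
  by apply: wn0; rewrite q0 a0 b0.
have : (d %| gcdz q a)%Z by exact: dvdz_gcdl.
rewrite dvdz_gcd => /andP[/dvdzP[q' hq] /dvdzP[a' ha]].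
have /dvdzP[b' hb] : (d %| b)%Z by exact: dvdz_gcdr.
exists d, (q', a', b'); split => //.
  exists (s * u, s * v, t); rewrite /vdot/=.
  apply: (mulfI d0); rewrite mulr1 -{2}e2 -e1 hq ha hb; ring.
by rewrite /vscale/= hq ha hb ![d * _]mulrC.
Qed.

End vectors.

(** * Short vectors in the lattice and in the dual *)

Section nondivergence.
Context {R : realType}.
Notation mu := (@lebesgue_measure R).
Notation vec := (int * int * int)%type.
Variables (f f1 : R -> R).

Section norms.
Variables (Y0 Y1 Y2 : R).

Definition psmall (e : R) (w : vec) (x : R) : Prop :=
  [/\ `|w.1.1%:~R| < e * Y0,
      `|tau f f1 w.1.1%:~R w.1.2%:~R w.2%:~R x| < e * Y2
    & `|alpha w.1.1%:~R w.1.2%:~R x| < e * Y1].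

(** Each dual coordinate is measured by the size of a 2 x 2 minor, a product of two of the [Y]; when
    [Y0 * Y1 * Y2 = 1] this is the reciprocal of the third. *)
Definition dsmall (e : R) (w : vec) (x : R) : Prop :=
  [/\ `|w.2%:~R| < e * (Y0 * Y1),
      `|Fd f w.1.1%:~R w.1.2%:~R w.2%:~R x| < e * (Y1 * Y2)
    & `|Fd1 f1 w.1.2%:~R w.2%:~R x| < e * (Y0 * Y2)].

Lemma norm_det_lt (p q r s A B : R) (e : R) : `|p| < e * A -> `|q| < e * B ->
  `|r| < e * B -> `|s| < e * A -> `|p * q - r * s| < 2 * e ^+ 2 * (A * B).
Proof.
move=> hp hq hr hs; apply: (le_lt_trans (ler_normB _ _)); rewrite !normrM.
have h1 : `|p| * `|q| < (e * A) * (e * B) by apply: ltr_pM.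
have h2 : `|r| * `|s| < (e * B) * (e * A) by apply: ltr_pM.
have -> : 2 * e ^+ 2 * (A * B) = (e * A) * (e * B) + (e * B) * (e * A) by ring.
exact: ltrD.
Qed.

(** Since (q, alpha, tau) is a unipotent change of (q, a, b), the dual coordinates of the cross
    product are its 2 x 2 minors, up to sign. *)
Lemma psmall_cross e w w' x : psmall e w x -> psmall e w' x ->
  dsmall (2 * e ^+ 2) (cross w w') x.
Proof.
case: w w' => [[q a] b] [[q' a'] b'] [/= q1 t1 a1] [/= q2 t2 a2]; rewrite /dsmall/=.
rewrite !(rmorphB, rmorphM)/=; split.
- have -> : q%:~R * a'%:~R - a%:~R * q'%:~R =
     q%:~R * alpha q'%:~R a'%:~R x - alpha q%:~R a%:~R x * q'%:~R :> R.
    by rewrite /alpha; ring.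
  exact: norm_det_lt.
- set F := Fd _ _ _ _ _.
  have -> : F = alpha q%:~R a%:~R x * tau f f1 q'%:~R a'%:~R b'%:~R x -
     tau f f1 q%:~R a%:~R b%:~R x * alpha q'%:~R a'%:~R x.
    by rewrite /F /Fd /tau /alpha; ring.
  exact: norm_det_lt.
- set F := Fd1 _ _ _ _.
  have -> : F = tau f f1 q%:~R a%:~R b%:~R x * q'%:~R -
     q%:~R * tau f f1 q'%:~R a'%:~R b'%:~R x.
    by rewrite /F /Fd1 /tau /alpha; ring.
  by rewrite (mulrC Y0); exact: norm_det_lt.
Qed.

Lemma dsmall_cross e w w' x : Y0 * Y1 * Y2 = 1 -> dsmall e w x -> dsmall e w' x ->
  psmall (2 * e ^+ 2) (cross w w') x.
Proof.
move=> Y1E.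
case: w w' => [[p0 p1] p2] [[r0 r1] r2] [/= q1 t1 a1] [/= q2 t2 a2]; rewrite /psmall/=.
rewrite !(rmorphB, rmorphM)/=; split.
- have -> : p1%:~R * r2%:~R - p2%:~R * r1%:~R =
     Fd1 f1 p1%:~R p2%:~R x * r2%:~R - p2%:~R * Fd1 f1 r1%:~R r2%:~R x :> R.
    by rewrite /Fd1; ring.
  rewrite (_ : Y0 = Y0 * Y2 * (Y0 * Y1)); last by rewrite -[LHS]mulr1 -Y1E; ring.
  exact: norm_det_lt.
- set F := tau _ _ _ _ _ _.
  have -> : F = Fd f p0%:~R p1%:~R p2%:~R x * Fd1 f1 r1%:~R r2%:~R x -
     Fd1 f1 p1%:~R p2%:~R x * Fd f r0%:~R r1%:~R r2%:~R x.
    by rewrite /F /Fd1 /Fd /tau /alpha; ring.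
  rewrite (_ : Y2 = Y1 * Y2 * (Y0 * Y2)); last by rewrite -[LHS]mulr1 -Y1E; ring.
  exact: norm_det_lt.
- set F := alpha _ _ _.
  have -> : F = p2%:~R * Fd f r0%:~R r1%:~R r2%:~R x - Fd f p0%:~R p1%:~R p2%:~R x * r2%:~R.
    by rewrite /F /Fd /alpha; ring.
  rewrite (_ : Y1 = Y0 * Y1 * (Y1 * Y2)); last by rewrite -[LHS]mulr1 -Y1E; ring.
  exact: norm_det_lt.
Qed.

(** A nonzero integer factor cannot decrease absolute values, so the primitive vector on the line of
    a short vector is short too. *)
Lemma normM_int_lt (k : int) (u v : R) : k != 0 -> `|k%:~R * u| < v -> `|u| < v.
Proof.
move=> k0; apply: le_lt_trans; rewrite normrM ler_peMl//.
by rewrite -intr_norm (ler_int _ 1) -gtz0_ge1 normr_gt0.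
Qed.

Lemma psmall_scale e k w x : k != 0 -> psmall e (vscale k w) x -> psmall e w x.
Proof.
case: w => [[q a] b] k0; rewrite /psmall/vscale/= !rmorphM/= => -[h1 h2 h3]; split.
- exact: normM_int_lt h1.
- apply: (normM_int_lt k0); apply: le_lt_trans h2; rewrite (_ : _ * tau _ _ _ _ _ _ = tau f f1 (k%:~R * q%:~R) (k%:~R * a%:~R) (k%:~R * b%:~R) x)//.
  by rewrite /tau /alpha; ring.
- apply: (normM_int_lt k0); apply: le_lt_trans h3; rewrite (_ : _ * alpha _ _ _ = alpha (k%:~R * q%:~R) (k%:~R * a%:~R) x)//.
  by rewrite /alpha; ring.
Qed.

Lemma dsmall_scale e k w x : k != 0 -> dsmall e (vscale k w) x -> dsmall e w x.
Proof.
case: w => [[q a] b] k0; rewrite /dsmall/vscale/= !rmorphM/= => -[h1 h2 h3]; split.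
- exact: normM_int_lt h1.
- apply: (normM_int_lt k0); apply: le_lt_trans h2; rewrite (_ : _ * Fd _ _ _ _ _ = Fd f (k%:~R * q%:~R) (k%:~R * a%:~R) (k%:~R * b%:~R) x)//.
  by rewrite /Fd; ring.
- apply: (normM_int_lt k0); apply: le_lt_trans h3; rewrite (_ : _ * Fd1 _ _ _ _ = Fd1 f1 (k%:~R * a%:~R) (k%:~R * b%:~R) x)//.
  by rewrite /Fd1; ring.
Qed.

End norms.

End nondivergence.

(** * The recursion between lattice and dual *)

Section nondivergence_rec.
Context {R : realType}.
Notation mu := (@lebesgue_measure R).
Notation vec := (int * int * int)%type.
Variables (f f1 : R -> R) (a b s c C : R).
Hypothesis hcur : curved f f1 a b s c C.

Lemma int_lt1 (z : int) : `|z%:~R : R| < 1 -> z = 0.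
Proof. by rewrite -intr_norm (ltr_int _ _ 1); case: z => [[|n]|n]. Qed.

Lemma intr_ge1 (z : int) : 0 < z -> 1 <= (z%:~R : R).
Proof. by move=> z0; rewrite (ler_int _ 1) -gtz0_ge1. Qed.

Lemma primitive_scaleN1 w : primitive w -> primitive (vscale (-1) w).
Proof.
case: w => [[q a'] b'] [[[u v] t] h]; exists (- u, - v, - t).
transitivity (vdot (u, v, t) (q, a', b')) => //; rewrite /vdot/vscale/=; ring.
Qed.

Lemma vscaleN1K w : vscale (-1) (vscale (-1) w) = w.
Proof. by case: w => [[q a'] b']; rewrite /vscale/= !mulN1r !opprK. Qed.

Variables (Y0 Y1 Y2 : R).

Definition PB (e : R) : set R :=
  [set x | a <= x <= b /\ exists2 w : vec, w <> (0, 0, 0) & psmall f f1 Y0 Y1 Y2 e w x].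
Definition DB (e : R) : set R :=
  [set x | a <= x <= b /\ exists2 w : vec, w <> (0, 0, 0) & dsmall f f1 Y0 Y1 Y2 e w x].

Hypotheses (Y00 : 0 < Y0) (Y10 : 0 < Y1) (Y20 : 0 < Y2) (YE : Y0 * Y1 * Y2 = 1)
  (Y11 : Y1 <= 1) (Y21 : Y2 <= 1) (Yab : 2 * Y1 <= b - a) (Yab2 : Y1 * Y2 < (b - a) ^+ 2).

(** If q = 0, then [alpha] is the integer a, of absolute value below 1; so a = 0, and then [tau] is
    the integer b. *)
Lemma psmall_q_neq0 e w x : e <= 1 -> w <> (0, 0, 0) -> psmall f f1 Y0 Y1 Y2 e w x ->
  w.1.1 != 0.
Proof.
move=> e1; case: w => [[q a'] b'] wn0 [/= h1 h2 h3]; apply/eqP => q0; apply: wn0.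
have Y_1 Y : 0 < Y -> Y <= 1 -> e * Y <= 1.
  move=> ? ?; have [|/ltW ?] := leP e 0; last by apply: mulr_ile1 => //; exact: ltW.
  by move=> ?; apply: le_trans ler01; rewrite mulr_le0_ge0// ltW.
have a0 : a' = 0.
  apply: int_lt1; move: h3; rewrite q0 /alpha mul0r subr0 => /lt_le_trans; apply.
  exact: Y_1.
rewrite q0 a0; congr (_, _, _).
apply: int_lt1; move: h2; rewrite q0 a0 /tau /alpha !mul0r !subr0 mulr0 subr0 => /lt_le_trans; apply.
exact: Y_1.
Qed.

Lemma dsmall_neq0 e w x : 0 < e -> e <= 1 -> w <> (0, 0, 0) -> dsmall f f1 Y0 Y1 Y2 e w x ->
  w.2 != 0 \/ w.1.2 != 0.
Proof.
move=> e0 e1; case: w => [[q a'] b'] wn0 [/= h1 h2 h3].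
have [b0|] := eqVneq b' 0; last by left.
have [a0|] := eqVneq a' 0; last by right.
exfalso; apply: wn0; rewrite b0 a0; congr (_, _, _).
apply: int_lt1; move: h2; rewrite b0 a0 /Fd !mul0r !addr0 => /lt_le_trans; apply.
apply: mulr_ile1 => //; [exact: ltW|by rewrite mulr_ge0// ltW|].
by apply: mulr_ile1 => //; exact: ltW.
Qed.

Section step.
Variables (eps rho lam : R).
Hypotheses (e0 : 0 < eps) (er : eps <= rho) (r1 : rho <= 1) (lam3 : 3 <= lam)
  (hlam : lam ^+ 2 * (4 * (2 * C) * eps) <= c * rho).

Let c0 : 0 < c. Proof. by case: hcur. Qed.
Let C1 : 1 <= C. Proof. by have [_ _ _ /andP[]] := hcur. Qed.
Let c1 : c <= 1. Proof. by have [_ _ _ /andP[]] := hcur. Qed.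
Let cC : c <= 2 * C.
Proof. by apply: (le_trans c1); have := C1; lra. Qed.
Let ab : a < b. Proof. by case: hcur. Qed.
Let all_close (lz x t : R) : a <= x <= b -> b - a < lz -> a <= t <= b -> `|t - x| <= lz.
Proof. by move=> xab h tab; apply: le_trans (ltW h); rewrite ler_distl; lra. Qed.

(** Vectors are normalised to primitive ones with q > 0. Two different ones are not parallel, so
    their cross product is a nonzero dual vector of size 2 rho^2. *)
Lemma PB_step :
  (mu (PB eps) <= 2%:E * ((12 * (b - a) / lam)%:E + 15%:E * mu (DB (2 * rho ^+ 2))))%E.
Proof.
have e1 : eps <= 1 by exact: le_trans r1.
pose idx (w : vec) := primitive w /\ 0 < w.1.1.
have q0 (w : vec) : idx w -> 0 < (w.1.1%:~R : R) by move=> [_ h]; rewrite ltr0z.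
pose cond (e : R) (w : vec) : Prop := `|w.1.1%:~R| < e * Y0.
apply: le_trans (@nondivergence_step R vec idx cond
  (fun w => tau f f1 w.1.1%:~R w.1.2%:~R w.2%:~R) (fun w => alpha w.1.1%:~R w.1.2%:~R)
  (fun w => w.1.1%:~R) a b c (2 * C) eps rho lam Y2 Y1 (DB (2 * rho ^+ 2))
  ab c0 cC e0 lam3 hlam Y20 Y10 _ _ _ _ _ _ _).
- apply: mu_le => x [xab [w wn0 sw]]; split => //.
  have [k [w0 [pw0 ew k0]]] := primitive_decomp wn0.
  move: sw; rewrite ew => /(psmall_scale k0) sw.
  have w0n0 : w0 <> (0, 0, 0) by move=> h; apply: wn0; rewrite ew h /vscale/= !mulr0.
  have := psmall_q_neq0 e1 w0n0 sw; case: ltgtP => // hq _; last first.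
    by exists w0.
  exists (vscale (-1) w0).
    by split; [exact: primitive_scaleN1|rewrite /vscale/= mulN1r oppr_gt0].
  by apply: (@psmall_scale _ _ _ _ _ _ _ (-1)) => //; rewrite vscaleN1K.
- by move=> w /q0/ltW.
- by move=> w /lt_le_trans; apply; apply: ler_wpM2r => //; exact: ltW.
- by move=> w x y /q0 hq xab yab; exact: (tau_lower hcur).
- by move=> w x y /q0 hq xab yab; exact: (tau_upper hcur).
- by move=> w x y /q0 hq _ _; exact: (alpha_diff hcur).
(* An enlarged interval longer than [a, b] would make [alpha] smaller than [Y1] at both ends,
   although it changes by q (b - a) >= b - a >= 2 Y1. *)
- move=> w x z iw xab z0 _ _ h; rewrite leNgt; apply/negP => hz.
  have aa : a <= a <= b by rewrite lexx ltW.
  have bb : a <= b <= b by rewrite lexx ltW.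
  have [_] := h a aa (all_close xab hz aa); have [_] := h b bb (all_close xab hz bb).
  have [_ /intr_ge1 q1] := iw; rewrite /alpha !ltr_norml.
  move: (w.1.1%:~R) (w.1.2%:~R) q1 => q u q1 /andP[h1 h2] /andP[h3 h4].
  have : b - a <= q * (b - a) by apply: ler_peMl => //; rewrite subr_ge0 ltW.
  have : rho * Y1 <= Y1 by apply: ler_piMl => //; exact: ltW.
  move: Yab h1 h2 h3 h4; lra.
- move=> w w' t [pw qw] [pw' qw'] ww' tab sw sw'; split => //.
  exists (cross w w'); last exact: psmall_cross.
  move=> h; have [//|h'] := primitive_parallel pw pw' h; first by move=> h'; apply: ww'.
  by move: qw'; rewrite h' /vscale/= mulN1r oppr_gt0 ltNge (ltW qw).
Qed.

Lemma DB_step :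
  (mu (DB eps) <= 2%:E * ((12 * (b - a) / lam)%:E + 15%:E * mu (PB (2 * rho ^+ 2))))%E.
Proof.
have e1 : eps <= 1 by exact: le_trans r1.
pose idx (w : vec) := primitive w /\ (0 < w.2 \/ (w.2 = 0 /\ 0 < w.1.2)).
have k0 (w : vec) : idx w -> 0 <= (w.2%:~R : R).
  by move=> [_ [h|[-> _]]] //; rewrite ler0z ltW.
pose cond (e : R) (w : vec) : Prop := `|w.2%:~R| < e * (Y0 * Y1).
apply: le_trans (@nondivergence_step R vec idx cond
  (fun w => Fd f w.1.1%:~R w.1.2%:~R w.2%:~R) (fun w => Fd1 f1 w.1.2%:~R w.2%:~R)
  (fun w => w.2%:~R) a b c (2 * C) eps rho lam (Y1 * Y2) (Y0 * Y2) (PB (2 * rho ^+ 2))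
  ab c0 cC e0 lam3 hlam (mulr_gt0 Y10 Y20) (mulr_gt0 Y00 Y20) _ _ _ _ _ _ _).
- apply: mu_le => x [xab [w wn0 sw]]; split => //.
  have [k [w0 [pw0 ew kn0]]] := primitive_decomp wn0.
  move: sw; rewrite ew => /(dsmall_scale kn0) sw.
  have w0n0 : w0 <> (0, 0, 0) by move=> h; apply: wn0; rewrite ew h /vscale/= !mulr0.
  have swN : dsmall f f1 Y0 Y1 Y2 eps (vscale (-1) w0) x.
    by apply: (@dsmall_scale _ _ _ _ _ _ _ (-1)) => //; rewrite vscaleN1K.
  have pN := primitive_scaleN1 pw0.
  case: (ltgtP w0.2 0) => h2.
  + by exists (vscale (-1) w0) => //; split => //; left; rewrite /vscale/= mulN1r oppr_gt0.
  + by exists w0 => //; split => //; left.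
  + have [|] := dsmall_neq0 e0 e1 w0n0 sw; first by rewrite h2 eqxx.
    case: ltgtP => // h1 _.
      exists (vscale (-1) w0) => //; split => //; right.
      by rewrite /vscale/= h2 mulr0 mulN1r oppr_gt0.
    by exists w0 => //; split => //; right.
- exact: k0.
- move=> w /lt_le_trans; apply; apply: ler_wpM2r => //.
  by rewrite mulr_ge0// ltW.
- by move=> w x y /k0 hq xab yab; exact: (Fd_lower hcur).
- by move=> w x y /k0 hq xab yab; exact: (Fd_upper hcur).
- by move=> w x y /k0 hq xab yab; exact: (Fd1_diff hcur).
(* Here the growth estimate limits the length: if the last coordinate is at least 1, then (lam z)^2
   <= Y1 Y2; otherwise the middle one is at least 1 and lam z <= Y1. Both contradict the lower
   bounds on b - a. *)
- move=> w x z iw xab z0 _ low _; rewrite leNgt; apply/negP => hz.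
  have lam0 : 0 < lam by apply: lt_le_trans lam3.
  have b0 : 0 < b - a by rewrite subr_gt0.
  have G0 : 0 < Y1 * Y2 by exact: mulr_gt0.
  have hG : lam ^+ 2 * (2 * eps * (Y1 * Y2)) <= c * (Y1 * Y2).
    have -> : lam ^+ 2 * (2 * eps * (Y1 * Y2)) = lam ^+ 2 * (2 * eps) * (Y1 * Y2) by ring.
    rewrite ler_pM2r//.
    have : c * rho <= c by apply: ler_piMr => //; exact: ltW.
    have : lam ^+ 2 * (2 * eps) <= lam ^+ 2 * (4 * (2 * C) * eps).
      by apply: ler_wpM2l; [exact: sqr_ge0|rewrite ler_pM2r//; have := C1; lra].
    by move: hlam; lra.
  have lz2 : (b - a) ^+ 2 < lam ^+ 2 * z ^+ 2.
    by rewrite -exprMn ltr_pXn2r// nnegrE ltW// (lt_trans b0).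
  have key : lam ^+ 2 * (w.2%:~R * z ^+ 2 + `|Fd1 f1 w.1.2%:~R w.2%:~R x| * z) <= Y1 * Y2.
    rewrite -(ler_pM2l c0); apply: le_trans hG.
    by rewrite mulrCA ler_wpM2l// sqr_ge0.
  have A0 : 0 <= `|Fd1 f1 w.1.2%:~R w.2%:~R x| * z by exact: mulr_ge0.
  case: iw => _ [/intr_ge1 h|[h2 /intr_ge1 h1]].
    have : lam ^+ 2 * z ^+ 2 <= lam ^+ 2 * (w.2%:~R * z ^+ 2 + `|Fd1 f1 w.1.2%:~R w.2%:~R x| * z).
      apply: ler_wpM2l; first exact: sqr_ge0.
      by apply: ler_wpDr => //; apply: ler_peMl => //; exact: sqr_ge0.
    by move: key lz2 Yab2; lra.
  move: key; rewrite h2 mul0r add0r /Fd1 mul0r addr0 ger0_norm; last exact: le_trans h1.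
  have lamlz : lam * z <= lam ^+ 2 * (w.1.2%:~R * z).
    have -> : lam ^+ 2 * (w.1.2%:~R * z) = (lam * w.1.2%:~R) * (lam * z) by ring.
    apply: ler_peMl; first by rewrite mulr_ge0// ltW.
    by apply: mulr_ege1 => //; apply: le_trans lam3; rewrite ler1n.
  have : Y1 * Y2 <= Y1 by apply: ler_piMr => //; exact: ltW.
  by move: Yab hz lamlz Y10; lra.
- move=> w w' t [pw qw] [pw' qw'] ww' tab sw sw'; split => //.
  exists (cross w w'); last exact: dsmall_cross.
  move=> h; have [//|h'] := primitive_parallel pw pw' h; first by move=> h'; apply: ww'.
  move: qw'; rewrite h' /vscale/= !mulN1r; case: qw => [h1 [|[]]|[h1 h2] [|[]]].
  + by rewrite oppr_gt0 ltNge (ltW h1).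
  + by move=> /eqP; rewrite oppr_eq0 gt_eqF.
  + by rewrite h1 oppr0 ltxx.
  + by rewrite oppr_gt0 ltNge (ltW h2).
Qed.

End step.

Lemma PB_empty e : 0 < e -> e <= 1 -> e * Y0 <= 1 -> PB e = set0.
Proof.
move=> e0 e1 eY; rewrite -subset0 => x [_ [w wn0 sw]].
have := psmall_q_neq0 e1 wn0 sw; case: sw => h _ _ /negP; apply.
by apply/eqP/int_lt1/(lt_le_trans h).
Qed.

Lemma DB_empty e : 0 < e -> e <= 1 -> e * Y0 <= 1 -> DB e = set0.
Proof.
move=> e0 e1 eY; rewrite -subset0 => x [_ [w wn0 sw]].
have eY' Y : 0 < Y -> Y <= 1 -> e * (Y0 * Y) <= 1.
  by move=> ? ?; rewrite mulrA; apply: mulr_ile1 => //; [apply: mulr_ge0|]; exact: ltW.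
have := dsmall_neq0 e0 e1 wn0 sw; case: sw => h _ h1.
have h2 : w.2 = 0 by apply/int_lt1/(lt_le_trans h)/eY'.
case=> /eqP; first by [].
by apply; apply/int_lt1; move: h1; rewrite h2 /Fd1 mul0r addr0 => /lt_le_trans; apply; exact: eY'.
Qed.

Lemma PB_mono e e' : e <= e' -> PB e `<=` PB e'.
Proof.
move=> ee x [xab [w wn0 [h1 h2 h3]]]; split => //; exists w => //.
by split; [apply: lt_le_trans h1 _|apply: lt_le_trans h2 _|apply: lt_le_trans h3 _];
  apply: ler_wpM2r => //; exact: ltW.
Qed.

Lemma DB_mono e e' : e <= e' -> DB e `<=` DB e'.
Proof.
move=> ee x [xab [w wn0 [h1 h2 h3]]]; split => //; exists w => //.
by split; [apply: lt_le_trans h1 _|apply: lt_le_trans h2 _|apply: lt_le_trans h3 _];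
  apply: ler_wpM2r => //; apply: mulr_ge0; exact: ltW.
Qed.

(** With lam = c / (8 C z), the term 2 * 12 / lam of a step equals [ndK * z]. *)
Definition ndK : R := 192 * C / c.

Lemma ndK_ge : 192 <= ndK.
Proof.
have [_ _ c0 /andP[c1 C1] _] := hcur.
rewrite /ndK ler_pdivlMr//; lra.
Qed.

(** A step is run with eps = z^8, rho = z^6, lam = c / (8 C z). It leads to a box of size 2 z^12 on
    the other side, at most (z / (4 K))^8 because z (4 K)^3 <= 1 and 2 z <= 1, so induction applies
    to z / (4 K). The bound becomes K z + 30 * 2 K z / (4 K) = (K + 15) z times the length, below 2
    K z. The base case has no vector at all. *)
Lemma nondivergence_both n z : 0 < z -> z <= (4 * ndK) ^- 3 ->
  (z / (4 * ndK) ^+ n) ^+ 8 * Y0 <= 1 ->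
  (mu (PB (z ^+ 8)) <= (2 * ndK * z * (b - a))%:E)%E /\
  (mu (DB (z ^+ 8)) <= (2 * ndK * z * (b - a))%:E)%E.
Proof.
have [ab _ c0 /andP[c1 C1] _] := hcur.
have K192 := ndK_ge; set K := ndK in K192 *.
have K4 : 1 <= 4 * K by lra.
have K40 : 0 < 4 * K by lra.
elim: n z => [|n IH] z z0 zz hn.
  have z1 : z <= 1.
    by apply: (le_trans zz); rewrite invf_le1 ?exprn_gt0// exprn_ege1.
  have z81 : z ^+ 8 <= 1 by apply: exprn_ile1 => //; exact: ltW.
  have z80 : 0 < z ^+ 8 by apply: exprn_gt0.
  move: hn; rewrite expr0 divr1 => hn.
  have r0 : 0 <= 2 * K * z * (b - a).
    by rewrite mulr_ge0// ?subr_ge0 ?(ltW ab)// mulr_ge0 ?(ltW z0)//; lra.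
  by rewrite PB_empty// DB_empty// measure0 lee_fin.
pose z' := z / (4 * K).
have z'0 : 0 < z' by apply: divr_gt0.
have z'z : z' <= z by rewrite /z' ler_pdivrMr// ler_peMr// ltW.
have z'h : (z' / (4 * K) ^+ n) ^+ 8 * Y0 <= 1.
  have <- : z / (4 * K) ^+ n.+1 = z' / (4 * K) ^+ n.
    by rewrite /z' exprS [(4 * K * _)^-1]invfM mulrA.
  by [].
have [IH1 IH2] := IH z' z'0 (le_trans z'z zz) z'h.
have zK : z * K <= 1 / 64.
  have : z * (4 * K) ^+ 3 <= 1 by rewrite -ler_pdivlMr ?exprn_gt0// div1r.
  rewrite exprS mulrA => h.
  have : z * (4 * K) <= z * (4 * K) * (4 * K) ^+ 2.
    by apply: ler_peMr; [rewrite mulr_ge0 ?ltW|apply: exprn_ege1].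
  have : 64 * (z * (4 * K)) <= z * (4 * K) * (4 * K) ^+ 2.
    rewrite mulrC; apply: ler_wpM2l; first by rewrite mulr_ge0 ?ltW.
    rewrite expr2; nra.
  lra.
have z1 : z <= 1.
  have : z * 1 <= z * K by rewrite ler_pM2l//; lra.
  lra.
pose kap := c / (8 * C).
have C0 : 0 < C by lra.
have kap0 : 0 < kap by rewrite divr_gt0//; lra.
have kK : kap * K = 24 by rewrite /kap /K /ndK; field; rewrite !gt_eqF.
have kap1 : kap <= 1 / 8 by rewrite /kap ler_pdivrMr; lra.
pose lam := kap / z.
have lam3 : 3 <= lam.
  rewrite /lam ler_pdivlMr//.
  have : 0 < K by lra.
  by move=> K0; rewrite -(ler_pM2r K0) kK; lra.
have e0 : 0 < z ^+ 8 by apply: exprn_gt0.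
have er : z ^+ 8 <= z ^+ 6 by apply: ler_wiXn2l => //; exact: ltW.
have r1 : z ^+ 6 <= 1 by apply: exprn_ile1 => //; exact: ltW.
have hlam : lam ^+ 2 * (4 * (2 * C) * z ^+ 8) <= c * z ^+ 6.
  have -> : lam ^+ 2 * (4 * (2 * C) * z ^+ 8) = kap * (kap * (8 * C)) * z ^+ 6.
    by rewrite /lam; field; rewrite gt_eqF.
  apply: ler_wpM2r; first by rewrite ltW// exprn_gt0.
  rewrite [kap * (8 * C)]divfK ?gt_eqF ?mulr_gt0//.
  by rewrite ler_piMl// ?ltW//; lra.
have e2 : 2 * (z ^+ 6) ^+ 2 <= z' ^+ 8.
  rewrite -exprM /z' expr_div_n ler_pdivlMr ?exprn_gt0//.
  have -> : 2 * z ^+ (6 * 2) * (4 * K) ^+ 8 = z ^+ 8 * (2 * (z * (4 * K)) ^+ 4 * (4 * K) ^+ 4) by ring.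
  rewrite ler_piMr ?(ltW e0)//.
  have h : z * (4 * K) ^+ 3 <= 1 by rewrite -ler_pdivlMr ?exprn_gt0// div1r.
  have -> : 2 * (z * (4 * K)) ^+ 4 * (4 * K) ^+ 4 = (2 * z) * (z * (4 * K) ^+ 3) ^+ 2 * (z * (4 * K) ^+ 2).
    by ring.
  have h2 : z * (4 * K) ^+ 2 <= 1.
    apply: le_trans h; rewrite ler_pM2l// [leRHS]exprS ler_peMl// ?exprn_ge0 ?ltW//; lra.
  have h3 : 2 * z <= 1.
    have : z * 192 <= z * K by rewrite ler_pM2l.
    lra.
  have A0 : 0 <= z * (4 * K) ^+ 3 by apply: mulr_ge0; rewrite ?exprn_ge0// ltW.
  have B0 : 0 <= z * (4 * K) ^+ 2 by apply: mulr_ge0; rewrite ?exprn_ge0// ltW.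
  have z20 : 0 <= 2 * z by apply: mulr_ge0 => //; exact: ltW.
  apply: mulr_ile1 => //; first by rewrite mulr_ge0// sqr_ge0.
  apply: mulr_ile1 => //; first by rewrite sqr_ge0.
  exact: exprn_ile1.
have fin (m : \bar R) : (0 <= m)%E -> (m <= (2 * K * z' * (b - a))%:E)%E ->
   (2%:E * ((12 * (b - a) / lam)%:E + 15%:E * m) <= (2 * K * z * (b - a))%:E)%E.
  move=> m0 hm.
  have -> : m = (fine m)%:E by rewrite fineK// ge0_fin_numE// (le_lt_trans hm)// ltry.
  have : fine m <= 2 * K * z' * (b - a).
    by rewrite -lee_fin fineK// ge0_fin_numE// (le_lt_trans hm)// ltry.
  move=> hm'; rewrite -(EFinM 15) -(EFinD (12 * (b - a) / lam)) -(EFinM 2) lee_fin.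
  have E1 : 12 * (b - a) / lam = K * z * (b - a) / 2.
    have -> : K = 24 / kap by rewrite -kK; field; rewrite gt_eqF.
    by rewrite /lam; field; rewrite !gt_eqF.
  have E2 : 2 * K * z' * (b - a) = z * (b - a) / 2.
    by rewrite /z'; field; rewrite gt_eqF//; lra.
  rewrite E1; rewrite E2 in hm'.
  have : 192 * (z * (b - a)) <= K * (z * (b - a)).
    by apply: ler_wpM2r => //; rewrite mulr_ge0 ?(ltW z0)// subr_ge0 ltW.
  have : 0 <= z * (b - a) by rewrite mulr_ge0 ?(ltW z0)// subr_ge0 ltW.
  by move: hm'; lra.
split.
- apply: (le_trans (PB_step e0 er r1 lam3 hlam)); apply: fin => //.
  by apply: le_trans IH2; apply: mu_le; exact: DB_mono.
- apply: (le_trans (DB_step e0 er r1 lam3 hlam)); apply: fin => //.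
  by apply: le_trans IH1; apply: mu_le; exact: PB_mono.
Qed.

Lemma nondivergence z : 0 < z -> z <= (4 * ndK) ^- 3 ->
  (mu (PB (z ^+ 8)) <= (2 * ndK * z * (b - a))%:E)%E.
Proof.
move=> z0 zz.
have K192 := ndK_ge.
have z1 : z <= 1.
  by apply: (le_trans zz); rewrite invf_le1 ?exprn_gt0// ?exprn_ege1//; lra.
pose n := Num.trunc Y0; have hn : Y0 <= n.+1%:R by rewrite ltW// Num.Theory.truncnS_gt.
have K40 : 0 < 4 * ndK by lra.
have K4n : (n.+1%:R : R) <= (4 * ndK) ^+ n.+1.
  apply: (@le_trans _ _ (2 ^+ n.+1)); last by apply: lerXn2r; rewrite ?nnegrE; lra.
  by rewrite -natrX ler_nat ltnW// ltn_expl.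
have hh : (z / (4 * ndK) ^+ n.+1) ^+ 8 * Y0 <= 1.
  have p0 : 0 < (4 * ndK) ^+ n.+1 by rewrite exprn_gt0.
  set t := z / (4 * ndK) ^+ n.+1.
  have t0 : 0 <= t by rewrite divr_ge0// ltW.
  have t1 : t <= 1 by rewrite /t ler_pdivrMr// mul1r (le_trans z1)// exprn_ege1//; lra.
  have : t ^+ 8 <= t by rewrite -[leRHS]expr1; apply: ler_wiXn2l.
  move=> t8; apply: (@le_trans _ _ (t * Y0)); first by rewrite ler_pM2r.
  rewrite /t mulrAC ler_pdivrMr// mul1r; apply: le_trans (le_trans hn K4n).
  by apply: ler_piMl => //; exact: ltW.
by have [] := nondivergence_both z0 zz hh.
Qed.

End nondivergence_rec.

(** * Pigeonhole and independent vectors *)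

Section pigeonhole.
Context {R : realType}.

Lemma fiber_card_gt (T U : finType) (h : T -> U) (m : nat) : (#|U| * m < #|T|)%N ->
  exists u, (m < #|[set x | h x == u]%SET|)%N.
Proof.
move=> hm; have [//|hu] := pselect (exists u, (m < #|[set x | h x == u]%SET|)%N).
exfalso; move: hm; rewrite ltnNge => /negP; apply.
have -> : (#|U| * m = \sum_(u : U) m)%N by rewrite -sum_nat_const; exact: eq_bigl.
rewrite -[#|T|]sum1_card (partition_big h predT)//=.
apply: (@leq_sum _ (index_enum U) xpredT) => u _; rewrite sum1dep_card leqNgt; apply/negP => h1.
by apply: hu; exists u.
Qed.

(** [inord] sends an index beyond [M] to 0, so equal cells imply closeness only under the bounds of
    [cell_close]. *)
Definition cell (M : nat) (d y : R) : 'I_M.+1 := inord (Num.trunc (y / d)).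

Lemma cell_close M (d y y' : R) : 0 < d -> 0 <= y -> 0 <= y' -> y < M.+1%:R * d -> y' < M.+1%:R * d ->
  cell M d y = cell M d y' -> `|y - y'| < d.
Proof.
move=> d0 y0 y'0 hy hy' /(congr1 val) /=.
have dv t : 0 <= t -> 0 <= t / d by move=> t0; rewrite divr_ge0// ltW.
have tr t : 0 <= t -> t < M.+1%:R * d -> (Num.trunc (t / d) < M.+1)%N.
  by move=> t0 ht; rewrite truncn_lt_nat ?ltr_pdivrMr// dv.
rewrite !inordK ?tr// => e.
have /andP[h1 h2] := truncn_itv (dv _ y0); have /andP[h3 h4] := truncn_itv (dv _ y'0).
move: h1 h2; rewrite e; move: h3 h4; move: (Num.trunc _) => n.
rewrite !ler_pdivlMr// !ltr_pdivrMr// -[n.+1%:R]natr1 => h1 h2 h3 h4.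
rewrite ltr_distl; lra.
Qed.

Lemma int_part (x : R) : exists k : int, k%:~R <= x < k%:~R + 1.
Proof.
exists (Num.floor x); have := floor_itv x; by rewrite intrD.
Qed.

(* The coordinate with the largest normal component is controlled by the other two. *)
Lemma planar_close n (S : {set 'I_n}) M (A B D : 'I_n -> R) (n0 n1 n2 L e : R) :
  0 < e -> n0 != 0 -> `|n1| <= `|n0| -> `|n2| <= `|n0| ->
  (forall i, i \in S -> n0 * A i + n1 * B i + n2 * D i = 0) ->
  (forall i, i \in S -> `|B i| <= L /\ `|D i| <= L) ->
  2 * L < M.+1%:R * (e / 2) -> (M.+1 * M.+1 < #|S|)%N ->
  exists i j, [/\ i \in S, j \in S, i != j, `|A i - A j| < e & `|B i - B j| < e /\ `|D i - D j| < e].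
Proof.
move=> e0 n00 n10 n20 pl bd ML MS.
pose h (i : 'I_n) := (cell M (e / 2) (B i + L), cell M (e / 2) (D i + L)).
have [i [j [iS jS ij hij]]] : exists i j, [/\ i \in S, j \in S, i != j & h i = h j].
  have : ~~ [forall i in S, forall j in S, (h i == h j) ==> (i == j)].
    apply/negP => inj; move: MS; rewrite ltnNge => /negP; apply.
    rewrite -(card_in_imset (f := h)).
      by rewrite (leq_trans (max_card _))// card_prod !card_ord.
    move=> i j iS jS /eqP hij; apply/eqP; move/forall_inP: inj => /(_ i iS)/forall_inP/(_ j jS).
    by rewrite hij.
  rewrite negb_forall => /existsP[i]; rewrite negb_imply => /andP[iS].
  rewrite negb_forall => /existsP[j]; rewrite negb_imply => /andP[jS].
  by rewrite negb_imply => /andP[/eqP hij ij]; exists i, j.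
have [Bi Di] := bd _ iS; have [Bj Dj] := bd _ jS.
have cl (y y' : R) : `|y| <= L -> `|y'| <= L -> cell M (e / 2) (y + L) = cell M (e / 2) (y' + L) ->
  `|y - y'| < e / 2.
  rewrite !ler_norml => /andP[? ?] /andP[? ?] ce.
  have -> : y - y' = (y + L) - (y' + L) by ring.
  by apply: (@cell_close M) => //; lra.
have [hB hD] := hij.
have cB := cl _ _ Bi Bj hB; have cD := cl _ _ Di Dj hD.
exists i, j; split => //; last by split; lra.
have n0p : 0 < `|n0| by rewrite normr_gt0.
rewrite -(ltr_pM2l n0p) -normrM.
have -> : n0 * (A i - A j) = - (n1 * (B i - B j) + n2 * (D i - D j)).
  by have := pl _ iS; have := pl _ jS; lra.
rewrite normrN; apply: (le_lt_trans (ler_normD _ _)); rewrite !normrM.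
have : `|n1| * `|B i - B j| <= `|n0| * `|B i - B j| by apply: ler_wpM2r.
have : `|n2| * `|D i - D j| <= `|n0| * `|D i - D j| by apply: ler_wpM2r.
have : `|n0| * `|B i - B j| < `|n0| * (e / 2) by rewrite ltr_pM2l.
have : `|n0| * `|D i - D j| < `|n0| * (e / 2) by rewrite ltr_pM2l.
lra.
Qed.

Lemma max3 (x y z : R) : [\/ x <= z /\ y <= z, y <= x /\ z <= x | x <= y /\ z <= y].
Proof.
have [h1|h1] := leP x y; have [h2|h2] := leP y z.
- by constructor 1; split => //; exact: le_trans h2.
- by constructor 3; split => //; exact: ltW.
- have [h3|h3] := leP x z; first by constructor 1.
  by constructor 2; split; exact: ltW.
- by constructor 2; split; [exact: ltW|apply: ltW; exact: lt_trans h2 h1].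
Qed.

Definition det3 (a b c : R * R * R) : R :=
  a.1.1 * (b.1.2 * c.2 - b.2 * c.1.2) - a.1.2 * (b.1.1 * c.2 - b.2 * c.1.1)
  + a.2 * (b.1.1 * c.1.2 - b.1.2 * c.1.1).

(** If all triples were dependent, the vectors would lie in a plane; the coordinate with the largest
    normal component is determined by the other two, and pigeonhole on (M + 1)^2 squares gives two
    vectors closer than [e]. *)
Lemma not_coplanar n (S : {set 'I_n}) M (V : 'I_n -> R * R * R) (L e : R) :
  0 < e ->
  (forall i, i \in S -> [/\ `|(V i).1.1| <= L, `|(V i).1.2| <= L & `|(V i).2| <= L]) ->
  2 * L < M.+1%:R * (e / 2) -> (M.+1 * M.+1 < #|S|)%N ->
  (exists2 i, i \in S & (V i).1.1 != 0) ->
  (forall i j, i \in S -> j \in S -> i != j ->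
     ~ [/\ `|(V i).1.1 - (V j).1.1| < e, `|(V i).1.2 - (V j).1.2| < e & `|(V i).2 - (V j).2| < e]) ->
  exists i j k, [/\ i \in S, j \in S, k \in S & det3 (V i) (V j) (V k) != 0].
Proof.
move=> e0 bd ML MS [i0 i0S A0] sep.
apply: contrapT => nd.
have d0 i j k : i \in S -> j \in S -> k \in S -> det3 (V i) (V j) (V k) = 0.
  by move=> iS jS kS; apply: contrapT => /eqP h; apply: nd; exists i, j, k.
suff [n0 [n1 [n2 [nz pl]]]] : exists n0 n1 n2 : R, (n0 != 0 \/ n1 != 0 \/ n2 != 0) /\
   forall i, i \in S -> n0 * (V i).1.1 + n1 * (V i).1.2 + n2 * (V i).2 = 0.
  have z0 (x y : R) : x = 0 -> `|y| <= `|x| -> y = 0.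
    by move=> ->; rewrite normr0 normr_le0 => /eqP.
  case: (max3 `|n0| `|n1| `|n2|) => -[h1 h2].
  - have nn : n2 != 0.
      apply/negP => /eqP h; case: nz => [|[]]; last by rewrite h eqxx.
      + by rewrite (z0 _ _ h h1) eqxx.
      + by rewrite (z0 _ _ h h2) eqxx.
    have [i [j [iS jS ij c1 [c2 c3]]]] := @planar_close n S M (fun i => (V i).2)
      (fun i => (V i).1.1) (fun i => (V i).1.2) n2 n0 n1 L e e0 nn h1 h2
      ltac:(by move=> i iS; rewrite -(pl i iS); ring)
      ltac:(by move=> i /bd[]) ML MS.
    exact: (sep i j).
  - have nn : n0 != 0.
      apply/negP => /eqP h; case: nz => [|[]]; first by rewrite h eqxx.
      + by rewrite (z0 _ _ h h1) eqxx.
      + by rewrite (z0 _ _ h h2) eqxx.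
    have [i [j [iS jS ij c1 [c2 c3]]]] := @planar_close n S M (fun i => (V i).1.1)
      (fun i => (V i).1.2) (fun i => (V i).2) n0 n1 n2 L e e0 nn h1 h2
      ltac:(by move=> i iS; rewrite -(pl i iS); ring)
      ltac:(by move=> i /bd[]) ML MS.
    exact: (sep i j).
  - have nn : n1 != 0.
      apply/negP => /eqP h; case: nz => [|[]].
      + by rewrite (z0 _ _ h h1) eqxx.
      + by rewrite h eqxx.
      + by rewrite (z0 _ _ h h2) eqxx.
    have [i [j [iS jS ij c1 [c2 c3]]]] := @planar_close n S M (fun i => (V i).1.2)
      (fun i => (V i).1.1) (fun i => (V i).2) n1 n0 n2 L e e0 nn h1 h2
      ltac:(by move=> i iS; rewrite -(pl i iS); ring)
      ltac:(by move=> i /bd[]) ML MS.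
    exact: (sep i j).
pose cr (b c : R * R * R) := (b.1.2 * c.2 - b.2 * c.1.2, b.1.1 * c.2 - b.2 * c.1.1,
  b.1.1 * c.1.2 - b.1.2 * c.1.1).
have [[j [k [jS kS h]]]|hn] := pselect (exists j k, [/\ j \in S, k \in S & cr (V j) (V k) <> (0, 0, 0)]).
  exists (cr (V j) (V k)).1.1, (- (cr (V j) (V k)).1.2), (cr (V j) (V k)).2; split.
    rewrite oppr_eq0; move: h; case: (cr _ _) => [[p q] r] /= h.
    have [p0|] := eqVneq p 0; last by left.
    have [q0|] := eqVneq q 0; last by right; left.
    have [r0|] := eqVneq r 0; last by right; right.
    by exfalso; apply: h; rewrite p0 q0 r0.
  by move=> i iS; rewrite -(d0 i j k iS jS kS) /det3 /cr/=; ring.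
exists (- (V i0).1.2), (V i0).1.1, 0; split; first by right; left.
move=> i iS.
have : cr (V i0) (V i) = (0, 0, 0).
  by apply: contrapT => h; apply: hn; exists i0, i.
by rewrite /cr => -[_ _ h]; rewrite mul0r addr0 -h; ring.
Qed.

Lemma round_basis (v1 v2 v3 u : R * R * R) : det3 v1 v2 v3 != 0 ->
  exists k1 k2 k3 : int, exists t1 t2 t3 : R,
  [/\ 0 <= t1 <= 1, 0 <= t2 <= 1, 0 <= t3 <= 1 &
     u = (k1%:~R * v1.1.1 + k2%:~R * v2.1.1 + k3%:~R * v3.1.1 + (t1 * v1.1.1 + t2 * v2.1.1 + t3 * v3.1.1),
          k1%:~R * v1.1.2 + k2%:~R * v2.1.2 + k3%:~R * v3.1.2 + (t1 * v1.1.2 + t2 * v2.1.2 + t3 * v3.1.2),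
          k1%:~R * v1.2 + k2%:~R * v2.2 + k3%:~R * v3.2 + (t1 * v1.2 + t2 * v2.2 + t3 * v3.2))].
Proof.
move=> dn0; set d := det3 v1 v2 v3 in dn0.
(* Coordinates of [u] by Cramer's rule; their integer parts are the [k], their fractional parts the
   [t]. *)
pose r1 := det3 u v2 v3 / d; pose r2 := det3 v1 u v3 / d; pose r3 := det3 v1 v2 u / d.
have [k1 /andP[a1 b1]] := int_part r1; have [k2 /andP[a2 b2]] := int_part r2.
have [k3 /andP[a3 b3]] := int_part r3.
exists k1, k2, k3, (r1 - k1%:~R), (r2 - k2%:~R), (r3 - k3%:~R); split; [lra|lra|lra|].
clear a1 b1 a2 b2 a3 b3; rewrite /r1 /r2 /r3; clear r1 r2 r3; move: dn0; rewrite /d; clear d.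
case: u v1 v2 v3 => [[x y] z] [[x1 y1] z1] [[x2 y2] z2] [[x3 y3] z3]; rewrite /det3/= => dn0.
by congr (_, _, _); field; exact: dn0.
Qed.

End pigeonhole.

(** * From the absence of short vectors to a covering box *)

Section covering.
Context {R : realType}.
Notation vec := (int * int * int)%type.
Variables (f f1 : R -> R) (x Y0 Y1 Y2 e L : R).

Hypotheses (Y00 : 0 < Y0) (Y10 : 0 < Y1) (Y20 : 0 < Y2) (YE : Y0 * Y1 * Y2 = 1)
  (e0 : 0 < e) (e1 : e <= 1) (LE : L = 100 / e ^+ 2) (LY1 : L * Y1 <= 1) (LY2 : L * Y2 <= 1).
Hypothesis good : forall w : vec, w <> (0, 0, 0) -> ~ psmall f f1 Y0 Y1 Y2 e w x.

Let lq (w : vec) : R := w.1.1%:~R.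
Let la (w : vec) : R := alpha w.1.1%:~R w.1.2%:~R x.
Let lt_ (w : vec) : R := tau f f1 w.1.1%:~R w.1.2%:~R w.2%:~R x.

(** A transference argument. For each height up to L Y0 a vector with [alpha] and [tau] in (0, 1] is
    chosen. Pigeonhole puts many into one cell; their mutual differences are not short, hence they
    are separated by [e], and three of them, relative to a base point, are independent. Rounding in
    that basis costs at most 3 L in each scaled coordinate. *)
Lemma lattice_covering (u0 u1 u2 : R) : exists w : vec,
  [/\ `|w.1.1%:~R - u0| <= 3 * L * Y0,
      `|alpha w.1.1%:~R w.1.2%:~R x - u1| <= 3 * L * Y1
    & `|tau f f1 w.1.1%:~R w.1.2%:~R w.2%:~R x - u2| <= 3 * L * Y2].
Proof.
have L0 : 0 < L by rewrite LE divr_gt0// exprn_gt0.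
have L100 : 100 <= L * e.
  by rewrite LE expr2 invfM mulrA mulfVK ?gt_eqF// ler_pdivlMr//; have := e1; lra.
pose n := (Num.trunc (Y0 * L)).+1.
have hn : Y0 * L < n%:R by exact: truncnS_gt.
have hn' (i : 'I_n) : (nat_of_ord i)%:R <= Y0 * L.
  have := ltn_ord i; rewrite ltnS /n truncn_ge_nat//.
  by rewrite mulr_ge0// ltW.
pose A (i : 'I_n) : int := Num.floor ((nat_of_ord i)%:R * x) + 1.
pose al (i : 'I_n) : R := (A i)%:~R - (nat_of_ord i)%:R * x.
have al01 i : 0 < al i <= 1.
  rewrite /al /A intrD; have := floor_itv ((nat_of_ord i)%:R * x); rewrite intrD; lra.
pose B (i : 'I_n) : int := Num.floor ((nat_of_ord i)%:R * f x + f1 x * al i) + 1.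
pose ta (i : 'I_n) : R := (B i)%:~R - (nat_of_ord i)%:R * f x - f1 x * al i.
have ta01 i : 0 < ta i <= 1.
  rewrite /ta /B intrD; have := floor_itv ((nat_of_ord i)%:R * f x + f1 x * al i).
  by rewrite intrD; lra.
pose N1 := Num.trunc (1 / (Y1 * L)); pose N2 := Num.trunc (1 / (Y2 * L)).
pose M := Num.trunc (4 * L / e).
pose h (i : 'I_n) := (cell N1 (Y1 * L) (al i), cell N2 (Y2 * L) (ta i)).
have YL1 : 0 < Y1 * L by rewrite mulr_gt0.
have YL2 : 0 < Y2 * L by rewrite mulr_gt0.
have tS (y : R) : 1 <= y -> ((Num.trunc y).+1%:R : R) <= 2 * y.
  move=> y1; rewrite -natr1; have : (Num.trunc y)%:R <= y by rewrite truncn_le; lra.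
  lra.
have N1b : (N1.+1%:R : R) <= 2 * (1 / (Y1 * L)) by apply: tS; rewrite ler_pdivlMr// mul1r mulrC.
have N2b : (N2.+1%:R : R) <= 2 * (1 / (Y2 * L)) by apply: tS; rewrite ler_pdivlMr// mul1r mulrC.
have Mb : (M.+1%:R : R) <= 5 * L / e.
  rewrite -natr1; have : M%:R <= 4 * L / e.
    by rewrite /M truncn_le divr_ge0// ?mulr_ge0// ltW.
  have : 1 <= L / e.
    rewrite ler_pdivlMr//; have Le : L * e <= L by apply: ler_piMr => //; exact: ltW.
    by have := e1; lra.
  lra.
(* The number of cells times (M + 1)^2 is at most 4 / (Y1 Y2 L^2) * 25 L^2 / e^2 = L / (Y1 Y2) = L
   Y0, which is where L = 100 / e^2 comes from. *)
have [c hc] : exists c, (M.+1 * M.+1 < #|[set i | h i == c]%SET|)%N.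
  apply: fiber_card_gt; rewrite card_prod !card_ord.
  rewrite -(ltr_nat R) !natrM; apply: le_lt_trans hn.
  apply: (@le_trans _ _ ((2 * (1 / (Y1 * L)) * (2 * (1 / (Y2 * L)))) * (5 * L / e * (5 * L / e)))).
    by rewrite ler_pM ?mulr_ge0// ler_pM.
  have -> : 2 * (1 / (Y1 * L)) * (2 * (1 / (Y2 * L))) * (5 * L / e * (5 * L / e)) =
     (Y0 * Y1 * Y2) * (100 / e ^+ 2 / (Y1 * Y2)).
    by rewrite YE; field; rewrite !gt_eqF.
  by rewrite -LE [leLHS](_ : _ = Y0 * L)//; field; rewrite !gt_eqF.
set S := [set i | h i == c]%SET in hc.
have [i0 i0S] : exists i0, i0 \in S.
  by apply/set0Pn; rewrite -card_gt0; apply: leq_ltn_trans hc.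
pose pt (i : 'I_n) : vec := (Posz i - Posz i0, A i - A i0, B i - B i0).
have ptq i : lq (pt i) = (nat_of_ord i)%:R - (nat_of_ord i0)%:R by rewrite /lq/= intrB.
have pta i : la (pt i) = al i - al i0.
  by rewrite /la /alpha/= !intrB -!pmulrn /al; ring.
have ptt i : lt_ (pt i) = ta i - ta i0.
  by rewrite /lt_ /tau /alpha/= !intrB -!pmulrn /ta /al; ring.
have close i j : i \in S -> j \in S -> [/\ `|(nat_of_ord i)%:R - (nat_of_ord j)%:R : R| <= Y0 * L,
   `|al i - al j| < Y1 * L & `|ta i - ta j| < Y2 * L].
  rewrite !inE => /eqP hi /eqP hj; split.
  - have := hn' i; have := hn' j; have : (0 : R) <= (nat_of_ord i)%:R by [].
    have : (0 : R) <= (nat_of_ord j)%:R by [].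
    by rewrite ler_distl; lra.
  - have [e1' _] : h i = h j by rewrite hi.
    have b1 : 1 < N1.+1%:R * (Y1 * L) by rewrite -ltr_pdivrMr// truncnS_gt.
    by apply: (cell_close (M := N1)) => //; have := al01 i; have := al01 j; lra.
  - have [_ e1'] : h i = h j by rewrite hi.
    have b1 : 1 < N2.+1%:R * (Y2 * L) by rewrite -ltr_pdivrMr// truncnS_gt.
    by apply: (cell_close (M := N2)) => //; have := ta01 i; have := ta01 j; lra.
pose V (i : 'I_n) : R * R * R := (lq (pt i) / Y0, la (pt i) / Y1, lt_ (pt i) / Y2).
have nd (y Y : R) : 0 < Y -> `|y / Y| = `|y| / Y.
  by move=> ?; rewrite normrM [`|Y^-1|]gtr0_norm// invr_gt0.
have VL i : i \in S -> [/\ `|(V i).1.1| <= L, `|(V i).1.2| <= L & `|(V i).2| <= L].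
  move=> iS; rewrite /V/= ptq pta ptt !nd// !ler_pdivrMr// ![L * _]mulrC.
  by have [? /ltW ? /ltW ?] := close _ _ iS i0S.
have [|||i [j [k [iS jS kS dn0]]]] := @not_coplanar R n S M V L e e0 VL _ hc _ _.
- have : 4 * L / e < M.+1%:R by exact: truncnS_gt.
  by rewrite ltr_pdivrMr//; lra.
- have : (1 < #|S|)%N by apply: leq_ltn_trans hc.
  rewrite (cardD1 i0) i0S ltnS => /card_gt0P[i]; rewrite !inE => /andP[ii0 iS].
  exists i; first by rewrite inE.
  rewrite /V/= ptq; apply: mulf_neq0; last by rewrite invr_eq0 gt_eqF.
  rewrite subr_eq0 eqr_nat.
  by apply: contra ii0 => /eqP h'; apply/eqP/val_inj.
- move=> i j iS jS ij [c1 c2 c3].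
  pose w : vec := (Posz i - Posz j, A i - A j, B i - B j).
  apply: (good (w := w)).
    move=> [h1 _ _]; move/eqP: ij; apply; apply/val_inj => /=.
    by move/eqP: h1; rewrite subr_eq0 => /eqP [].
  move: c1 c2 c3; rewrite /V/= -!mulrBl !nd// !ltr_pdivrMr// => c1 c2 c3.
  split.
  + by move: c1; rewrite !ptq /w/= intrB -!pmulrn opprB addrA subrK.
  + move: c3; rewrite !ptt (_ : _ - _ - _ = ta i - ta j); last by ring.
    rewrite (_ : ta i - ta j = tau f f1 w.1.1%:~R w.1.2%:~R w.2%:~R x)//.
    by rewrite /tau /alpha /w/= !intrB -!pmulrn /ta /al; ring.
  + move: c2; rewrite !pta (_ : _ - _ - _ = al i - al j); last by ring.
    rewrite (_ : al i - al j = alpha w.1.1%:~R w.1.2%:~R x)//.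
    by rewrite /alpha /w/= !intrB -!pmulrn /al; ring.
have [k1 [k2 [k3 [t1 [t2 [t3 [h1 h2 h3 hu]]]]]]] := round_basis (u0 / Y0, u1 / Y1, u2 / Y2) dn0.
have [c1 c2 c3] := And3 (VL _ iS) (VL _ jS) (VL _ kS).
pose w : vec := (k1 * (pt i).1.1 + k2 * (pt j).1.1 + k3 * (pt k).1.1,
  k1 * (pt i).1.2 + k2 * (pt j).1.2 + k3 * (pt k).1.2,
  k1 * (pt i).2 + k2 * (pt j).2 + k3 * (pt k).2).
have bnd (Y p q r y u : R) : 0 < Y -> `|p / Y| <= L -> `|q / Y| <= L -> `|r / Y| <= L ->
   u / Y = k1%:~R * (p / Y) + k2%:~R * (q / Y) + k3%:~R * (r / Y) + (t1 * (p / Y) + t2 * (q / Y) + t3 * (r / Y)) ->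
   y = k1%:~R * p + k2%:~R * q + k3%:~R * r -> `|y - u| <= 3 * L * Y.
  move=> Yp hp hq hr hu' ->.
  have -> : k1%:~R * p + k2%:~R * q + k3%:~R * r - u =
    - (t1 * (p / Y) + t2 * (q / Y) + t3 * (r / Y)) * Y.
    have -> : u = u / Y * Y by rewrite divfK// gt_eqF.
    by rewrite hu'; field; rewrite gt_eqF.
  rewrite normrM normrN (gtr0_norm Yp) ler_pM2r//.
  have t1l (t y' : R) : 0 <= t <= 1 -> `|y'| <= L -> `|t * y'| <= L.
    move=> /andP[ta' tb'] hy; rewrite normrM (ger0_norm ta').
    by apply: le_trans hy; apply: ler_piMl.
  apply: (le_trans (ler_normD _ _)).
  have := ler_normD (t1 * (p / Y)) (t2 * (q / Y)).
  have := t1l _ _ h1 hp; have := t1l _ _ h2 hq; have := t1l _ _ h3 hr; lra.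
move: hu; rewrite /V/= => -[hu0 hu1 hu2].
case: c1 c2 c3 => [c11 c12 c13] [c21 c22 c23] [c31 c32 c33].
exists w; split.
- apply: (bnd _ _ _ _ _ _ Y00 c11 c21 c31 hu0).
  by rewrite /w /lq; move: (pt i) (pt j) (pt k) => [[? ?] ?] [[? ?] ?] [[? ?] ?] /=; rewrite !intrD !intrM; ring.
- apply: (bnd _ _ _ _ _ _ Y10 c12 c22 c32 hu1).
  by rewrite /w /la /alpha; move: (pt i) (pt j) (pt k) => [[? ?] ?] [[? ?] ?] [[? ?] ?] /=; rewrite !intrD !intrM; ring.
- apply: (bnd _ _ _ _ _ _ Y20 c13 c23 c33 hu2).
  by rewrite /w /lt_ /tau /alpha; move: (pt i) (pt j) (pt k) => [[? ?] ?] [[? ?] ?] [[? ?] ?] /=; rewrite !intrD !intrM; ring.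
Qed.

End covering.

(** * Finite covers *)

Section finite_covers.
Context {R : realType}.
Notation mu := (@lebesgue_measure R).

Lemma exhaustive_seq (T : eqType) (P : T -> Prop) (n : nat) :
  (forall s : seq T, uniq s -> (forall v, v \in s -> P v) -> (size s <= n)%N) ->
  exists2 s : seq T, (size s <= n)%N & forall v, P v -> v \in s.
Proof.
move=> bd.
pose Q := fun k : nat => `[< exists s : seq T, [/\ uniq s, (forall v, v \in s -> P v) & size s = k] >].
have Q0 : exists k, Q k by exists 0%N; apply/asboolP; exists [::].
have Qn k : Q k -> (k <= n)%N by move=> /asboolP[s [us sP <-]]; exact: bd.
case: (ex_maxnP Q0 Qn) => k /asboolP[s [us sP sk]] kmax.
exists s; first exact: bd.
move=> v Pv; apply/negP => /negP vs.
have : Q k.+1.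
  apply/asboolP; exists (v :: s); split=> /=; [by rewrite vs|idtac|by rewrite sk].
  by move=> u; rewrite inE => /orP[/eqP ->//|/sP].
by move=> /kmax; rewrite ltnn.
Qed.

Lemma mu_seq_cover (T : eqType) (s : seq T) (F : T -> set R) (d : R) :
  (forall v, v \in s -> (mu (F v) <= d%:E)%E) ->
  (mu [set x | exists2 v, v \in s & F v x] <= ((size s)%:R * d)%:E)%E.
Proof.
elim: s => [|v s IH] h.
  rewrite mul0r (_ : [set x | _] = set0) ?measure0//.
  by rewrite -subset0 => x [v].
rewrite (_ : [set x | _] = F v `|` [set x | exists2 v, v \in s & F v x]); last first.
  apply/seteqP; split=> x /=.
    by move=> [u]; rewrite inE => /orP[/eqP -> ?|us ?]; [left|right; exists u].
  by move=> [?|[u us ?]]; [exists v => //; rewrite mem_head|exists u => //; rewrite inE us orbT].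
have -> : (size (v :: s))%:R * d = d + (size s)%:R * d by rewrite /= -natr1; ring.
apply: (le_trans (mu_setU _ _)); rewrite EFinD.
apply: leeD; first by apply: h; rewrite mem_head.
by apply: IH => u us; apply: h; rewrite inE us orbT.
Qed.

Lemma mu_diam (A : set R) (d : R) : 0 <= d -> (forall x y, A x -> A y -> `|x - y| <= d) ->
  (mu A <= (2 * d)%:E)%E.
Proof.
move=> d0 h; have [->|/set0P[x Ax]] := eqVneq A set0.
  by rewrite measure0 lee_fin mulr_ge0.
have -> : 2 * d = (x + d) - (x - d) by lra.
apply: mu_le_cc; first lra.
by move=> y Ay; rewrite /= in_itv/= -ler_distl; exact: h.
Qed.

Definition enc (M : nat) (z : int) : 'I_M.+1 := inord `|z|%N.

Lemma enc_inj M (z z' : int) : 0 <= z <= M%:Z -> 0 <= z' <= M%:Z ->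
  enc M z = enc M z' -> z = z'.
Proof.
case: z z' => [n|//] [n'|//] /andP[_ h] /andP[_ h'] /(congr1 val) /=.
by rewrite !inordK//= => ->.
Qed.

End finite_covers.

Lemma int_box_add (q q' : int) (N : nat) : 0 <= q -> q <= (2 * N)%:Z -> `|q'| <= N%:Z ->
  - N%:Z <= q + q' <= (3 * N)%:Z.
Proof. by rewrite ler_norml; lia. Qed.

Lemma int_box_shift (z k : int) (m : nat) : - m%:Z <= z - k -> z - k < m%:Z + 1 ->
  0 <= z - k + m%:Z <= (2 * m)%:Z.
Proof. by lia. Qed.

Lemma int_box_shift3 (q : int) (N : nat) : - N%:Z <= q -> q <= (3 * N)%:Z ->
  0 <= q + N%:Z <= (4 * N)%:Z.
Proof. by lia. Qed.

(** * Counting solutions at a good point *)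

Section counting.
Context {R : realType}.
Notation vec := (int * int * int)%type.
Variables (f f1 : R -> R) (x th1 th2 : R).

(** Inhomogeneous versions of [alpha] and [tau]: adding a lattice vector to [v] adds the homogeneous
    values. *)
Definition sh_alpha (v : vec) : R := alpha v.1.1%:~R v.1.2%:~R x + th1.
Definition sh_tau (v : vec) : R := v.2%:~R + th2 - v.1.1%:~R * f x - f1 x * sh_alpha v.

(* Translating the points by lattice vectors placed at heights j D del gives disjoint copies inside a box of known size. *)
Lemma count_bound (N K : nat) (del C1 : R) (s : seq vec) :
  0 < del -> del <= 1 -> 0 <= C1 -> C1 + 2 <= K%:R ->
  (forall u0 u1 u2 : R, exists w : vec, [/\ `|w.1.1%:~R - u0| <= N%:R,
     `|alpha w.1.1%:~R w.1.2%:~R x - u1| <= 1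
   & `|tau f f1 w.1.1%:~R w.1.2%:~R w.2%:~R x - u2| <= del]) ->
  uniq s ->
  (forall v, v \in s -> [/\ 0 <= v.1.1 <= (2 * N)%:Z, `|sh_alpha v| <= 3 & `|sh_tau v| <= C1 * del]) ->
  (size s)%:R <= ((4 * N).+1 * (9 * (2 * K).+1))%:R * ((2 * C1 + 3) * del).
Proof.
move=> d0 d1 C10 CK cov us sP.
pose D := (2 * C1 + 3) * del.
have D0 : 0 < D by rewrite mulr_gt0//; lra.
pose n := (Num.trunc (1 / D)).+1.
have [w hw] := choice (fun j : 'I_n => cov 0 0 (j%:R * D)).
pose add (i : 'I_(size s)) (j : 'I_n) : vec :=
  let v := nth (0, 0, 0) s i in
  (v.1.1 + (w j).1.1, v.1.2 + (w j).1.2, v.2 + (w j).2).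
have jD (j : 'I_n) : (j : nat)%:R * D <= 1.
  rewrite -ler_pdivlMr// -truncn_ge_nat ?divr_ge0 ?ltW//.
  by have := ltn_ord j; rewrite ltnS.
have addP i j : let v := add i j in [/\ - N%:Z <= v.1.1 <= (3 * N)%:Z, `|sh_alpha v| <= 4,
    `|sh_tau v - j%:R * D| <= (C1 + 1) * del & `|sh_tau v| <= K%:R].
  have [/andP[v1 v1'] v2 v3] := sP _ (mem_nth (0, 0, 0) (ltn_ord i)).
  have [w1 w2 w3] := hw j; rewrite !subr0 in w1 w2.
  rewrite /add; move: (nth _ _ _) v1 v1' v2 v3 => [[q a] b] /= v1 v1' v2 v3.
  move: (w j) w1 w2 w3 => [[q' a'] b'] /= w1 w2 w3.
  have E1 : sh_alpha (q + q', a + a', b + b') = sh_alpha (q, a, b) + alpha q'%:~R a'%:~R x.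
    by rewrite /sh_alpha /alpha/= !intrD; ring.
  have E2 : sh_tau (q + q', a + a', b + b') = sh_tau (q, a, b) + tau f f1 q'%:~R a'%:~R b'%:~R x.
    by rewrite /sh_tau E1 /tau /alpha/= !intrD; ring.
  have h3 : `|sh_tau (q + q', a + a', b + b') - j%:R * D| <= (C1 + 1) * del.
    rewrite E2 -addrA mulrDl mul1r; apply: (le_trans (ler_normD _ _)).
    by apply: lerD.
  split => //.
  - by apply: int_box_add => //; rewrite -(ler_int R) intr_norm.
  - rewrite E1; apply: (le_trans (ler_normD _ _)); lra.
  - have := ler_normD (sh_tau (q + q', a + a', b + b') - j%:R * D) (j%:R * D).
    rewrite subrK [`|j%:R * D|]ger0_norm; last by rewrite mulr_ge0// ltW.
    have := jD j.
    have : (C1 + 1) * del <= C1 + 1 by apply: ler_piMr => //; lra.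
    lra.
pose t1 (q : int) : R := q%:~R * x - th1.
pose t2 (v : vec) : R := v.1.1%:~R * f x + f1 x * sh_alpha v - th2.
(* A translate is encoded by q and by the offsets of a and b from the integer parts of their
   predicted values: 4 N + 1, 9 and 2 K + 1 possibilities. *)
pose h (ij : 'I_(size s) * 'I_n) := let v := add ij.1 ij.2 in
  (enc (4 * N) (v.1.1 + N%:Z), (enc 8 (v.1.2 - Num.floor (t1 v.1.1) + 4),
    enc (2 * K) (v.2 - Num.floor (t2 v) + K%:Z))).
have hinj : injective h.
  move=> [i j] [i' j'] hh.
  have [/andP[a1 b1] a2 a3 a4] := addP i j.
  have [/andP[a1' b1'] a2' a3' a4'] := addP i' j'.
  have [ha hb hc] : [/\ enc (4 * N) ((add i j).1.1 + N%:Z) = enc (4 * N) ((add i' j').1.1 + N%:Z),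
     enc 8 ((add i j).1.2 - Num.floor (t1 (add i j).1.1) + 4) =
     enc 8 ((add i' j').1.2 - Num.floor (t1 (add i' j').1.1) + 4) &
     enc (2 * K) ((add i j).2 - Num.floor (t2 (add i j)) + K%:Z) =
     enc (2 * K) ((add i' j').2 - Num.floor (t2 (add i' j')) + K%:Z)].
    by move: hh; rewrite /h/= => -[].
  have fl (t : R) (z : int) (m : nat) : `|z%:~R - t| <= m%:R ->
      0 <= z - Num.floor t + m%:Z <= (2 * m)%:Z.
    have /andP[f1' f2'] := floor_itv t; rewrite intrD in f2'.
    rewrite ler_norml => /andP[h1 h2].
    apply: int_box_shift.
      by rewrite -(ler_int R) !intrD !intrN -pmulrn; lra.
    by rewrite -(ltr_int R) !intrD !intrN -pmulrn; lra.
  have qE : (add i j).1.1 = (add i' j').1.1.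
    by have /addIr := enc_inj (M := 4 * N) (int_box_shift3 a1 b1) (int_box_shift3 a1' b1') ha.
  have aE : (add i j).1.2 = (add i' j').1.2.
    rewrite qE in hb.
    have aa v : (v.1.2%:~R : R) - t1 v.1.1 = sh_alpha v by rewrite /t1 /sh_alpha /alpha; ring.
    have b2 : `|((add i j).1.2%:~R : R) - t1 (add i' j').1.1| <= 4%N%:R.
      by rewrite -qE aa.
    have b2' : `|((add i' j').1.2%:~R : R) - t1 (add i' j').1.1| <= 4%N%:R.
      by rewrite aa.
    by have /addIr/addIr := enc_inj (M := 8) (fl _ _ _ b2) (fl _ _ _ b2') hb.
  have t2E : t2 (add i j) = t2 (add i' j') by rewrite /t2 /sh_alpha qE aE.
  have bE : (add i j).2 = (add i' j').2.
    have b2 v : `|sh_tau v| <= K%:R -> `|(v.2%:~R : R) - t2 v| <= K%:R.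
      by rewrite (_ : v.2%:~R - t2 v = sh_tau v)// /t2 /sh_tau; ring.
    rewrite t2E in hc.
    have b3 : `|((add i j).2%:~R : R) - t2 (add i' j')| <= K%:R by rewrite -t2E; exact: b2.
    by have /addIr/addIr := enc_inj (M := 2 * K) (fl _ _ _ b3) (fl _ _ _ (b2 _ a4')) hc.
  have vE : add i j = add i' j'.
    by move: qE aE bE; case: (add i j) (add i' j') => [[? ?] ?] [[? ?] ?] /= -> -> ->.
  (* [sh_tau] determines [j]: it lies within (C1 + 1) del of j D, and twice that is less than the
     spacing D = (2 C1 + 3) del. *)
  have jE : j = j'.
    rewrite vE in a3; apply/val_inj => /=.
    have : `|(j : nat)%:R * D - (j' : nat)%:R * D| < D.
      have := ler_distD (sh_tau (add i' j')) (j%:R * D) (j'%:R * D).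
      rewrite (distrC (j%:R * D) (sh_tau _)).
      move=> h'; apply: (le_lt_trans h').
      apply: (@le_lt_trans _ _ ((C1 + 1) * del + (C1 + 1) * del)); first exact: lerD.
      by rewrite /D; lra.
    rewrite -mulrBl normrM (gtr0_norm D0) -[ltRHS]mul1r ltr_pM2r// ltr_distl.
    move=> /andP[h1 h2]; apply/eqP; rewrite eqn_leq; apply/andP; split.
      by rewrite -ltnS -(ltr_nat R) -natr1.
    by rewrite -ltnS -(ltr_nat R) -natr1 -ltrBlDr.
  congr (_, _) => //; apply/val_inj; rewrite jE in vE.
  have : nth (0, 0, 0) s i = nth (0, 0, 0) s i'.
    move: vE; rewrite /add => -[/addIr + /addIr + /addIr].
    by case: (nth _ s i) (nth _ s i') => [[? ?] ?] [[? ?] ?] /= -> -> ->.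
  by move=> /eqP; rewrite nth_uniq// => /eqP.
have := leq_card _ hinj; rewrite !card_prod !card_ord => card.
have n1 : 1 <= n%:R * D by rewrite -ler_pdivrMr// ltW// truncnS_gt.
apply: (@le_trans _ _ ((size s)%:R * (n%:R * D))); first exact: ler_peMr.
rewrite mulrA ler_pM2r// -natrM ler_nat.
by apply: (leq_trans card); rewrite leqnn.
Qed.

End counting.

(** * Measure of one dyadic level *)

Section level.
Context {R : realType}.
Notation mu := (@lebesgue_measure R).
Notation vec := (int * int * int)%type.
Variables (f f1 : R -> R) (a b s c C sg cf Cf th1 th2 : R).

(** [sg] is the sign of the slope. With the slope bounded away from 0 both inequalities localise
    [x], and the smaller tolerance decides. *)
Definition sloped : Prop :=
  [/\ sg * sg = 1, 0 < cf <= 1 & forall x, a <= x <= b -> cf <= sg * f1 x <= Cf].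

Hypothesis hcur : curved f f1 a b s c C.
Hypothesis hslo : sloped.

Lemma slope_abs x : a <= x <= b -> cf <= `|f1 x| <= Cf.
Proof.
move=> xab; have [ss /andP[c0 _] /(_ x xab)] := hslo.
have -> : sg * f1 x = `|f1 x|; last by [].
have -> : `|f1 x| = `|sg * f1 x|.
  rewrite normrM (_ : `|sg| = 1) ?mul1r//.
  by apply/eqP; rewrite -(@eqrXn2 _ 2)// expr1n -normrX expr2 ss normr1.
rewrite ger0_norm//; have [_ _ /(_ x xab)/andP[h _]] := hslo.
by apply: le_trans h; exact: ltW.
Qed.

(** A mean value estimate from remainders alone: seen from the right end, the remainder has the sign
    of the linear term and may be dropped. *)
Lemma sloped_expand x y : a <= x <= b -> a <= y <= b -> cf * `|y - x| <= `|f y - f x|.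
Proof.
move=> xab yab; have [_ _ c0 _ h] := hcur.
have [ss /andP[cf0 _] hs] := hslo.
have sn (z : R) : s * z <= `|z|.
  case: (curved_sign hcur) => ->; rewrite ?mul1r ?mulN1r ?ler_norm//.
  by rewrite -normrN ler_norm.
have main (u v : R) : a <= u <= b -> a <= v <= b -> 0 <= s * sg * (v - u) -> cf * `|v - u| <= `|f v - f u|.
  move=> uab vab sgn; apply: le_trans (sn _).
  have /andP[h1 _] := h u v uab vab.
  have -> : s * (f v - f u) = s * remainder f f1 u v + (sg * f1 u) * (s * sg * (v - u)).
    have -> : (sg * f1 u) * (s * sg * (v - u)) = (sg * sg) * (s * (f1 u * (v - u))) by ring.
    by rewrite ss /remainder; ring.
  have -> : `|v - u| = s * sg * (v - u).
    rewrite -[RHS]ger0_norm// !normrM.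
    have -> : `|s| = 1 by case: (curved_sign hcur) => ->; rewrite ?normrN normr1.
    have -> : `|sg| = 1 by apply/eqP; rewrite -(@eqrXn2 _ 2)// expr1n -normrX expr2 ss normr1.
    by rewrite !mul1r.
  have /andP[h2 _] := hs u uab.
  have := ler_wpM2r sgn h2.
  have : 0 <= c * (v - u) ^+ 2 by rewrite mulr_ge0 ?sqr_ge0// ltW.
  lra.
have [h0|h0] := leP 0 (s * sg * (y - x)); first exact: main.
rewrite distrC [leRHS]distrC; apply: main => //.
by rewrite -opprB mulrN oppr_ge0 ltW.
Qed.

Definition beta (v : vec) (x : R) : R := v.2%:~R + th2 - v.1.1%:~R * f x.

Definition level (N : nat) (p1 p2 : R) : set R :=
  [set x | a <= x <= b /\ exists v : vec, [/\ N%:Z <= v.1.1 < (2 * N)%:Z,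
     `|sh_alpha x th1 v| < p1 & `|beta v x| < p2]].

Lemma level_points_close (v : vec) (N : nat) (p1 p2 x y : R) : (0 < N)%N -> N%:Z <= v.1.1 ->
  a <= x <= b -> a <= y <= b ->
  `|sh_alpha x th1 v| < p1 -> `|sh_alpha y th1 v| < p1 ->
  `|beta v x| < p2 -> `|beta v y| < p2 ->
  `|x - y| <= 2 * Order.min p1 p2 / (N%:R * cf).
Proof.
move=> N0 hq xab yab a1 a2 b1 b2; have [_ /andP[cf0 cf1] _] := hslo.
have NR : 0 < N%:R :> R by rewrite ltr0n.
have q0 : (N%:R : R) <= v.1.1%:~R by move: hq; rewrite -(ler_int R) -pmulrn.
have qx : `|v.1.1%:~R * (x - y)| < 2 * p1.
  have -> : v.1.1%:~R * (x - y) = sh_alpha y th1 v - sh_alpha x th1 v.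
    by rewrite /sh_alpha /alpha; ring.
  apply: (le_lt_trans (ler_normB _ _)); lra.
have qf : `|v.1.1%:~R * (f x - f y)| < 2 * p2.
  have -> : v.1.1%:~R * (f x - f y) = beta v y - beta v x by rewrite /beta; ring.
  apply: (le_lt_trans (ler_normB _ _)); lra.
have q00 : (0 : R) < v.1.1%:~R by exact: lt_le_trans q0.
rewrite normrM (gtr0_norm q00) in qx; rewrite normrM (gtr0_norm q00) in qf.
have e1 := sloped_expand yab xab.
have x0 : 0 <= `|x - y| by [].
rewrite ler_pdivlMr ?mulr_gt0//.
have k1 : N%:R * `|x - y| <= v.1.1%:~R * `|x - y| by exact: ler_wpM2r.
have k2 : N%:R * (cf * `|x - y|) <= v.1.1%:~R * `|f x - f y|.
  by apply: ler_pM => //; rewrite mulr_ge0// ltW.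
have k3 : N%:R * (cf * `|x - y|) <= N%:R * `|x - y|.
  by rewrite ler_pM2l// ler_piMl.
have -> : `|x - y| * (N%:R * cf) = N%:R * (cf * `|x - y|) by ring.
by rewrite /Order.min; case: ifP => _; lra.
Qed.

(** In units of [del]: the vertical deviation, slope times horizontal deviation, and the Taylor
    remainder to the reference point of an arc. *)
Definition countC : R := 1 + Cf + 2 * C.
Definition levelK : R :=
  180 * (2 * Num.trunc (countC + 2)).+3%:R * (2 * countC + 3) / cf.

Lemma levelK_ge0 : 0 <= levelK.
Proof.
have [_ /andP[cf0 cf1] hs] := hslo; have [ab _ _ /andP[_ C1] _] := hcur.
have /hs : a <= a <= b by rewrite lexx ltW.
move=> h; have Cf0 : 0 <= Cf by lra.
by rewrite /levelK /countC divr_ge0 ?(ltW cf0)// !mulr_ge0//; lra.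
Qed.

(** On an arc of length 1 / N, q times the Taylor remainder is of order 1 / N <= del, so every
    solution on the arc is one at [x0] with larger constants. Counting leaves O(N del) vectors, each
    solving on a set of measure O(min p1 p2 / N). *)
Lemma level_arc (N : nat) (p1 p2 del x0 : R) (i : nat) : (0 < N)%N ->
  0 < p1 <= 1 -> 0 < p2 -> p1 <= del -> p2 <= del -> N%:R^-1 <= del -> del <= 1 ->
  a <= x0 <= b -> i%:R <= N%:R * (x0 - a) < i.+1%:R ->
  (forall u0 u1 u2 : R, exists w : vec, [/\ `|w.1.1%:~R - u0| <= N%:R,
     `|alpha w.1.1%:~R w.1.2%:~R x0 - u1| <= 1
   & `|tau f f1 w.1.1%:~R w.1.2%:~R w.2%:~R x0 - u2| <= del]) ->
  (mu (level N p1 p2 `&` [set t | (i%:R <= N%:R * (t - a) < i.+1%:R)%R]) <=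
    (levelK * del * Order.min p1 p2)%:E)%E.
Proof.
move=> N0 /andP[p10 p11] p20 p1d p2d Nd d1 x0ab ix0 cov.
have [_ /andP[cf0 cf1] hs] := hslo; have [ab _ c0 /andP[_ C1] _] := hcur.
have NR : 0 < N%:R :> R by rewrite ltr0n.
have d0 : 0 < del by exact: lt_le_trans p1d.
have Cf0 : 0 <= Cf by have /andP[] := slope_abs x0ab; lra.
pose K := (Num.trunc (countC + 2)).+1.
have CK : countC + 2 <= K%:R by rewrite ltW// truncnS_gt.
have cC0 : 0 <= countC by rewrite /countC; lra.
pose P (v : vec) := [/\ 0 <= v.1.1 <= (2 * N)%:Z, `|sh_alpha x0 th1 v| <= 3
   & `|sh_tau f f1 x0 th1 th2 v| <= countC * del].
pose bound := ((4 * N).+1 * (9 * (2 * K).+1))%:R * ((2 * countC + 3) * del).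
have bound0 : 0 <= bound by rewrite /bound !mulr_ge0// ?ltW//; lra.
have hb (s' : seq vec) : uniq s' -> (forall v, v \in s' -> P v) -> (size s' <= Num.trunc bound)%N.
  move=> us sP; rewrite truncn_ge_nat// /bound.
  exact: (@count_bound _ f f1 x0 th1 th2 N K del countC s' d0 d1 cC0 CK cov us sP).
have [vs svs hvs] := exhaustive_seq hb.
have sz : (size vs)%:R <= bound.
  by apply: le_trans (_ : (Num.trunc bound)%:R <= _); rewrite ?ler_nat// truncn_le.
pose F (v : vec) : set R := [set x | [/\ a <= x <= b, `|sh_alpha x th1 v| < p1, `|beta v x| < p2 & N%:Z <= v.1.1]].
pose m := Order.min p1 p2.
have m0 : 0 < m by rewrite /m lt_min p10.
have muF v : v \in vs -> (mu (F v) <= (2 * (2 * m / (N%:R * cf)))%:E)%E.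
  move=> _; apply: mu_diam.
    by rewrite divr_ge0 ?mulr_ge0// ltW.
  move=> x y [xab ax bx qv] [yab ay by_ _].
  exact: (level_points_close N0 qv).
apply: (@le_trans _ _ (mu [set x | exists2 v, v \in vs & F v x])).
  apply: mu_le => x [[xab [v [/andP[v1 v2] av bv]]] /= ix].
  exists v; last by split.
  apply: hvs; split.
  - by rewrite (ltW v2) andbT (le_trans _ v1).
  - have xx0 : `|N%:R * (x - x0)| < 1.
      have -> : N%:R * (x - x0) = N%:R * (x - a) - N%:R * (x0 - a) by ring.
      by rewrite ltr_norml; move: ix ix0; rewrite -!natr1; lra.
    have q2 : `|v.1.1%:~R * (x - x0)| <= 2.
      have q0 : (0 : R) <= v.1.1%:~R by rewrite ler0z (le_trans _ v1).
      have q2N : (v.1.1%:~R : R) <= 2 * N%:R.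
        by move: v2; rewrite -(ltr_int R) -pmulrn natrM; exact: ltW.
      rewrite normrM (ger0_norm q0).
      rewrite normrM (gtr0_norm NR) in xx0.
      have : v.1.1%:~R * `|x - x0| <= 2 * N%:R * `|x - x0| by exact: ler_wpM2r.
      lra.
    have -> : sh_alpha x0 th1 v = sh_alpha x th1 v + v.1.1%:~R * (x - x0) by rewrite /sh_alpha /alpha; ring.
    apply: (le_trans (ler_normD _ _)); lra.
  - have xx0 : `|N%:R * (x - x0)| < 1.
      have -> : N%:R * (x - x0) = N%:R * (x - a) - N%:R * (x0 - a) by ring.
      by rewrite ltr_norml; move: ix ix0; rewrite -!natr1; lra.
    have -> : sh_tau f f1 x0 th1 th2 v = beta v x - f1 x0 * sh_alpha x th1 v + v.1.1%:~R * remainder f f1 x0 x.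
      by rewrite /sh_tau /beta /sh_alpha /alpha /remainder; ring.
    have r1 := curved_remainder hcur x0ab xab.
    have q0 : (0 : R) <= v.1.1%:~R by rewrite ler0z (le_trans _ v1).
    have q2N : (v.1.1%:~R : R) <= 2 * N%:R.
      by move: v2; rewrite -(ltr_int R) -pmulrn natrM; exact: ltW.
    have xx2 : N%:R * (x - x0) ^+ 2 <= N%:R^-1.
      rewrite -(ler_pM2l NR) mulfV ?gt_eqF// mulrA -expr2 -exprMn -real_normK ?num_real//.
      by apply: exprn_ile1 => //; exact: ltW.
    have t3 : `|v.1.1%:~R * remainder f f1 x0 x| <= 2 * C * del.
      rewrite normrM (ger0_norm q0).
      apply: (@le_trans _ _ (2 * N%:R * (C * (x - x0) ^+ 2))); first exact: ler_pM.
      have -> : 2 * N%:R * (C * (x - x0) ^+ 2) = 2 * C * (N%:R * (x - x0) ^+ 2) by ring.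
      by apply: ler_wpM2l; [lra|exact: le_trans Nd].
    have /andP[_ Cfx] := slope_abs x0ab.
    have t2 : `|f1 x0 * sh_alpha x th1 v| <= Cf * del.
      by rewrite normrM; apply: ler_pM => //; apply: le_trans p1d; exact: ltW.
    apply: (le_trans (ler_normD _ _)).
    have := ler_normB (beta v x) (f1 x0 * sh_alpha x th1 v).
    rewrite /countC; lra.
apply: (le_trans (mu_seq_cover muF)); rewrite lee_fin.
apply: (@le_trans _ _ (bound * (2 * (2 * m / (N%:R * cf))))).
  apply: ler_wpM2r => //; rewrite mulr_ge0// divr_ge0 ?mulr_ge0// ltW//.
have N1 : (1 : R) <= N%:R by rewrite ler1n.
have -> : levelK * del * m = (5 * N%:R * (9 * (2 * Num.trunc (countC + 2)).+3%:R)) * ((2 * countC + 3) * del) * (2 * (2 * m / (N%:R * cf))).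
  by rewrite /levelK; field; rewrite !gt_eqF.
apply: ler_wpM2r; first by rewrite mulr_ge0// divr_ge0 ?mulr_ge0// ltW.
apply: ler_wpM2r; first by rewrite mulr_ge0 ?ltW//; lra.
rewrite natrM; apply: ler_pM => //.
  by rewrite -natr1 natrM; lra.
by rewrite natrM /K mulnS.
Qed.

(** The covering factor for e = r^8 is 3 L = 300 / r^16; the box is chosen so that this factor turns
    it into sizes N, 1 and 300^3 / (N r^48) <= del. Bad points cost O(r), and each of O(N) arcs with
    a good point is bounded by [level_arc]. *)
Lemma level_bound (N : nat) (p1 p2 r del : R) : (0 < N)%N ->
  0 < p1 <= 1 -> 0 < p2 -> p1 <= del -> p2 <= del -> del <= 1 ->
  0 < r -> r <= (4 * ndK c C) ^- 3 -> r <= b - a -> r * (4 * 300 ^+ 3) <= 1 ->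
  1 <= r ^+ 3 * (N%:R * r ^+ 48) ->
  300 ^+ 3 / (N%:R * r ^+ 48) <= del ->
  (mu (level N p1 p2) <= (2 * ndK c C * r * (b - a) +
     (N%:R * (b - a) + 1) * (levelK * del * Order.min p1 p2))%:E)%E.
Proof.
move=> N0 p1P p20 p1d p2d d1 r0 rK rab.
have [K [K100 KE]] : exists K : R, 100 <= K /\ 300 = K by exists 300; split => //; lra.
rewrite KE => r10 hN hdel.
have {KE} K3E : K = 3 * 100 by rewrite -KE; lra.
have [ab _ c0 /andP[_ C1] _] := hcur.
have NR : 0 < N%:R :> R by rewrite ltr0n.
have p10 : 0 < p1 by case/andP: p1P.
have K1 : 1 <= K by lra.
have K0 : 0 < K by lra.
have K3 : K <= K ^+ 3 by rewrite -{1}[K]expr1 ler_weXn2l.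
have K23 : 100 * K ^+ 2 <= K ^+ 3 by rewrite [leRHS]exprS ler_wpM2r// sqr_ge0.
have rW := ltW r0.
have K30 : 0 < K ^+ 3 by rewrite exprn_gt0.
have r81 : r <= 1.
  apply: le_trans r10; rewrite ler_peMr//; lra.
have rK3 : r * K ^+ 3 <= 1 / 4 by lra.
have rp n : 0 < r ^+ n by rewrite exprn_gt0.
pose g := (N%:R * r ^+ 48)^-1.
have Nr0 : 0 < N%:R * r ^+ 48 by rewrite mulr_gt0.
have g0 : 0 < g by rewrite invr_gt0.
have gr : g <= r ^+ 3.
  by rewrite /g -[leLHS]mul1r ler_pdivrMr.
have NgE : N%:R * r ^+ 48 * g = 1 by rewrite mulfV// gt_eqF.
pose Y0 := N%:R * r ^+ 16 / K; pose Y1 := r ^+ 16 / K; pose Y2 := K ^+ 2 * (r ^+ 16 * g).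
have Y00 : 0 < Y0 by apply: divr_gt0 => //; exact: mulr_gt0.
have Y10 : 0 < Y1 by exact: divr_gt0.
have Y20 : 0 < Y2 by apply: mulr_gt0; [exact: exprn_gt0|exact: mulr_gt0].
have Kn0 : K != 0 by rewrite gt_eqF.
have YE : Y0 * Y1 * Y2 = 1.
  rewrite -NgE /Y0 /Y1 /Y2 -[48%N]/(16 + 16 + 16)%N !exprD.
  by move: (r ^+ 16) => r16; field.
have r161 : r ^+ 16 <= r by rewrite -[leRHS]expr1; apply: ler_wiXn2l.
have r31 : r ^+ 3 <= r by rewrite -[leRHS]expr1; apply: ler_wiXn2l.
have Kg : K ^+ 3 * g <= 1.
  apply: (@le_trans _ _ (r * K ^+ 3)); last lra.
  by rewrite mulrC ler_pM2r//; exact: le_trans gr r31.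
have Y11 : Y1 <= 1 by rewrite /Y1 ler_pdivrMr// mul1r; apply: le_trans K1; exact: le_trans r81.
have r16g : r ^+ 16 * g <= g.
  by apply: ler_piMl; [exact: ltW|exact: le_trans r161 r81].
have K2g : 100 * K ^+ 2 * g <= K ^+ 3 * g by rewrite ler_pM2r.
have K2g0 : 0 < K ^+ 2 * g by apply: mulr_gt0 => //; exact: exprn_gt0.
have Y21 : Y2 <= 1.
  apply: (@le_trans _ _ (K ^+ 2 * g)); first by rewrite /Y2 ler_pM2l// exprn_gt0.
  rewrite -mulrA in K2g; lra.
have Yab : 2 * Y1 <= b - a.
  apply: le_trans rab; rewrite /Y1 mulrA ler_pdivrMr//.
  apply: (@le_trans _ _ (r * 2)); first by rewrite mulrC ler_wpM2r.
  by rewrite ler_pM2l//; lra.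
have Yab2 : Y1 * Y2 < (b - a) ^+ 2.
  have -> : Y1 * Y2 = K * (r ^+ 32 * g).
    by rewrite /Y1 /Y2 -[32%N]/(16 + 16)%N exprD; move: (r ^+ 16) => r16; field.
  have r32 : r ^+ 32 <= 1 by apply: exprn_ile1.
  apply: (@lt_le_trans _ _ (r ^+ 2)); last by rewrite ler_pXn2r// nnegrE// subr_ge0 ltW.
  apply: (@le_lt_trans _ _ (K * r ^+ 3)).
    rewrite ler_pM2l//; apply: le_trans gr; apply: ler_piMl => //; exact: ltW.
  rewrite exprSr mulrCA -[ltRHS]mulr1 ltr_pM2l//.
  have : r * K <= r * K ^+ 3 by rewrite ler_pM2l.
  by rewrite mulrC; lra.
have nd := @nondivergence R f f1 a b s c C hcur Y0 Y1 Y2 Y00 Y10 Y20 YE Y11 Y21 Yab Yab2 r r0 rK.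
pose PBad := PB f f1 a b Y0 Y1 Y2 (r ^+ 8).
pose n := (Num.trunc (N%:R * (b - a))).+1.
pose arc (i : nat) : set R := [set t | (i%:R <= N%:R * (t - a) < i.+1%:R)%R].
(* Only arcs containing a good point [x0] count; on any other arc all points of [a, b] belong to
   [PBad]. *)
pose G (i : nat) : set R := [set x | level N p1 p2 x /\ arc i x /\ exists x0, [/\ (a <= x0 <= b)%R, arc i x0 & ~ PBad x0]].
have m0 : 0 < Order.min p1 p2 by rewrite lt_min p10.
have d0 : 0 < del by exact: lt_le_trans p1d.
have lK0 : 0 <= levelK * del * Order.min p1 p2.
  by apply: mulr_ge0; [apply: mulr_ge0; [exact: levelK_ge0|exact: ltW]|exact: ltW].
have muG i : i \in iota 0 n -> (mu (G i) <= (levelK * del * Order.min p1 p2)%:E)%E.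
  move=> _; have [[x0 [x0ab ix0 nb]]|ne] := pselect (exists x0, [/\ (a <= x0 <= b)%R, arc i x0 & ~ PBad x0]); last first.
    rewrite (_ : G i = set0) ?measure0 ?lee_fin//.
    by rewrite -subset0 => x [_ [_ /ne]].
  apply: (@le_trans _ _ (mu (level N p1 p2 `&` arc i))).
    by apply: mu_le => x [? [? _]].
  apply: (@level_arc N p1 p2 del x0 i) => //.
    apply: le_trans hdel; rewrite -/g.
    have -> : N%:R^-1 = r ^+ 48 * g by rewrite /g invfM mulrCA mulfV ?mulr1// gt_eqF.
    by rewrite ler_pM2r//; apply: (le_trans (exprn_ile1 _ _ r81)) => //; exact: le_trans K3.
  move=> u0 u1 u2.
  have e8 : r ^+ 8 <= 1 by apply: exprn_ile1.
  have LE : 100 / r ^+ 16 = 100 / (r ^+ 8) ^+ 2 by rewrite -exprM.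
  have r16n : r ^+ 16 != 0 by rewrite gt_eqF.
  have LY1 : 100 / r ^+ 16 * Y1 <= 1.
    have -> : 100 / r ^+ 16 * Y1 = 100 / K by rewrite /Y1; move: (r ^+ 16) r16n => r16 r16n; field; rewrite Kn0.
    by rewrite ler_pdivrMr// mul1r.
  have LY2 : 100 / r ^+ 16 * Y2 <= 1.
    have -> : 100 / r ^+ 16 * Y2 = 100 * K ^+ 2 * g by rewrite /Y2; move: (r ^+ 16) r16n => r16 r16n; field.
    exact: le_trans K2g Kg.
  have good (w : vec) : w <> (0, 0, 0) -> ~ psmall f f1 Y0 Y1 Y2 (r ^+ 8) w x0.
    by move=> wn0 sw; apply: nb; split => //; exists w.
  have [w [w1 w2 w3]] := lattice_covering Y00 Y10 Y20 YE (rp 8%N) e8 LE LY1 LY2 good u0 u1 u2.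
  have E3 : 3 * (100 / r ^+ 16) = K / r ^+ 16 by rewrite K3E mulrA.
  rewrite E3 in w1 w2 w3.
  exists w; split.
  - apply: (le_trans w1); rewrite le_eqVlt; apply/orP; left; apply/eqP.
    by rewrite /Y0; move: (r ^+ 16) r16n => r16 r16n; field; rewrite Kn0.
  - apply: (le_trans w2); rewrite le_eqVlt; apply/orP; left; apply/eqP.
    by rewrite /Y1; move: (r ^+ 16) r16n => r16 r16n; field; rewrite Kn0.
  - apply: (le_trans w3); apply: le_trans hdel; rewrite -/g le_eqVlt; apply/orP; left; apply/eqP.
    by rewrite /Y2; move: (r ^+ 16) r16n => r16 r16n; field.
apply: (@le_trans _ _ (mu (PBad `|` [set x | exists2 i, i \in iota 0 n & G i x]))).
  apply: mu_le => x lx; have [xab _] := lx.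
  have [?|nb] := pselect (PBad x); [by left|right].
  have Nx : 0 <= N%:R * (x - a) by apply: mulr_ge0 => //; rewrite subr_ge0; case/andP: xab.
  exists (Num.trunc (N%:R * (x - a))).
    rewrite mem_iota/= add0n /n ltnS; apply: le_truncn; rewrite ler_pM2l//.
    by rewrite lerD2r; case/andP: xab.
  have ax : arc (Num.trunc (N%:R * (x - a))) x by rewrite /arc/= truncn_itv.
  by split => //; split => //; exists x.
apply: (le_trans (mu_setU _ _)); rewrite EFinD; apply: leeD => //.
apply: (le_trans (mu_seq_cover muG)); rewrite lee_fin size_iota.
apply: ler_wpM2r => //.
by rewrite /n -natr1 lerD2r truncn_le; apply: mulr_ge0 => //; rewrite subr_ge0 ltW.
Qed.

End level.

(** * Cauchy condensation *)

Section condensation.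
Context {R : realType}.
Variable phi : nat -> R.
Hypothesis phi_dec : forall m n, (0 < m)%N -> (m <= n)%N -> phi n <= phi m.

Lemma pow2_gap T : (2 ^ T.+1 - 2 ^ T = 2 ^ T)%N.
Proof. by rewrite expnS mul2n -addnn addnK. Qed.

(** The block from 2^T + 1 to 2^(T+1) has 2^T terms, none below the last one; twice the block pays
    for the new term. *)
Lemma condensation_le T :
  0 <= phi 1 -> \sum_(0 <= t < T.+1) 2 ^+ t * phi (2 ^ t)%N <= 2 * \sum_(1 <= q < (2 ^ T).+1) phi q.
Proof.
move=> phi1; elim: T => [|T IH].
  by rewrite !big_nat1 expr0 mul1r; lra.
rewrite big_nat_recr//= [X in _ <= 2 * X](@big_cat_nat _ _ _ (2 ^ T).+1)//=; last first.
  by rewrite ltnS leq_exp2l.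
rewrite mulrDr; apply: lerD => //.
have -> : 2 ^+ T.+1 * phi (2 ^ T.+1)%N = 2 * \sum_((2 ^ T).+1 <= q < (2 ^ T.+1).+1) phi (2 ^ T.+1)%N.
  rewrite sumr_const_nat subSS pow2_gap -[phi _ *+ _]mulr_natl natrX exprS; ring.
rewrite ler_pM2l//; apply: ler_sum_nat => q /andP[q1 q2].
by apply: phi_dec; [exact: leq_ltn_trans q1|].
Qed.

Lemma condensation_ge T :
  \sum_(1 <= q < (2 ^ T)%N) phi q <= \sum_(0 <= t < T) 2 ^+ t * phi (2 ^ t)%N.
Proof.
elim: T => [|T IH]; first by rewrite !big_geq.
rewrite big_nat_recr//= [X in X <= _](@big_cat_nat _ _ _ (2 ^ T)%N)//=; last 2 first.
  by rewrite expn_gt0.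
  by rewrite leq_exp2l.
apply: lerD => //.
have -> : 2 ^+ T * phi (2 ^ T)%N = \sum_((2 ^ T)%N <= q < (2 ^ T.+1)%N) phi (2 ^ T)%N.
  by rewrite sumr_const_nat pow2_gap -[phi _ *+ _]mulr_natl natrX.
apply: ler_sum_nat => q /andP[q1 q2].
by apply: phi_dec => //; rewrite expn_gt0.
Qed.

End condensation.

(** * Borel-Cantelli and elementary sums *)

Section limsup.
Context {R : realType}.
Notation mu := (@lebesgue_measure R).

(** The limsup set lies in every tail union, whose outer measure is at most a tail of a convergent
    series. *)
Lemma limsup_null (E : nat -> set R) (e : nat -> R) (t0 : nat) (B : R) :
  (forall t, (t0 <= t)%N -> (mu (E t) <= (e t)%:E)%E) -> (forall t, 0 <= e t) ->
  (forall n, \sum_(0 <= t < n) e t <= B) ->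
  mu [set x | forall T, exists2 t, (T <= t)%N & E t x] = 0%E.
Proof.
move=> hE e0 hB; apply/eqP; rewrite -measure_le0.
have fin : (\sum_(0 <= t <oo) (e t)%:E < +oo)%E.
  apply: (@le_lt_trans _ _ B%:E); last exact: ltry.
  apply: lime_le; first by apply: is_cvg_nneseries => n _ _; rewrite lee_fin.
  by apply: nearW => n; rewrite sumEFin lee_fin.
have := nneseries_tail_cvg fin (fun k _ => ltac:(by rewrite lee_fin)).
move=> /cvg_lim <- //.
apply: lime_ge; first by apply/cvg_ex; exists 0%E; exact: (nneseries_tail_cvg fin (fun k _ => ltac:(by rewrite lee_fin))).
near=> N.
have tN : (t0 <= N)%N by near: N; exact: nbhs_infty_ge.
pose E' n := if (t0 <= n)%N then E n else set0.
apply: (@le_trans _ _ (mu (\bigcup_(n in ~` `I_N) E' n))).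
  apply: mu_le => x /(_ N)[t Nt Et]; exists t => /=.
    by apply/negP; rewrite -leqNgt.
  by rewrite /E' (leq_trans tN Nt).
apply: le_trans (outer_measure_sigma_subadditive_tail (wlength idfun)^*%mu N E') _.
apply: lee_nneseries; first by move=> *; exact: outer_measure_ge0.
move=> i *; rewrite /E'; case: ifPn => [|_]; first exact: hE.
by rewrite outer_measure0 lee_fin.
Unshelve. all: by end_near. Qed.

Lemma bernoulli_lower (x : R) n : 0 <= x <= 1 -> 1 - n%:R * x <= (1 - x) ^+ n.
Proof.
move=> x01; elim: n => [|n IH]; first by rewrite expr0; lra.
rewrite exprS -natr1.
have : (1 - x) * (1 - n%:R * x) <= (1 - x) * (1 - x) ^+ n by apply: ler_wpM2l => //; lra.
have : 0 <= n%:R * (x * x) by rewrite !mulr_ge0//; lra.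
lra.
Qed.

Lemma geometric_sum_le (rho : R) n : 0 <= rho -> rho < 1 ->
  \sum_(0 <= t < n) rho ^+ t <= (1 - rho)^-1.
Proof.
move=> r0 r1.
have E : (1 - rho) * \sum_(0 <= t < n) rho ^+ t = 1 - rho ^+ n.
  elim: n => [|n IH]; first by rewrite big_geq// mulr0 expr0 subrr.
  by rewrite big_nat_recr//= mulrDr IH exprS; ring.
rewrite -(@ler_pM2l _ (1 - rho)) ?subr_gt0// E mulfV ?subr_eq0 ?gt_eqF//.
have : 0 <= rho ^+ n by rewrite exprn_ge0.
lra.
Qed.

End limsup.

(** * Convergence on one arc *)

Section approximations.
Context {R : realType}.
Notation mu := (@lebesgue_measure R).

Definition decreasing_to0 (psi : nat -> R) : Prop :=
  [/\ forall q, (0 < q)%N -> 0 < psi q,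
      forall m n, (0 < m)%N -> (m <= n)%N -> psi n <= psi m
    & forall e, 0 < e -> exists n, forall q, (n <= q)%N -> psi q < e].

Definition solvable (psi1 psi2 : nat -> R) (th1 th2 x y : R) (q : nat) : Prop :=
  exists a b : int, `|a%:~R + th1 - q%:R * x| < psi1 q /\ `|b%:~R + th2 - q%:R * y| < psi2 q.

(** Level t is bounded with r = rho^t and [del] = M + 300^3 g. Three sums remain: a geometric one,
    that of 2^t m M, controlled by condensation, and that of m / r^48. *)
Lemma convergence_local (f f1 : R -> R) (a b s c C sg cf Cf th1 th2 : R) (psi1 psi2 : nat -> R) (B : R) :
  curved f f1 a b s c C -> sloped f1 a b sg cf Cf ->
  decreasing_to0 psi1 -> decreasing_to0 psi2 ->
  (forall n, \sum_(1 <= q < n) psi1 q * psi2 q <= B) ->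
  mu [set x | (a <= x <= b)%R /\ forall n, exists2 q, (n <= q)%N & solvable psi1 psi2 th1 th2 x (f x) q] = 0%E.
Proof.
move=> hcur hslo [p1pos p1dec p1lim] [p2pos p2dec p2lim] hB.
have [ab _ c0 /andP[_ C1] _] := hcur.
pose phi q := psi1 q * psi2 q.
have phid m n : (0 < m)%N -> (m <= n)%N -> phi n <= phi m.
  move=> m0 mn; have n0 := leq_trans m0 mn.
  by apply: ler_pM; [exact: ltW (p1pos _ _)|exact: ltW (p2pos _ _)|exact: p1dec|exact: p2dec].
have phi0 q : (0 < q)%N -> 0 < phi q by move=> q0; rewrite mulr_gt0 ?p1pos ?p2pos.
have [T3 [T30 T3E]] : exists T : R, 0 < T /\ 300 ^+ 3 = T.
  by exists (300 ^+ 3); split; [apply: exprn_gt0; lra|reflexivity].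
(* Close enough to 1 that 2 rho^192 >= 1, by Bernoulli's inequality since 192 / 400 < 1 / 2. Then
   2^t r^192 >= 1 absorbs all losses in powers of r. *)
pose rho : R := 399 / 400.
have rho0 : 0 < rho by rewrite /rho; lra.
have rho1 : rho < 1 by rewrite /rho; lra.
have rho192 : 1 <= 2 * rho ^+ 192.
  have := @bernoulli_lower R (1 / 400) 192 ltac:(lra).
  have -> : 1 - 1 / 400 = rho by rewrite /rho; lra.
  lra.
pose M t := Order.max (psi1 (2 ^ t)%N) (psi2 (2 ^ t)%N).
pose m t := Order.min (psi1 (2 ^ t)%N) (psi2 (2 ^ t)%N).
have t2 t : (0 < 2 ^ t)%N by rewrite expn_gt0.
have mM t : m t * M t = phi (2 ^ t)%N by rewrite /m /M /phi /Order.min /Order.max; case: ifP => //; rewrite mulrC.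
have m0 t : 0 < m t by rewrite lt_min p1pos// p2pos.
have M0 t : 0 < M t by rewrite lt_max p1pos.
have mleM t : m t <= M t by rewrite ge_min le_max lexx.
pose r t := rho ^+ t.
have r0 t : 0 < r t by exact: exprn_gt0.
have r1 t : r t <= 1 by apply: exprn_ile1; exact: ltW.
have Nr t : 1 <= (2 ^ t)%:R * r t ^+ 192.
  by rewrite natrX /r -exprM mulnC exprM -exprMn exprn_ege1.
pose g t := ((2 ^ t)%:R * r t ^+ 48)^-1.
have NR t : 0 < (2 ^ t)%:R :> R by rewrite ltr0n.
have g0 t : 0 < g t by rewrite invr_gt0 mulr_gt0// exprn_gt0.
pose del t := M t + T3 * g t.
pose K := ndK c C. pose LK := levelK C cf Cf.
have LK0 : 0 <= LK by exact: (levelK_ge0 hcur hslo).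
have K0 : 0 < K by have := ndK_ge hcur; rewrite /K; lra.
pose e t := 2 * K * r t * (b - a) + ((2 ^ t)%:R * (b - a) + 1) * (LK * del t * m t).
have e0 t : 0 <= e t.
  have d0 : 0 < del t by apply: addr_gt0 => //; exact: mulr_gt0.
  have ba : 0 < b - a by rewrite subr_gt0.
  have [KW baW rW dW mW] := And5 (ltW K0) (ltW ba) (ltW (r0 t)) (ltW d0) (ltW (m0 t)).
  apply: addr_ge0; first by do 3 apply: mulr_ge0 => //.
  apply: mulr_ge0; first by apply: addr_ge0 => //; exact: mulr_ge0.
  by do 2 apply: mulr_ge0 => //.
have [t0 ht0] : exists t0, forall t, (t0 <= t)%N ->
    [/\ r t <= (4 * K) ^- 3, r t <= b - a, r t * (4 * T3) <= 1 & M t <= 1 / 2].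
  have c300 : 0 < (4 * T3 : R) by rewrite mulr_gt0.
  pose eta := Order.min ((4 * K) ^- 3) (Order.min (b - a) (4 * T3)^-1).
  have eta0 : 0 < eta.
    by rewrite !lt_min subr_gt0 ab !invr_gt0 c300 exprn_gt0// mulr_gt0.
  have : rho ^+ n @[n --> \oo] --> (0 : R).
    by apply: cvg_expr; rewrite ger0_norm// ltW.
  move=> /cvgr_lt /(_ eta eta0)[n1 _ hn1].
  have [n2 hn2] := p1lim (1 / 2) ltac:(lra).
  have [n3 hn3] := p2lim (1 / 2) ltac:(lra).
  exists (n1 + (n2 + n3))%N => t tn.
  have : r t < eta by apply: hn1 => /=; exact: leq_trans (leq_addr _ _) tn.
  rewrite !lt_min => /andP[h1 /andP[h2 h3]].
  have t2t : (t <= 2 ^ t)%N by rewrite ltnW// ltn_expl.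
  split; [exact: ltW|exact: ltW| |].
    by rewrite -ler_pdivlMr// div1r ltW.
  rewrite ge_max; apply/andP; split; apply/ltW; [apply: hn2|apply: hn3];
    apply: leq_trans t2t; apply: leq_trans tn.
    exact: leq_trans (leq_addr _ _) (leq_addl _ _).
  exact: leq_trans (leq_addl _ _) (leq_addl _ _).
have hlev t : (t0 <= t)%N ->
   (mu (level f a b th1 th2 (2 ^ t) (psi1 (2 ^ t)%N) (psi2 (2 ^ t)%N)) <= (e t)%:E)%E.
  move=> /ht0[h1 h2 h3 h4].
  have gr3 : 1 <= r t ^+ 3 * ((2 ^ t)%:R * r t ^+ 48).
    apply: (le_trans (Nr t)); rewrite [leRHS]mulrCA -exprD ler_pM2l//.
    by apply: ler_wiXn2l => //; exact: ltW.
  have gr : g t <= r t.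
    apply: (@le_trans _ _ (r t ^+ 3)).
      by rewrite /g -[leLHS]mul1r ler_pdivrMr// mulr_gt0// exprn_gt0.
    by rewrite -[leRHS]expr1; apply: ler_wiXn2l => //; exact: ltW.
  have g300 : T3 * g t <= 1 / 4.
    have : T3 * g t <= T3 * r t by rewrite ler_pM2l.
    by move: h3; lra.
  have gg0 : 0 < T3 * g t by rewrite mulr_gt0.
  have pM1 : psi1 (2 ^ t)%N <= M t by rewrite le_max lexx.
  have pM2 : psi2 (2 ^ t)%N <= M t by rewrite le_max lexx orbT.
  move: gg0 g300; set X := T3 * g t => X0 X4.
  apply: (@level_bound R f f1 a b s c C sg cf Cf th1 th2 hcur hslo (2 ^ t) _ _ (r t) (del t)) => //.
  - by rewrite p1pos//=; lra.
  - exact: p2pos.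
  - by rewrite /del -/X; lra.
  - by rewrite /del -/X; lra.
  - by rewrite /del -/X; lra.
  - by rewrite T3E.
  - by rewrite T3E -/(g t) /del ler_wpDl// ltW.
have [B1 hB1] : exists B1, forall n, \sum_(0 <= t < n) e t <= B1.
  pose B3 := 1 + 2 * B.
  have sumphi n : \sum_(0 <= t < n) 2 ^+ t * phi (2 ^ t)%N <= 2 * B.
    case: n => [|n]; first by rewrite big_geq// mulr_ge0//; have := hB 1%N; rewrite big_geq.
    apply: (le_trans (condensation_le phid n (ltW (phi0 1%N isT)))).
    by rewrite ler_pM2l.
  have Nphi t : 2 ^+ t * phi (2 ^ t)%N <= 2 * B.
    apply: le_trans (sumphi t.+1); rewrite big_nat_recr//= ler_wpDl//.
    by apply: sumr_ge0 => i _; rewrite mulr_ge0 ?exprn_ge0// ltW// phi0.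
  have B0 : 0 <= B by have := hB 1%N; rewrite big_geq.
  (* As m <= M, m^2 <= m M = phi (2^t) <= 2 B / 2^t <= 2 B r^192; so m is of order r^96, and
     dividing by r^48 leaves a geometric sequence. *)
  have X t : m t / r t ^+ 48 <= B3 * r t.
    have r480 : 0 < r t ^+ 48 by rewrite exprn_gt0.
    apply: (@le_trans _ _ (B3 * r t ^+ 48)); last first.
      apply: ler_wpM2l; first by rewrite /B3; lra.
      by rewrite -[leRHS]expr1; apply: ler_wiXn2l => //; exact: ltW.
    rewrite -(@ler_pXn2r _ 2) ?nnegrE//; last 2 first.
    - by rewrite divr_ge0 ?ltW.
    - by rewrite mulr_ge0 ?ltW//; rewrite /B3; lra.
    rewrite expr_div_n ler_pdivrMr ?exprn_gt0//.
    have mm : m t ^+ 2 <= phi (2 ^ t)%N by rewrite -mM expr2 ler_pM2l.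
    have r192 : (B3 * r t ^+ 48) ^+ 2 * (r t ^+ 48) ^+ 2 = B3 ^+ 2 * r t ^+ 192.
      by rewrite -exprMn -mulrA -exprD exprMn -exprM.
    rewrite r192; apply: (le_trans mm).
    have -> : phi (2 ^ t)%N = (2 ^+ t * phi (2 ^ t)%N) / (2 ^ t)%:R.
      by rewrite natrX mulrAC mulfV ?mul1r// expf_neq0.
    rewrite ler_pdivrMr//.
    apply: (@le_trans _ _ (B3 ^+ 2)).
      by apply: (le_trans (Nphi t)); rewrite /B3 expr2; nra.
    rewrite -mulrA [_ * (2 ^ t)%:R]mulrC ler_peMr// sqr_ge0//.
  have etb t : e t <= (2 * K * (b - a) + (b - a + 1) * LK * (T3 * B3)) * r t
        + (b - a + 1) * LK * (2 ^+ t * phi (2 ^ t)%N).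
    have ba : 0 < b - a by rewrite subr_gt0.
    have N1 : (1 : R) <= (2 ^ t)%:R by rewrite ler1n.
    have d0 : 0 < del t by apply: addr_gt0 => //; exact: mulr_gt0.
    have h1 : ((2 ^ t)%:R * (b - a) + 1) * (LK * del t * m t) <=
       ((2 ^ t)%:R * (b - a + 1)) * (LK * del t * m t).
      apply: ler_wpM2r.
        by apply: mulr_ge0; [apply: mulr_ge0 => //; exact: ltW|exact: ltW].
      by rewrite [leRHS]mulrDr mulr1 lerD2l.
    have h2 : (2 ^ t)%:R * (del t * m t) <= 2 ^+ t * phi (2 ^ t)%N + T3 * B3 * r t.
      rewrite /del mulrDl mulrDr [M t * _]mulrC mM natrX lerD2l.
      have -> : 2 ^+ t * (T3 * g t * m t) = T3 * (m t / r t ^+ 48).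
        rewrite /g natrX invfM.
        have : r t ^+ 48 != 0 by rewrite gt_eqF// exprn_gt0.
        by move: (r t ^+ 48) => r48 r48n; field; rewrite r48n expf_neq0.
      by rewrite -mulrA ler_pM2l.
    rewrite /e.
    have h3 : (b - a + 1) * LK * ((2 ^ t)%:R * (del t * m t)) <=
       (b - a + 1) * LK * (2 ^+ t * phi (2 ^ t)%N + T3 * B3 * r t).
      by apply: ler_wpM2l => //; rewrite mulr_ge0//; lra.
    move: h1 h3; move: (2 ^+ t * phi (2 ^ t)%N) (2 ^ t)%:R => X2 X3; lra.
  set A1 := (2 * K * (b - a) + _) in etb; set A2 := (b - a + 1) * LK in etb.
  exists (A1 * (1 - rho)^-1 + A2 * (2 * B)) => n.
  apply: (@le_trans _ _ (\sum_(0 <= t < n) (A1 * r t + A2 * (2 ^+ t * phi (2 ^ t)%N)))).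
    by apply: ler_sum_nat => t _; exact: etb.
  have ba : 0 < b - a by rewrite subr_gt0.
  have A20 : 0 <= A2 by rewrite /A2 mulr_ge0//; lra.
  have A10 : 0 <= A1.
    apply: addr_ge0.
      by apply: mulr_ge0; [apply: mulr_ge0 => //; exact: ltW|exact: ltW].
    apply: mulr_ge0 => //; apply: mulr_ge0; first exact: ltW.
    by rewrite /B3; lra.
  rewrite big_split/= -!mulr_sumr; apply: lerD; apply: ler_wpM2l => //.
  exact: (geometric_sum_le n (ltW rho0) rho1).
apply/eqP; rewrite -measure_le0; rewrite -(limsup_null hlev e0 hB1); apply: mu_le.
move=> x [xab h] T; have [q qT [u [v [h1 h2]]]] := h (2 ^ T)%N.
have q0 : (0 < q)%N by apply: leq_trans qT.
have /andP[l1 l2] := trunc_log_bounds (isT : (1 < 2)%N) q0.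
(* The dyadic level with 2^t <= q < 2^(t+1); since both psi decrease, the tolerances at q are at
   most those at 2^t. *)
exists (trunc_log 2 q).
  by rewrite -ltnS -(@ltn_exp2l 2)//; exact: leq_ltn_trans qT l2.
split => //; exists (Posz q, u, v); split => /=.
- by rewrite lez_nat l1/= ltz_nat -expnS.
- rewrite /sh_alpha /alpha/= addrAC; apply: (lt_le_trans h1); exact: p1dec.
- by rewrite /beta/=; apply: (lt_le_trans h2); exact: p2dec.
Qed.

End approximations.

(** * Disjoint intervals and separated nets *)

Section disjoint_intervals.
Context {R : realType}.
Notation mu := (@lebesgue_measure R).

Lemma sumr_const_seq (T : Type) (xs : seq T) (u : R) : \sum_(x <- xs) u = (size xs)%:R * u.
Proof.
elim: xs => [|x xs IH]; first by rewrite big_nil mul0r.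
by rewrite big_cons IH /= -natr1; ring.
Qed.

Definition itv_apart (p q : R * R) : bool := p.2 + q.2 <= `|p.1 - q.1|.

Lemma mu_disjoint_sum (U : seq (R * R)) (W : set R) : measurable W ->
  pairwise itv_apart U -> (forall p, p \in U -> 0 <= p.2) ->
  (forall p x, p \in U -> `|x - p.1| < p.2 -> W x) ->
  ((\sum_(p <- U) 2 * p.2)%:E <= mu W)%E.
Proof.
elim: U W => [|p U IH] W mW; first by rewrite big_nil.
rewrite pairwise_cons => /andP[/allP pU pwU] r0 sub.
rewrite big_cons EFinD.
pose I := ball p.1 p.2.
have mI : measurable I by exact: measurable_ball.
have p20 : 0 <= p.2 by apply: r0; rewrite mem_head.
have -> : mu W = (mu (W `\` I) + mu (W `&` I))%E by exact: (@measureDI _ _ _ mu _ _ mW mI).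
rewrite addeC; apply: leeD.
  apply: IH => //; first exact: measurableD.
  - by move=> q qU; apply: r0; rewrite inE qU orbT.
  - move=> q x qU xq; split; first by apply: (sub q) => //; rewrite inE qU orbT.
    rewrite /I /ball/= => px.
    have := pU _ qU; rewrite /itv_apart.
    have := ler_distD x p.1 q.1; lra.
have -> : W `&` I = I.
  apply/setIidPr => x; rewrite /I /ball/= distrC => xp.
  by apply: (sub p) => //; rewrite mem_head.
by rewrite lebesgue_measure_ball// mulr_natl.
Qed.

(* A maximal separated subset is a net. *)
Lemma separated_net (X : set R) (a b h : R) : a < b -> 0 < h ->
  (forall x, X x -> a <= x <= b) ->
  exists xs : seq R, [/\ pairwise (fun x y => h <= `|x - y|) xs,
    forall x, x \in xs -> X x, (size xs)%:R * h <= b - a + h &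
    (mu X <= ((size xs)%:R * (2 * h))%:E)%E].
Proof.
move=> ab h0 Xab.
pose good (xs : seq R) := pairwise (fun x y => h <= `|x - y|) xs /\ forall x, x \in xs -> X x.
have bd xs : good xs -> (size xs)%:R * h <= b - a + h.
  move=> [pw xsX].
  have := @mu_disjoint_sum [seq (x, h / 2) | x <- xs] `[a - h / 2, b + h / 2]%classic.
  rewrite mu_cc; last by lra.
  rewrite big_map/= sumr_const_seq lee_fin => H.
  suff : (size xs)%:R * (2 * (h / 2)) <= b + h / 2 - (a - h / 2) by lra.
  apply: H.
  - exact: measurable_itv.
  - rewrite pairwise_map; apply: sub_pairwise pw => x y /=.
    by rewrite /itv_apart/=; lra.
  - by move=> p /mapP[x _ ->] /=; lra.
  - move=> p x /mapP[y ys ->] /=; rewrite ltr_distl => /andP[? ?].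
    have /Xab/andP[? ?] := xsX _ ys; rewrite in_itv/=; lra.
pose Q := fun k : nat => `[< exists xs, good xs /\ size xs = k >].
have Q0 : exists k, Q k by exists 0%N; apply/asboolP; exists [::].
have Qn k : Q k -> (k <= Num.trunc ((b - a + h) / h))%N.
  move=> /asboolP[xs [gx <-]]; rewrite truncn_ge_nat; last by apply: divr_ge0; lra.
  by rewrite ler_pdivlMr//; exact: bd.
case: (ex_maxnP Q0 Qn) => k /asboolP[xs [gx sk]] kmax.
exists xs; split; [by case: gx|by case: gx|exact: bd|].
apply: (@le_trans _ _ (mu [set x | exists2 y, y \in xs & [set x | `|x - y| <= h] x])).
  apply: mu_le => x Xx; apply: contrapT => nx.
  have : Q k.+1.
    apply/asboolP; exists (x :: xs); split; last by rewrite /= sk.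
    split; last by move=> y; rewrite inE => /orP[/eqP ->//|]; case: gx => _; apply.
    rewrite pairwise_cons; case: gx => -> _; rewrite andbT.
    apply/allP => y ys; apply: ltW; rewrite ltNge; apply/negP => hy.
    by apply: nx; exists y.
  by move=> /kmax; rewrite ltnn.
apply: mu_seq_cover => y _.
have -> : 2 * h = (y + h) - (y - h) by lra.
apply: mu_le_cc; first lra.
by move=> x; rewrite /= ler_distl in_itv.
Qed.

End disjoint_intervals.

(** * From ubiquity to full measure *)

Section ubiquity.
Context {R : realType}.
Notation mu := (@lebesgue_measure R).
Variables (a b : R) (TT : pred nat) (d r : nat -> R) (Res : nat -> set R).

Definition hits (T : nat) : set R :=
  [set x | exists t y, [/\ (T <= t)%N, TT t, Res t y & `|x - y| < r t]].

Hypothesis ab : a < b.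
Hypothesis d0 : forall t, 0 < d t.
Hypothesis r0 : forall t, 0 < r t <= d t.
Hypothesis geo : forall s t, TT s -> TT t -> (s <= t)%N -> d t <= (3 / 4) ^+ (t - s) * d s.
Hypothesis dlim : forall e, 0 < e -> exists t1, forall t, (t1 <= t)%N -> TT t -> d t < e.
Hypothesis div : forall B : R, exists n, B < \sum_(0 <= t < n | TT t) r t / d t.
Hypothesis ubi : forall a' b', a <= a' -> a' < b' -> b' <= b ->
  exists t1, forall t, (t1 <= t)%N -> TT t ->
  (mu [set x | (a' <= x <= b')%R /\ ~ exists2 y, Res t y & (`|x - y| <= d t)%R] <=
   ((b' - a') / 3)%:E)%E.

Lemma hits_open T : open (hits T).
Proof.
have -> : hits T = \bigcup_(p in [set p : nat * R | [/\ (T <= p.1)%N, TT p.1 & Res p.1 p.2]])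
   ball p.2 (r p.1).
  apply/seteqP; split=> x /=.
    by move=> [t [y [Tt tt ry xy]]]; exists (t, y) => //=; rewrite /ball/= distrC.
  by move=> [[t y] /= [Tt tt ry]]; rewrite /ball/= distrC => xy; exists t, y.
by apply: bigcup_open => p _; exact: ball_open.
Qed.

(** If the hit set had less than l/8, disjoint balls inside it could be added level after level:
    they always leave room for more, while their total length grows like l/500 times the divergent
    sum of r / d. *)
Lemma hits_dense T a' b' : a <= a' -> a' < b' -> b' <= b ->
  (((b' - a') / 8)%:E <= mu (hits T `&` `[a', b']%classic))%E.
Proof.
move=> aa' ab' bb'; rewrite leNgt; apply/negP => small.
pose l := b' - a'; have l0 : 0 < l by rewrite subr_gt0.
set W := hits T `&` _ in small.
have mW : measurable W.
  by apply: measurableI; [apply: open_measurable; exact: hits_open|exact: measurable_itv].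
have [t1 ht1] := ubi aa' ab' bb'.
have [t2 ht2] := dlim (e := l / 200) ltac:(lra).
pose t3 := (T + (t1 + t2))%N.
have T3 t : (t3 <= t)%N -> TT t -> [/\ (T <= t)%N, d t < l / 200 &
  (mu [set x | (a' <= x <= b')%R /\ ~ exists2 y, Res t y & (`|x - y| <= d t)%R] <= (l / 3)%:E)%E].
  move=> tt Tt; split.
  - exact: leq_trans (leq_addr _ _) tt.
  - apply: ht2 => //; apply: leq_trans tt; exact: leq_trans (leq_addl _ _) (leq_addl _ _).
  - apply: ht1 => //; apply: leq_trans tt; exact: leq_trans (leq_addr _ _) (leq_addl _ _).
have rec n : \sum_(t3 <= t < t3 + n.+1 | TT t) r t / d t =
   \sum_(t3 <= t < t3 + n | TT t) r t / d t + (if TT (t3 + n)%N then r (t3 + n)%N / d (t3 + n)%N else 0).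
  by rewrite addnS big_mkcond big_nat_recr ?leq_addr//= -big_mkcond.
(* The last clause keeps the number of balls small against 1 / d. A level adds at most 2 l / (100 d)
   balls, and 6 is the fixed point of k -> (k + 2) * 3/4, where 3/4 is the decay of [d]. *)
have build n : exists U : seq (R * R), [/\ pairwise itv_apart U,
    (forall p, p \in U -> 0 <= p.2),
    (forall p x, p \in U -> `|x - p.1| < p.2 -> W x),
    l / 500 * (\sum_(t3 <= t < t3 + n | TT t) r t / d t) <= \sum_(p <- U) 2 * p.2 &
    (forall u, (t3 + n <= u)%N -> TT u -> (size U)%:R * d u <= 6 * l / 100 * (3 / 4) ^+ (u - (t3 + n)))].
  elim: n => [|n [U [pw U0 UW Usum Usz]]].
    exists [::]; split => //; first by rewrite addn0 big_geq// mulr0 big_nil.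
    move=> u _ _ /=; rewrite mul0r; apply: mulr_ge0; first lra.
    by apply: exprn_ge0; lra.
  have next u : (t3 + n.+1 <= u)%N -> (3 / 4 : R) ^+ (u - (t3 + n)) = 3 / 4 * (3 / 4) ^+ (u - (t3 + n.+1)).
    by rewrite addnS => h; rewrite -exprS -subSn.
  have pos u : 0 <= l * (3 / 4) ^+ u by apply: mulr_ge0; [exact: ltW|apply: exprn_ge0; lra].
  have [tt|ntt] := boolP (TT (t3 + n)%N); last first.
    exists U; split => //.
      by rewrite rec (negbTE ntt) addr0.
    move=> u tu Tu; have := Usz u (leq_trans (leq_add (leqnn _) (leqnSn n)) tu) Tu.
    rewrite next//; have := pos (u - (t3 + n.+1))%N; lra.
  set t := (t3 + n)%N in tt Usum Usz next.
  have [Tt dt ubt] := T3 t (leq_addr _ _) tt.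
  have dt0 := d0 t; have /andP[rt0 rd] := r0 t.
  have szd : (size U)%:R * d t <= 6 * l / 100.
    by have := Usz t (leqnn _) tt; rewrite subnn expr0 mulr1.
  have usum : \sum_(p <- U) 2 * p.2 <= l / 8.
    have := le_lt_trans (mu_disjoint_sum mW pw U0 UW) small.
    by rewrite lte_fin => /ltW.
  pose X := [set x | [/\ (a' + 2 * d t <= x <= b' - 2 * d t)%R,
     exists2 y, Res t y & (`|x - y| <= d t)%R &
     forall p, p \in U -> (p.2 + 2 * d t < `|x - p.1|)%R]].
  (* Lost are l/3 away from resonant points, 4 d at the ends, l/8 in the old balls and 24 l / 100 in
     their thickenings; as d < l/200, more than l/5 remains. *)
  have muX : ((l / 5)%:E <= mu X)%E.
    pose B1 := [set x | (a' <= x <= b')%R /\ ~ exists2 y, Res t y & (`|x - y| <= d t)%R].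
    pose B2 : set R := `[a', a' + 2 * d t]%classic.
    pose B3 : set R := `[b' - 2 * d t, b']%classic.
    pose B4 := [set x | exists2 p, p \in U & [set x : R | `|x - p.1| <= p.2 + 2 * d t] x].
    have B4b : (mu B4 <= (\sum_(p <- U) (2 * p.2 + 4 * d t))%:E)%E.
      rewrite /B4; elim: (U) U0 => [|p V IH] V0.
        rewrite big_nil (_ : [set x | _] = set0) ?measure0//.
        by rewrite -subset0 => x [].
      rewrite big_cons EFinD.
      rewrite (_ : [set x | _] = [set x : R | `|x - p.1| <= p.2 + 2 * d t] `|`
         [set x | exists2 p, p \in V & [set x : R | `|x - p.1| <= p.2 + 2 * d t] x]); last first.
        apply/seteqP; split=> x /=.
          by move=> [q]; rewrite inE => /orP[/eqP -> ?|qV ?]; [left|right; exists q].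
        by move=> [?|[q qV ?]]; [exists p => //; rewrite mem_head|exists q => //; rewrite inE qV orbT].
      apply: (le_trans (mu_setU _ _)); apply: leeD; last first.
        by apply: IH => q qV; apply: V0; rewrite inE qV orbT.
      have p20 : 0 <= p.2 by apply: V0; rewrite mem_head.
      have -> : 2 * p.2 + 4 * d t = (p.1 + (p.2 + 2 * d t)) - (p.1 - (p.2 + 2 * d t)) by lra.
      apply: mu_le_cc; first lra.
      by move=> x; rewrite /= ler_distl in_itv.
    have cover : `[a', b']%classic `<=` X `|` (B1 `|` (B2 `|` (B3 `|` B4))).
      move=> x; rewrite /= in_itv/= => /andP[ax xb].
      have [nx|yx] := pselect (exists2 y, Res t y & (`|x - y| <= d t)%R); last first.
        by right; left; split => //; rewrite ax xb.
      have [h2|h2] := leP x (a' + 2 * d t); first by right; right; left; rewrite /B2/= in_itv/= ax.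
      have [h3|h3] := leP (b' - 2 * d t) x; first by right; right; right; left; rewrite /B3/= in_itv/= h3.
      have [h4|h4] := pselect (B4 x); first by right; right; right; right.
      left; split => //; first by rewrite (ltW h2) (ltW h3).
      by move=> p pU; rewrite ltNge; apply/negP => h; apply: h4; exists p.
    have := mu_le cover; rewrite mu_cc ?(ltW ab')// => /le_trans/(_ (mu_setU _ _)) h1.
    have E4 : \sum_(p <- U) (2 * p.2 + 4 * d t) <= l / 8 + 24 * l / 100.
      rewrite big_split/= sumr_const_seq.
      lra.
    have m2 : (mu B2 <= (2 * d t)%:E)%E by rewrite mu_cc ?lee_fin; lra.
    have m3 : (mu B3 <= (2 * d t)%:E)%E by rewrite mu_cc ?lee_fin; lra.
    have hb : (mu (B1 `|` (B2 `|` (B3 `|` B4))) <= (l / 3 + (2 * d t + (2 * d t + (l / 8 + 24 * l / 100))))%:E)%E.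
      apply: (le_trans (mu_setU _ _)); rewrite EFinD; apply: leeD => //.
      apply: (le_trans (mu_setU _ _)); rewrite EFinD; apply: leeD => //.
      apply: (le_trans (mu_setU _ _)); rewrite EFinD; apply: leeD => //.
      by apply: (le_trans B4b); rewrite lee_fin.
    have h2 : (l%:E <= mu X + (l / 3 + (2 * d t + (2 * d t + (l / 8 + 24 * l / 100))))%:E)%E.
      by apply: (le_trans h1); apply: leeD.
    rewrite -leeBlDr// in h2.
    by apply: le_trans h2; rewrite -EFinB lee_fin; lra.
  (* Separation 100 d gives at least l / (1000 d) points; moving each by at most d to a resonant
     point keeps the new balls disjoint from one another and from the old ones. *)
  have [xs [pwx xsX xsz xmu]] := @separated_net R X a' b' (100 * d t) ab' ltac:(lra)
    ltac:(by move=> x [/andP[? ?] _ _]; lra).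
  have [ys hys] : exists ys : R -> R, forall x, x \in xs -> Res t (ys x) /\ `|x - ys x| <= d t.
    have H x : exists y, x \in xs -> Res t y /\ `|x - y| <= d t.
      have [xi|xi] := boolP (x \in xs); last by exists 0.
      by have [_ [y ry xy] _] := xsX _ xi; exists y.
    by have [ys hys] := choice H; exists ys.
  have nlow : l / 5 <= (size xs)%:R * (2 * (100 * d t)).
    by have := le_trans muX xmu; rewrite lee_fin.
  pose V := [seq (ys x, r t) | x <- xs].
  exists (V ++ U); split.
  - rewrite pairwise_cat pw andbT; apply/andP; split.
      apply/allrelP => p q /mapP[x xi ->] qU; rewrite /itv_apart/=.
      have [_ _ /(_ q qU) h] := xsX _ xi; have [_ hy] := hys _ xi.
      have := ler_distD (ys x) x q.1; lra.
    rewrite pairwise_map; apply/(pairwiseP 0) => i j; rewrite !inE => hi hj ij.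
    have := (pairwiseP 0 pwx) i j; rewrite !inE => /(_ hi hj ij) h.
    have [_ h1] := hys _ (mem_nth 0 hi); have [_ h2] := hys _ (mem_nth 0 hj).
    rewrite /itv_apart/=; move: h h1 h2; move: (nth 0 xs i) (nth 0 xs j) => u v h h1 h2.
    have := ler_distD (ys u) u v; have := ler_distD (ys v) (ys u) v.
    rewrite (distrC (ys v) v); lra.
  - by move=> p; rewrite mem_cat => /orP[/mapP[x _ ->] /=|/U0//]; exact: ltW.
  - move=> p x; rewrite mem_cat => /orP[/mapP[z zi ->] /= hx|pU]; last exact: UW.
    have [ry hy] := hys _ zi; have [/andP[z1 z2] _ _] := xsX _ zi.
    split; first by exists t, (ys z).
    move: hx hy; rewrite /= ltr_distl ler_distl in_itv/=; lra.
  - rewrite rec -/t tt big_cat/= mulrDr addrC.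
    apply: lerD => //.
    rewrite big_map/= sumr_const_seq.
    have -> : l / 500 * (r t / d t) = (l / 5) / (200 * d t) * (2 * r t).
      by field; rewrite gt_eqF.
    apply: ler_wpM2r; first lra.
    rewrite ler_pdivrMr; [lra|lra].
  - move=> u tu Tu; rewrite size_cat size_map natrD mulrDl.
    have tu' : (t <= u)%N by apply: leq_trans tu; rewrite /t addnS leqnSn.
    have h1 := Usz u tu' Tu.
    have xsz2 : (size xs)%:R * d t <= 2 * l / 100 by move: xsz; rewrite -/l; lra.
    have h2 : (size xs)%:R * d u <= 2 * l / 100 * (3 / 4) ^+ (u - t).
      apply: (@le_trans _ _ ((size xs)%:R * ((3 / 4) ^+ (u - t) * d t))).
        by apply: ler_wpM2l => //; exact: geo.
      have -> : (size xs)%:R * ((3 / 4) ^+ (u - t) * d t) = (size xs)%:R * d t * (3 / 4) ^+ (u - t) by ring.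
      by apply: ler_wpM2r => //; apply: exprn_ge0; lra.
    move: h1 h2; rewrite next//; have := pos (u - (t3 + n.+1))%N; lra.
have [n hn] := div ((1 / (1 / 500)) + \sum_(0 <= t < t3 | TT t) r t / d t).
have rd0 t : 0 <= r t / d t by have /andP[? _] := r0 t; rewrite divr_ge0 ?ltW.
have hn' : 1 / (1 / 500) < \sum_(t3 <= t < t3 + n | TT t) r t / d t.
  have : \sum_(0 <= t < n | TT t) r t / d t <= \sum_(0 <= t < t3 + n | TT t) r t / d t.
    rewrite [leRHS](@big_cat_nat _ _ _ n) ?leq_addl//= ler_wpDr//.
    by apply: sumr_ge0 => i _.
  rewrite [X in _ <= X](@big_cat_nat _ _ _ t3) ?leq_addr//=; lra.
have [U [pw U0 UW Usum _]] := build n.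
have := le_lt_trans (mu_disjoint_sum mW pw U0 UW) small; rewrite lte_fin -/l.
have : l / 500 * (1 / (1 / 500)) <= l / 500 * \sum_(t3 <= t < t3 + n | TT t) r t / d t.
  by apply: ler_wpM2l; [lra|exact: ltW].
lra.
Qed.

(** At an interior density point the complement would have relative measure tending to 1 in small
    intervals, but it is at most 7/8; 15/16 lies strictly between. *)
Lemma hits_full T : mu (`[a, b]%classic `\` hits T) = 0%E.
Proof.
set Z := _ `\` _.
have mZ : measurable Z.
  by apply: measurableD; [exact: measurable_itv|apply: open_measurable; exact: hits_open].
have [N [mN N0 hN]] := lebesgue_density mZ.
apply/eqP; rewrite -measure_le0 -N0.
apply: (@le_trans _ _ (mu (N `|` ([set a] `|` [set b])))); last first.
  apply: (le_trans (mu_setU _ _)).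
  have -> : mu ([set a] `|` [set b]) = 0%E.
    apply/eqP; rewrite -measure_le0; apply: (le_trans (mu_setU _ _)).
    by rewrite !lebesgue_measure_set1 adde0.
  by rewrite adde0.
apply: mu_le => x [xab nx]; move: (xab); rewrite /= in_itv/= => /andP[ax xb].
have [->|xa] := eqVneq x a; first by right; left.
have [->|xb'] := eqVneq x b; first by right; right.
left; apply: hN => /= lim.
have {ax} ax : a < x by rewrite lt_neqAle eq_sym xa.
have {xb} xb : x < b by rewrite lt_neqAle xb'.
have : ((\1_Z x)%:E <= (15 / 16)%:E :> \bar R)%E.
  rewrite -(cvg_lim (@ereal_hausdorff R) lim); apply: lime_le.
    by apply/cvg_ex; eexists; exact: lim.
  near=> e.
  have e0 : 0 < e by near: e; exact: nbhs_right_gt.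
  have ea : e < x - a by near: e; apply: nbhs_right_lt; rewrite subr_gt0.
  have eb : e < b - x by near: e; apply: nbhs_right_lt; rewrite subr_gt0.
  pose Ie : set R := `[x - e, x + e]%classic.
  have mI : measurable Ie by exact: measurable_itv.
  rewrite lebesgue_measure_ball ?ltW// inver mulrn_eq0/= gt_eqF//.
  have := @hits_dense T (x - e) (x + e) ltac:(lra) ltac:(lra) ltac:(lra); rewrite -/Ie.
  set H := hits T `&` _ => hH.
  have ZI : (mu (Z `&` ball x e) <= mu (Ie `\` hits T))%E.
    apply: mu_le => y [[_ ny]]; rewrite /ball/= => /ltW; rewrite distrC ler_distl => hy.
    by split => //; rewrite /Ie/= in_itv.
  have mHo : measurable (hits T) by apply: open_measurable; exact: hits_open.
  have E : mu Ie = (mu (Ie `\` hits T) + mu (Ie `&` hits T))%E.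
    exact: (@measureDI _ _ _ mu _ _ mI mHo).
  rewrite /Ie mu_cc -/Ie in E; last lra.
  have hle : (mu (Ie `\` hits T) <= (7 / 8 * (2 * e))%:E)%E.
    have f1 : mu (Ie `&` hits T) \is a fin_num.
      rewrite ge0_fin_numE//; apply: le_lt_trans (ltry (x + e - (x - e))).
      by rewrite E leeDr.
    have f2 : mu (Ie `\` hits T) \is a fin_num.
      rewrite ge0_fin_numE//; apply: le_lt_trans (ltry (x + e - (x - e))).
      by rewrite E leeDl.
    rewrite /H setIC in hH.
    move: E hH; rewrite -(fineK f1) -(fineK f2) -EFinD => -[E]; rewrite !lee_fin.
    lra.
  rewrite muleC.
  apply: (@le_lt_trans _ _ ((e *+ 2)^-1%:E * (7 / 8 * (2 * e))%:E)%E).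
    apply: lee_wpmul2l; first by rewrite lee_fin invr_ge0 mulrn_wge0// ltW.
    exact: le_trans hle.
  have e2 : e *+ 2 = 2 * e by rewrite mulr_natl.
  have e2n : 2 * e != 0 by apply/eqP; lra.
  rewrite -EFinM lte_fin e2 mulrCA mulVf// mulr1; lra.
rewrite indicE mem_set//= lee_fin; lra.
Unshelve. all: by end_near. Qed.

End ubiquity.

(** * Ubiquity of shifted rational points *)

Section resonance.
Context {R : realType}.
Notation mu := (@lebesgue_measure R).
Notation vec := (int * int * int)%type.
Variables (f f1 : R -> R) (a b s c C th1 th2 : R).
Hypothesis hcur : curved f f1 a b s c C.

Lemma curved_sub a' b' : a <= a' -> a' < b' -> b' <= b -> curved f f1 a' b' s c C.
Proof.
move=> aa ab' bb; have [_ ss c0 cC h] := hcur; split => //.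
move=> x y /andP[x1 x2] /andP[y1 y2].
by apply: h; apply/andP; split; [exact: le_trans x1|exact: le_trans bb|exact: le_trans y1|exact: le_trans bb].
Qed.

(** The first coordinate is met exactly; half of the tolerance in the second is kept for moving from
    [y] to nearby points. *)
Definition resonant (N : nat) (M : R) : set R :=
  [set y | a <= y <= b /\ exists (q : nat) (u v : int),
     [/\ (N <= q <= 2 * N)%N, q%:R * y = u%:~R + th1 & `|v%:~R + th2 - q%:R * f y| <= M / 2]].

Definition ubiL : R := 100 / (((4 * ndK c C) ^- 3) ^+ 8) ^+ 2.

Lemma ubiL_ge1 : 1 <= ubiL.
Proof.
have K192 := ndK_ge hcur.
have z0 : 0 < (4 * ndK c C) ^- 3 by rewrite invr_gt0 exprn_gt0//; lra.
have z1 : (4 * ndK c C) ^- 3 <= 1 by rewrite invf_le1 ?exprn_gt0 ?exprn_ege1//; lra.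
rewrite /ubiL ler_pdivlMr ?exprn_gt0// mul1r -exprM.
apply: (@le_trans _ _ 1); last by rewrite ler1n.
by apply: exprn_ile1 => //; exact: ltW.
Qed.

(** With R = 3 L the box satisfies R Y0 = N / 2 and R Y2 = M / 4, which forces R Y1 = 8 R^3 / T.
    Covering a target of height 3 N / 2 gives N <= q <= 2 N, and y = (u + th1) / q is the resonant
    point. The exceptions take 1/32 of the length and two end pieces of at most 1/10 each. *)
Lemma resonant_ubiquity (N : nat) (M a' b' : R) (Rr := 3 * ubiL) :
  a <= a' -> a' < b' -> b' <= b -> (0 < N)%N -> 0 < M <= 1 ->
  8 * Rr ^+ 2 * ubiL <= N%:R * M -> 16 * Rr ^+ 2 <= N%:R * M * (b' - a') ->
  2 * Rr < N%:R * M * (b' - a') ^+ 2 -> 512 * C * Rr ^+ 6 <= N%:R * M -> 1 <= N%:R * M ->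
  80 * Rr ^+ 3 <= N%:R * M * (b' - a') ->
  (mu [set x | (a' <= x <= b')%R /\ ~ exists2 y, resonant N M y &
      (`|x - y| <= 8 * Rr ^+ 3 / (N%:R * (N%:R * M)))%R] <= ((b' - a') / 3)%:E)%E.
Proof.
move=> aa ab' bb N0 /andP[M0 M1] A1 A2 A3 A4 A5 A6.
have [ab _ c0 /andP[_ C1] _] := hcur.
have hc' := curved_sub aa ab' bb.
have K192 := ndK_ge hcur.
have L1 := ubiL_ge1.
have Rr3 : 3 <= Rr by rewrite /Rr; lra.
have RrE : Rr = 3 * ubiL by [].
have Rr0 : 0 < Rr by lra.
clearbody Rr.
set L := ubiL in L1 A1 RrE *.
set T := N%:R * M in A1 A2 A3 A4 A5 A6 *.
pose z0 := (4 * ndK c C) ^- 3.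
have z00 : 0 < z0 by rewrite invr_gt0 exprn_gt0//; lra.
have z01 : z0 <= 1 by rewrite invf_le1 ?exprn_gt0 ?exprn_ege1//; lra.
have LE : L = 100 / (z0 ^+ 8) ^+ 2 by [].
clearbody L.
have NR : 0 < N%:R :> R by rewrite ltr0n.
have T0 : 0 < T by rewrite mulr_gt0.
have TN : T <= N%:R by rewrite /T ler_piMr// ltW.
have l0 : 0 < b' - a' by rewrite subr_gt0.
pose Y0 := N%:R / (2 * Rr); pose Y1 := 8 * Rr ^+ 2 / T; pose Y2 := M / (4 * Rr).
have Rn : Rr != 0 by rewrite gt_eqF.
have Nn : (N%:R : R) != 0 by rewrite gt_eqF.
have Mn : M != 0 by rewrite gt_eqF.
have Tn : T != 0 by rewrite gt_eqF.
have Rr20 : 0 < Rr ^+ 2 by rewrite exprn_gt0.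
have Rr30 : 0 < Rr ^+ 3 by rewrite exprn_gt0.
have Y00 : 0 < Y0 by apply: divr_gt0 => //; lra.
have Y10 : 0 < Y1 by apply: divr_gt0 => //; lra.
have Y20 : 0 < Y2 by apply: divr_gt0 => //; lra.
have YE : Y0 * Y1 * Y2 = 1 by rewrite /Y0 /Y1 /Y2 /T; field; rewrite Rn Nn Mn.
have LY1 : L * Y1 <= 1 by rewrite /Y1 mulrA ler_pdivrMr// mul1r mulrC.
have Y11 : Y1 <= 1 by apply: le_trans LY1; rewrite ler_peMl// ltW.
have Y21 : Y2 <= 1 by rewrite /Y2 ler_pdivrMr; lra.
have LY2 : L * Y2 <= 1 by rewrite /Y2 mulrA ler_pdivrMr; [rewrite mul1r RrE; nra|lra].
have Yab : 2 * Y1 <= b' - a'.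
  by rewrite /Y1 mulrA ler_pdivrMr//; move: A2; rewrite [T * _]mulrC; lra.
have Yab2 : Y1 * Y2 < (b' - a') ^+ 2.
  have -> : Y1 * Y2 = 2 * Rr / N%:R by rewrite /Y1 /Y2 /T; field; rewrite Rn Nn Mn.
  rewrite ltr_pdivrMr// [ltRHS]mulrC; apply: (lt_le_trans A3).
  by rewrite ler_pM2r// exprn_gt0.
have nd := @nondivergence R f f1 a' b' s c C hc' Y0 Y1 Y2 Y00 Y10 Y20 YE Y11 Y21 Yab Yab2 z0 z00 (lexx _).
clear A1 A2 A3 Y11 Y21 Yab Yab2.
have Kz : 2 * ndK c C * z0 <= 1 / 32.
  have -> : z0 = 1 / (4 * ndK c C * (4 * ndK c C) ^+ 2) by rewrite /z0 -exprS div1r.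
  set Kc := ndK c C in K192 *.
  have K0 : 0 < Kc by lra.
  have -> : 2 * Kc * (1 / (4 * Kc * (4 * Kc) ^+ 2)) = 1 / (2 * (4 * Kc) ^+ 2).
    by field; rewrite gt_eqF.
  have K2 : 16 <= (4 * Kc) ^+ 2 by rewrite expr2; nra.
  rewrite ler_pdivrMr; lra.
pose d := 8 * Rr ^+ 3 / (N%:R * T).
have d0 : 0 < d by apply: divr_gt0; [lra|exact: mulr_gt0].
have N1 : (1 : R) <= N%:R by rewrite ler1n.
have dE : d = N%:R^-1 * (8 * Rr ^+ 3 / T) by rewrite /d; field; rewrite Nn Tn.
have dT : d <= 8 * Rr ^+ 3 / T.
  rewrite dE; apply: ler_piMl; first by apply: divr_ge0; lra.
  by rewrite invf_le1.
have dl : 10 * d <= b' - a'.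
  apply: (@le_trans _ _ (10 * (8 * Rr ^+ 3 / T))); first lra.
  by rewrite mulrA ler_pdivrMr//; move: A6; rewrite [T * _]mulrC; lra.
pose PBad := PB f f1 a' b' Y0 Y1 Y2 (z0 ^+ 8).
apply: (@le_trans _ _ (mu (PBad `|` (`[a', a' + d]%classic `|` `[b' - d, b']%classic)))); last first.
  apply: (le_trans (mu_setU _ _)).
  apply: (@le_trans _ _ ((2 * ndK c C * z0 * (b' - a'))%:E + ((a' + d - a')%:E + (b' - (b' - d))%:E))%E).
    apply: leeD => //; apply: (le_trans (mu_setU _ _)).
    by rewrite !mu_cc//; lra.
  rewrite -!EFinD lee_fin.
  have : 2 * ndK c C * z0 * (b' - a') <= 1 / 32 * (b' - a') by rewrite ler_pM2r.
  lra.
apply: mu_le => x [xab nres].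
have [?|nb] := pselect (PBad x); first by left.
have [h1|h1] := leP x (a' + d).
  by right; left; rewrite /= in_itv/= h1 andbT; case/andP: xab.
have [h2|h2] := leP (b' - d) x.
  by right; right; rewrite /= in_itv/= h2/=; case/andP: xab.
exfalso; apply: nres.
have good (w : vec) : w <> (0, 0, 0) -> ~ psmall f f1 Y0 Y1 Y2 (z0 ^+ 8) w x.
  by move=> wn0 sw; apply: nb; split => //; exists w.
have e0 : 0 < z0 ^+ 8 by rewrite exprn_gt0.
have e1 : z0 ^+ 8 <= 1 by apply: exprn_ile1 => //; exact: ltW.
have [[[q u] v] /= [w1 w2 w3]] := lattice_covering Y00 Y10 Y20 YE e0 e1 LE LY1 LY2 good
  (3 / 2 * N%:R) (- th1) (f1 x * th1 - th2).
clear YE LY1 LY2 LE Kz K192 z01 e1 nd good nb dl dT A6 L1.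
rewrite -RrE in w1 w2 w3.
have E1 : Rr * Y0 = N%:R / 2 by rewrite /Y0; field.
have E2 : Rr * Y1 = 8 * Rr ^+ 3 / T by rewrite /Y1; field.
have E3 : Rr * Y2 = M / 4 by rewrite /Y2; field.
rewrite E1 in w1; rewrite E2 in w2; rewrite E3 in w3; clear E1 E2 E3.
move: w1; rewrite ler_distl => /andP[q1 q2].
have qN : N%:R <= q%:~R :> R by lra.
have q2N : q%:~R <= 2 * N%:R :> R by lra.
have q0 : 0 < q%:~R :> R by lra.
have qn0 : q%:~R != 0 :> R by rewrite gt_eqF.
case: q q1 q2 qN q2N q0 qn0 w2 w3 => [q|q] q1 q2 qN q2N q0 qn0 w2 w3; last first.
  by move: q0; rewrite ltr0z.
rewrite -!pmulrn in q1 q2 qN q2N q0 qn0 w2 w3.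
pose y := (u%:~R + th1) / q%:R.
have qy : q%:R * y = u%:~R + th1 by rewrite /y mulrCA mulfV// mulr1.
have w2' : `|q%:R * (y - x)| <= 8 * Rr ^+ 3 / T.
  by move: w2; rewrite /alpha (_ : _ - - th1 = q%:R * (y - x))//; rewrite mulrBr qy; ring.
have xy : `|y - x| <= d.
  rewrite dE ler_pdivlMl//.
  apply: le_trans w2'; rewrite normrM (gtr0_norm q0).
  by apply: ler_wpM2r.
have yab : a' <= y <= b' by move: xy; rewrite ler_distl; lra.
have yab0 : a <= y <= b by case/andP: yab => ? ?; apply/andP; split; [exact: le_trans aa _|exact: le_trans bb].
exists y; last by rewrite distrC.
split => //; exists q, u, v; split => //.
  by rewrite -!(ler_nat R) natrM qN q2N.
have rem := curved_remainder hc' xab yab.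
(* The deviation at [y] is the tangential deviation at [x] minus q times the remainder; each is at
   most M / 4. *)
have E : v%:~R + th2 - q%:R * f y = (tau f f1 q%:R u%:~R v%:~R x - (f1 x * th1 - th2)) - q%:R * remainder f f1 x y.
  rewrite /tau /alpha /remainder.
  have -> : u%:~R = q%:R * y - th1 :> R by rewrite qy addrK.
  ring.
rewrite E; apply: (le_trans (ler_normB _ _)).
suff : `|q%:R * remainder f f1 x y| <= M / 4 by lra.
rewrite normrM (gtr0_norm q0).
apply: (@le_trans _ _ (2 * N%:R * (C * d ^+ 2))).
  apply: ler_pM => //; apply: (le_trans rem); apply: ler_wpM2l; first lra.
  by rewrite -[X in X <= _]real_normK ?num_real// ler_pXn2r// nnegrE// ltW.
have -> : 2 * N%:R * (C * d ^+ 2) = (128 * C * Rr ^+ 6) / (N%:R * T ^+ 2).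
  by rewrite /d; field; rewrite Nn Tn.
rewrite ler_pdivrMr; last by rewrite mulr_gt0// exprn_gt0.
have -> : M / 4 * (N%:R * T ^+ 2) = T * T ^+ 2 / 4 by rewrite /T; ring.
have : T <= T * T ^+ 2.
  by apply: ler_peMr; [exact: ltW|exact: exprn_ege1].
lra.
Qed.

Lemma curved_lipschitz (Cf x y : R) : (forall z, a <= z <= b -> `|f1 z| <= Cf) ->
  a <= x <= b -> a <= y <= b -> `|f y - f x| <= (Cf + C * (b - a)) * `|y - x|.
Proof.
move=> hC xab yab; have [ab _ c0 /andP[_ C1] _] := hcur.
have rem := curved_remainder hcur xab yab.
have -> : f y - f x = f1 x * (y - x) + remainder f f1 x y by rewrite /remainder; ring.
apply: (le_trans (ler_normD _ _)); rewrite normrM mulrDl; apply: lerD.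
  by apply: ler_wpM2r => //; exact: hC.
apply: (le_trans rem); rewrite -real_normK ?num_real// expr2 mulrA; apply: ler_wpM2r => //.
apply: ler_wpM2l; first lra.
by rewrite ler_distl; lra.
Qed.

End resonance.

(** * Record levels *)

Section records.
Context {R : realType}.
Variables (M m : nat -> R).
Hypotheses (M0 : forall t, 0 < M t) (m0 : forall t, 0 < m t)
  (mdec : forall t, m t.+1 <= m t).

Let W t := 3 ^+ t * M t.
Let wmax n := iteri n (fun k w => Order.max w (W k)) 0.
Definition mass t : R := 2 ^+ t * (m t * M t).
(** At a record, 1 / (4^t M_t) = (3/4)^t / (3^t M_t) has dropped by at least (3/4)^(t - s) since any
    earlier level s, the decay that ubiquity requires. *)
Definition record t : bool := [forall s : 'I_t, 3 ^+ s * M s <= 3 ^+ t * M t].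

Lemma record_max s t : record t -> (s <= t)%N -> 3 ^+ s * M s <= 3 ^+ t * M t.
Proof.
rewrite leq_eqVlt => /forallP rt /predU1P[->//|st].
exact: (rt (Ordinal st)).
Qed.

Let wmax_le n x : 0 <= x -> (wmax n <= x) = [forall s : 'I_n, W s <= x].
Proof.
move=> x0; apply/idP/forallP => [|h].
  elim: n => [_ []//|n IH]; rewrite /wmax/= -/(wmax n) ge_max => /andP[/IH h1 h2] [k kn].
  have := kn; rewrite ltnS leq_eqVlt => /predU1P[kE|kn'] /=; first by rewrite kE.
  exact: (h1 (Ordinal kn')).
elim: n h => [//|n IH] h; rewrite /wmax/= -/(wmax n) ge_max; apply/andP; split.
  by apply: IH => i; exact: (h (widen_ord (leqnSn n) i)).
exact: (h ord_max).
Qed.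

(* Between two records of 3^t M_t the masses decay like (2/3)^t. *)
Lemma record_mass n : \sum_(0 <= t < n) mass t <= 3 * \sum_(0 <= t < n | record t) mass t.
Proof.
have W0 t : 0 < W t by rewrite mulr_gt0// exprn_gt0.
have w0 k : 0 <= wmax k.
  by elim: k => [//|k IH]; rewrite /wmax/= -/(wmax k) le_max IH.
have q0 k : 0 <= (2 / 3 : R) ^+ k by apply: exprn_ge0; lra.
(* Strengthened for induction: the added term is the whole geometric tail, of factor 3 = 1 / (1 -
   2/3), to be expected if no record follows. *)
suff : \sum_(0 <= t < n) mass t + 3 * (2 / 3) ^+ n * (wmax n * m n) <=
    3 * \sum_(0 <= t < n | record t) mass t.
  move=> h; apply: le_trans h; rewrite lerDl.
  apply: mulr_ge0; first by apply: mulr_ge0.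
  by apply: mulr_ge0 => //; exact: ltW.
elim: n => [|n IH]; first by rewrite !big_geq// /wmax/= mul0r !mulr0 addr0.
have massE : mass n = (2 / 3) ^+ n * (W n * m n).
  by rewrite /mass /W expr_div_n; field; rewrite expf_neq0.
have wS : wmax n.+1 = Order.max (wmax n) (W n) by [].
have rE : record n = (wmax n <= W n) by rewrite wmax_le// ltW.
have md := mdec n; have mn0 := m0 n; have mS0 := m0 n.+1.
rewrite wS; move: (wmax n) (w0 n) IH rE => w wn IH rE.
rewrite big_nat_recr//= [X in _ <= 3 * X]big_mkcond big_nat_recr//= -big_mkcond/=.
rewrite [(2 / 3) ^+ n.+1]exprS massE rE.
have := q0 n; move: ((2 / 3) ^+ n) IH (W0 n) => Q IH Wn Q0.
have [h|h] := leP w (W n).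
  have k1 : Q * (W n * m n.+1) <= Q * (W n * m n).
    by apply: ler_wpM2l => //; apply: ler_wpM2l => //; exact: ltW.
  have k2 : 0 <= Q * (w * m n) by apply: mulr_ge0 => //; apply: mulr_ge0 => //; exact: ltW.
  by rewrite mulrDr; lra.
have k1 : Q * (w * m n.+1) <= Q * (w * m n).
  by apply: ler_wpM2l => //; apply: ler_wpM2l.
have k2 : Q * (W n * m n) <= Q * (w * m n).
  by apply: ler_wpM2l => //; apply: ler_wpM2r; exact: ltW.
by rewrite addr0; lra.
Qed.

End records.

(** * Divergence under truncation and splitting *)

Section truncated_sums.
Context {R : realType}.

(** Either the terms are eventually at most 1 and capping alters finitely many, or infinitely many
    capped terms equal 1. *)
Lemma sum_min1_unbounded (P : pred nat) (p : nat -> R) : (forall t, 0 <= p t) ->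
  (forall B : R, exists n, B < \sum_(0 <= t < n | P t) p t) ->
  forall B : R, exists n, B < \sum_(0 <= t < n | P t) Order.min (p t) 1.
Proof.
move=> p0 div.
have min0 t : 0 <= Order.min (p t) 1 by rewrite le_min p0 ler01.
have [[t1 ht1]|inf] := pselect (exists t1, forall t, (t1 <= t)%N -> P t -> p t <= 1).
  move=> B; have [n hn] := div (B + \sum_(0 <= t < t1 | P t) p t).
  exists (t1 + n)%N.
  have h1 : \sum_(0 <= t < n | P t) p t <= \sum_(0 <= t < t1 + n | P t) p t.
    rewrite [leRHS](@big_cat_nat _ _ _ n) ?leq_addl//= lerDl.
    by apply: sumr_ge0 => i _.
  move: h1; rewrite [X in _ <= X](@big_cat_nat _ _ _ t1) ?leq_addr//= => h1.
  rewrite (@big_cat_nat _ _ _ t1) ?leq_addr//=.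
  have h2 : 0 <= \sum_(0 <= t < t1 | P t) Order.min (p t) 1 by apply: sumr_ge0.
  have h3 : \sum_(t1 <= t < t1 + n | P t) p t <= \sum_(t1 <= t < t1 + n | P t) Order.min (p t) 1.
    rewrite big_nat_cond [leRHS]big_nat_cond; apply: ler_sum => t /andP[/andP[tt _] Pt].
    by rewrite le_min lexx ht1.
  lra.
have inf' t1 : exists t, [/\ (t1 <= t)%N, P t & 1 < p t].
  apply: contrapT => h; apply: inf; exists t1 => t tt Pt; rewrite leNgt; apply/negP => h'.
  by apply: h; exists t.
have key (k : nat) : exists n, k%:R <= \sum_(0 <= t < n | P t) Order.min (p t) 1.
  elim: k => [|k [n hn]]; first by exists 0%N; rewrite big_geq.
  have [t [nt Pt pt]] := inf' n.
  exists t.+1; rewrite big_mkcond big_nat_recr//= -big_mkcond/= Pt.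
  have -> : Order.min (p t) 1 = 1 by apply: min_r; exact: ltW.
  rewrite -natr1 lerD2r; apply: (le_trans hn).
  rewrite [leRHS](@big_cat_nat _ _ _ n)//= lerDl; exact: sumr_ge0.
move=> B; have [n hn] := key (Num.trunc B).+1; exists n.
by apply: lt_le_trans hn; exact: truncnS_gt.
Qed.

Lemma sum_pred_split (P Q : pred nat) (p : nat -> R) :
  (forall B : R, exists n, B < \sum_(0 <= t < n | P t) p t) ->
  ~ (forall B : R, exists n, B < \sum_(0 <= t < n | P t && Q t) p t) ->
  (forall B : R, exists n, B < \sum_(0 <= t < n | P t && ~~ Q t) p t).
Proof.
move=> div h B.
have [B1 hB1] : exists B1, forall n, \sum_(0 <= t < n | P t && Q t) p t <= B1.
  apply: contrapT => h'; apply: h => B1; apply: contrapT => h2; apply: h'; exists B1 => n.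
  by rewrite leNgt; apply/negP => h3; apply: h2; exists n.
have [n hn] := div (B + B1); exists n.
move: hn; rewrite (bigID Q)/=; have := hB1 n; lra.
Qed.

Lemma half_power_unbounded (B : R) : exists t1, forall t, (t1 <= t)%N -> B <= (3 / 2) ^+ t.
Proof.
have low t : 1 + t%:R / 2 <= (3 / 2 : R) ^+ t.
  elim: t => [|t IH]; first by rewrite expr0 mul0r addr0.
  rewrite exprS -natr1; have : (0 : R) <= t%:R by []; lra.
exists (2 * (Num.trunc B).+1)%N => t tt; apply: le_trans (low t).
have : ((2 * (Num.trunc B).+1)%:R : R) <= t%:R by rewrite ler_nat.
have := truncnS_gt B; rewrite natrM; lra.
Qed.

End truncated_sums.

(** * Divergence when psi1 is the smaller function *)

Section divergence.
Context {R : realType}.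
Notation mu := (@lebesgue_measure R).

(** Taken at 2^(t+1), the top height of level t, where decreasing psi are smallest on that level. *)
Definition maxpsi (psi1 psi2 : nat -> R) (t : nat) : R :=
  Order.max (psi1 (2 ^ t.+1)%N) (psi2 (2 ^ t.+1)%N).
Definition minpsi (psi1 psi2 : nat -> R) (t : nat) : R :=
  Order.min (psi1 (2 ^ t.+1)%N) (psi2 (2 ^ t.+1)%N).

(** Records give the decay of [d]; the lower bound on the mass gives T^2 >= 2^t m T >= (3/2)^t, so T
    tends to infinity and the resonant points are ubiquitous. As psi1 <= psi2, the coordinate met
    exactly is the one with the smaller tolerance. *)
Lemma divergence_type (f f1 : R -> R) (a b s c C Cf th1 th2 : R) (psi1 psi2 : nat -> R) (TT : pred nat)
  (M := maxpsi psi1 psi2) (m := minpsi psi1 psi2) :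
  curved f f1 a b s c C -> (forall x, a <= x <= b -> `|f1 x| <= Cf) ->
  decreasing_to0 psi1 -> decreasing_to0 psi2 ->
  (forall t, TT t -> [/\ record M t, (3 / 4) ^+ t <= mass M m t & psi1 (2 ^ t.+1)%N <= psi2 (2 ^ t.+1)%N]) ->
  (forall B : R, exists n, B < \sum_(0 <= t < n | TT t) mass M m t) ->
  mu [set x | (a <= x <= b)%R /\ ~ forall n, exists2 q, (n <= q)%N & solvable psi1 psi2 th1 th2 x (f x) q] = 0%E.
Proof.
move=> hcur hCf [p1pos p1dec p1lim] [p2pos p2dec p2lim] hTT div.
have [ab _ c0 /andP[_ C1] _] := hcur.
have L1 := ubiL_ge1 hcur.
have [Rr [Rr0 RrE]] : exists Rr, 0 < Rr /\ Rr = 3 * ubiL c C.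
  by exists (3 * ubiL c C); split => //; lra.
have t2 t : (0 < 2 ^ t)%N by rewrite expn_gt0.
have NR t : 0 < (2 ^ t)%:R :> R by rewrite ltr0n.
have M0 t : 0 < M t by rewrite lt_max p1pos.
have m0 t : 0 < m t by rewrite lt_min p1pos// p2pos.
have mM t : m t <= M t by rewrite ge_min le_max lexx.
have [D0 [D01 D0E]] : exists D0, 1 <= D0 /\ D0 = 8 * Rr ^+ 3.
  exists (8 * Rr ^+ 3); split => //.
  have : 1 <= Rr ^+ 3 by apply: exprn_ege1; lra.
  lra.
have D00 : 0 < D0 by lra.
pose Lam := Cf + C * (b - a).
have aab : a <= a <= b by rewrite lexx ltW.
have Cf0 : 0 <= Cf by exact: le_trans (normr_ge0 _) (hCf _ aab).
have Lam0 : 0 <= Lam by apply: addr_ge0 => //; apply: mulr_ge0; lra.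
(* Small enough that moving by less than [r] from a resonant point changes q f by at most m / 4. *)
pose kap := (8 * (1 + Lam))^-1.
have kap0 : 0 < kap by rewrite invr_gt0; lra.
have kapE : kap * (8 * (1 + Lam)) = 1 by rewrite mulVf// gt_eqF//; lra.
have kap1 : kap <= 1 by rewrite invf_le1; lra.
pose T t := (2 ^ t)%:R * M t.
have T0 t : 0 < T t by exact: mulr_gt0.
pose d t := D0 / ((2 ^ t)%:R * T t).
have NT0 t : 0 < (2 ^ t)%:R * T t by exact: mulr_gt0.
have d0 t : 0 < d t by exact: divr_gt0.
(* The cap 1 / T ensures r <= d; then r / d is, up to a constant, the mass truncated at 1. *)
pose r t := kap * Order.min (m t) (T t)^-1 / (2 ^ t)%:R.
have mt0 t : 0 < Order.min (m t) (T t)^-1 by rewrite lt_min m0 invr_gt0 T0.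
have r0 t : 0 < r t <= d t.
  apply/andP; split; first by apply: divr_gt0 => //; exact: mulr_gt0.
  have -> : d t = D0 * (T t)^-1 / (2 ^ t)%:R by rewrite /d; field; rewrite !gt_eqF.
  rewrite /r ler_pM2r ?invr_gt0//; apply: ler_pM; [exact: ltW|exact: ltW|lra|].
  by rewrite ge_min lexx orbT.
have massE t : mass M m t = m t * T t by rewrite /mass /T natrX; ring.
have rd t : r t / d t = kap / D0 * Order.min (mass M m t) 1.
  have -> : Order.min (mass M m t) 1 = Order.min (m t) (T t)^-1 * T t.
    rewrite massE /Order.min -ltr_pdivlMr// div1r; case: ifP => // _.
    by rewrite mulVf// gt_eqF.
  by rewrite /r /d; field; rewrite !gt_eqF.
have Tlim B : exists t1, forall t, (t1 <= t)%N -> TT t -> B <= T t.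
  have [t1 ht1] := half_power_unbounded (B ^+ 2).
  exists t1 => t tt /hTT[_ hm _].
  have [B0|B0] := leP B 0; first by apply: (le_trans B0); exact: ltW.
  rewrite -(@ler_pXn2r _ 2)//; [|by rewrite nnegrE ltW|by rewrite nnegrE ltW].
  apply: (le_trans (ht1 _ tt)).
  have -> : (3 / 2 : R) ^+ t = 2 ^+ t * (3 / 4) ^+ t by rewrite -exprMn; congr (_ ^+ _); lra.
  have -> : T t ^+ 2 = 2 ^+ t * (M t * T t) by rewrite /T natrX; ring.
  rewrite ler_pM2l ?exprn_gt0//; apply: (le_trans hm); rewrite massE.
  by rewrite ler_pM2r.
have geo s' t : TT s' -> TT t -> (s' <= t)%N -> d t <= (3 / 4) ^+ (t - s') * d s'.
  move=> _ /hTT[rt _ _] st.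
  have dW u : d u = D0 * ((3 / 4) ^+ u / (3 ^+ u * M u)).
    have n1 : (3 : R) ^+ u != 0 by rewrite expf_neq0.
    have n2 : (2 : R) ^+ u != 0 by rewrite expf_neq0.
    have -> : (3 / 4 : R) ^+ u = 3 ^+ u / (2 ^+ u * 2 ^+ u).
      by rewrite expr_div_n -exprMn; congr (_ / _ ^+ _); lra.
    by rewrite /d /T natrX; field; rewrite n1 n2 gt_eqF.
  have W0 u : 0 < 3 ^+ u * M u by rewrite mulr_gt0// exprn_gt0.
  have q0 u : 0 < (3 / 4 : R) ^+ u by apply: exprn_gt0; lra.
  rewrite !dW.
  have -> : (3 / 4) ^+ (t - s') * (D0 * ((3 / 4) ^+ s' / (3 ^+ s' * M s'))) =
     D0 * ((3 / 4) ^+ t / (3 ^+ s' * M s')).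
    have -> : (3 / 4 : R) ^+ t = (3 / 4) ^+ (t - s') * (3 / 4) ^+ s' by rewrite -exprD subnK.
    ring.
  rewrite ler_pM2l// ler_pM2l// lef_pV2 ?posrE//.
  exact: record_max.
have dlim e : 0 < e -> exists t1, forall t, (t1 <= t)%N -> TT t -> d t < e.
  move=> e0; have [t1 ht1] := Tlim (D0 / e + 1); exists t1 => t tt Tt.
  have h := ht1 t tt Tt.
  have N1 : (1 : R) <= (2 ^ t)%:R by rewrite ler1n.
  rewrite /d ltr_pdivrMr// mulrC -ltr_pdivrMr//.
  have : T t <= (2 ^ t)%:R * T t by rewrite ler_peMl// ltW.
  lra.
have div' B : exists n, B < \sum_(0 <= t < n | TT t) r t / d t.
  have mass0 t : 0 <= mass M m t by rewrite massE; apply: mulr_ge0; exact: ltW.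
  have kD : 0 < kap / D0 by exact: divr_gt0.
  have [n hn] := sum_min1_unbounded mass0 div (B / (kap / D0)).
  exists n; under eq_bigr do rewrite rd.
  by rewrite -mulr_sumr mulrC -ltr_pdivrMr.
have ubi a' b' : a <= a' -> a' < b' -> b' <= b -> exists t1, forall t, (t1 <= t)%N -> TT t ->
  (mu [set x | (a' <= x <= b')%R /\ ~ exists2 y, resonant f a b th1 th2 (2 ^ t) (M t) y & (`|x - y| <= d t)%R] <=
   ((b' - a') / 3)%:E)%E.
  move=> aa ab' bb.
  have l0 : 0 < b' - a' by rewrite subr_gt0.
  have [u1 hu1] := Tlim (8 * Rr ^+ 2 * ubiL c C).
  have [u2 hu2] := Tlim (16 * Rr ^+ 2 / (b' - a')).
  have [u3 hu3] := Tlim (2 * Rr / (b' - a') ^+ 2 + 1).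
  have [u4 hu4] := Tlim (512 * C * Rr ^+ 6).
  have [u5 hu5] := Tlim 1.
  have [u6 hu6] := Tlim (80 * Rr ^+ 3 / (b' - a')).
  have [u7 hu7] := p1lim 1 ltr01.
  have [u8 hu8] := p2lim 1 ltr01.
  exists (u1 + (u2 + (u3 + (u4 + (u5 + (u6 + (u7 + u8)))))))%N => t tt Tt.
  have [k1 tt1] : (u1 <= t)%N /\ (u2 + (u3 + (u4 + (u5 + (u6 + (u7 + u8))))) <= t)%N.
    by split; apply: leq_trans tt; [exact: leq_addr|exact: leq_addl].
  have [k2 tt2] : (u2 <= t)%N /\ (u3 + (u4 + (u5 + (u6 + (u7 + u8)))) <= t)%N.
    by split; apply: leq_trans tt1; [exact: leq_addr|exact: leq_addl].
  have [k3 tt3] : (u3 <= t)%N /\ (u4 + (u5 + (u6 + (u7 + u8))) <= t)%N.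
    by split; apply: leq_trans tt2; [exact: leq_addr|exact: leq_addl].
  have [k4 tt4] : (u4 <= t)%N /\ (u5 + (u6 + (u7 + u8)) <= t)%N.
    by split; apply: leq_trans tt3; [exact: leq_addr|exact: leq_addl].
  have [k5 tt5] : (u5 <= t)%N /\ (u6 + (u7 + u8) <= t)%N.
    by split; apply: leq_trans tt4; [exact: leq_addr|exact: leq_addl].
  have [k6 tt6] : (u6 <= t)%N /\ (u7 + u8 <= t)%N.
    by split; apply: leq_trans tt5; [exact: leq_addr|exact: leq_addl].
  have [k7 k8] : (u7 <= t)%N /\ (u8 <= t)%N.
    by split; apply: leq_trans tt6; [exact: leq_addr|exact: leq_addl].
  have t2t : (t <= 2 ^ t.+1)%N by rewrite ltnW// (leq_trans (ltn_expl t (isT : (1 < 2)%N)))// leq_exp2l.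
  have M1 : M t <= 1.
    rewrite ge_max; apply/andP; split; apply/ltW; [apply: hu7|apply: hu8]; exact: leq_trans t2t.
  have := @resonant_ubiquity R f f1 a b s c C th1 th2 hcur (2 ^ t) (M t) a' b' aa ab' bb (t2 t).
  rewrite M0 M1 -RrE -/(T t) -D0E -/(d t); apply => //.
  - exact: hu1.
  - by rewrite -ler_pdivrMr//; exact: hu2.
  - by rewrite -ltr_pdivrMr ?exprn_gt0//; have := hu3 t k3 Tt; lra.
  - exact: hu4.
  - exact: hu5.
  - by rewrite -ler_pdivrMr//; exact: hu6.
have full T' := hits_full d0 r0 geo dlim div' ubi T'.
apply/eqP; rewrite -measure_le0.
apply: (@le_trans _ _ (mu (\bigcup_T' (`[a, b]%classic `\` hits TT r (fun t => resonant f a b th1 th2 (2 ^ t) (M t)) T')))); last first.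
  by apply: (le_trans (mu_bigcup _)); rewrite eseries0.
apply: mu_le => x [xab nx].
apply: contrapT => ncov; apply: nx => n.
have : hits TT r (fun t => resonant f a b th1 th2 (2 ^ t) (M t)) n x.
  have xI : `[a, b]%classic x by rewrite /= in_itv.
  by apply: contrapT => nh; apply: ncov; exists n => //; exact: (conj xI nh).
move=> [t [y [nt Tt [yab [q [u [v [/andP[qN q2N] qy hv]]]]] xy]]].
have [_ _ p12] := hTT _ Tt.
have mE : m t = psi1 (2 ^ t.+1)%N by rewrite /m /minpsi min_l.
have ME : M t = psi2 (2 ^ t.+1)%N by rewrite /M /maxpsi max_r.
exists q.
  by apply: leq_trans nt _; apply: leq_trans qN; rewrite ltnW// ltn_expl.
have q0 : (0 < q)%N by apply: leq_trans qN.
have q2 : (q <= 2 ^ t.+1)%N by rewrite expnS.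
have qr : q%:R * `|x - y| < 2 * kap * m t.
  apply: (@lt_le_trans _ _ (q%:R * r t)); first by rewrite ltr_pM2l// ltr0n.
  have hr : (2 ^ t)%:R * r t <= kap * m t.
    have -> : (2 ^ t)%:R * r t = kap * Order.min (m t) (T t)^-1 by rewrite /r mulrC divfK// gt_eqF.
    by rewrite ler_pM2l// ge_min lexx.
  have : (q%:R : R) <= 2 * (2 ^ t)%:R by rewrite -natrM ler_nat.
  move=> hq; have /andP[rt0 _] := r0 t.
  have : q%:R * r t <= 2 * (2 ^ t)%:R * r t by rewrite ler_pM2r.
  lra.
have k8 : kap <= 1 / 8 by nra.
have kL : kap * Lam <= 1 / 8 by nra.
exists u, v; split.
  have -> : u%:~R + th1 - q%:R * x = - (q%:R * (x - y)) by rewrite -qy; ring.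
  rewrite normrN normrM ger0_norm//; apply: (lt_le_trans qr).
  apply: (@le_trans _ _ (m t)); last by rewrite mE p1dec.
  by have := m0 t; nra.
apply: (@lt_le_trans _ _ (M t)); last by rewrite ME p2dec.
have -> : v%:~R + th2 - q%:R * f x = (v%:~R + th2 - q%:R * f y) - q%:R * (f x - f y) by ring.
apply: (le_lt_trans (ler_normB _ _)); rewrite [`|q%:R * _|]normrM [`|q%:R|]ger0_norm//.
have lip := curved_lipschitz hcur hCf yab xab.
have : q%:R * `|f x - f y| <= Lam * (q%:R * `|x - y|).
  by rewrite mulrCA; apply: ler_wpM2l.
have : Lam * (q%:R * `|x - y|) <= Lam * (2 * kap * m t) by apply: ler_wpM2l => //; exact: ltW.
have : kap * Lam * m t <= 1 / 8 * m t by rewrite ler_pM2r.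
have := mM t; have := m0 t; lra.
Qed.

(** Open intervals covering the image pull back to pieces of [A] of diameter at most their length
    over k. Only covers are used, so [A] is arbitrary. *)
Lemma null_preimage (A : set R) (u : R -> R) (k : R) : 0 < k ->
  (forall x y, A x -> A y -> k * `|x - y| <= `|u x - u y|) ->
  mu (u @` A) = 0%E -> mu A = 0%E.
Proof.
move=> k0 hk uA0; apply/eqP; rewrite -measure_le0.
apply/lee_addgt0Pr => e e0; rewrite add0e.
have e2 : 0 < k * e / 2 by rewrite divr_gt0// mulr_gt0.
have [F [FO FA] Fe] : exists2 F, open_itv_cover (u @` A) F &
   (\sum_(0 <= i <oo) (wlength idfun) (F i) <= (k * e / 2)%:E)%E.
  have E := outer_measure_open_itv_cover (u @` A).
  have fn : ereal_inf [set (\sum_(i <oo) wlength idfun (F i))%E | F in open_itv_cover (u @` A)] \is a fin_num.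
    by rewrite -E [X in X \is a fin_num]uA0.
  have [_ [F hF <-] hlt] := lb_ereal_inf_adherent e2 fn.
  exists F => //; apply: (le_trans (ltW hlt)).
  by rewrite -E [X in (X + _)%E](_ : _ = 0%E)// add0e.
apply: (@le_trans _ _ (mu (\bigcup_i (A `&` u @^-1` F i)))).
  apply: mu_le => x Ax; have [i _ Fi] := FA (u x) (ex_intro2 _ _ x Ax erefl).
  by exists i.
apply: (le_trans (mu_bigcup _)).
apply: (@le_trans _ _ (\sum_(0 <= i <oo) (2 / k)%:E * wlength idfun (F i))%E); last first.
  rewrite nneseriesZl; last by move=> *; exact: wlength_ge0.
  apply: (@le_trans _ _ ((2 / k)%:E * (k * e / 2)%:E)%E).
    by apply: lee_wpmul2l => //; rewrite lee_fin divr_ge0// ltW.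
  by rewrite -EFinM lee_fin le_eqVlt; apply/orP; left; apply/eqP; field; rewrite gt_eqF.
apply: lee_nneseries; first by move=> *; exact: measure_ge0.
move=> i *; have [[p q] Fi] := FO i; rewrite Fi /=.
have [pq|qp] := ltP p q; last first.
  rewrite (_ : _ `&` _ = set0) ?measure0; last first.
    by rewrite -subset0 => x [_ /=]; rewrite in_itv/= => /andP[h1 h2]; have := lt_trans h1 h2; rewrite ltNge qp.
  by apply: mule_ge0; [rewrite lee_fin divr_ge0// ltW|exact: wlength_ge0].
rewrite wlength_itv/= lte_fin pq -EFinB -EFinM.
apply: (@le_trans _ _ (2 * ((q - p) / k))%:E).
  apply: mu_diam; first by rewrite divr_ge0 ?subr_ge0 ?ltW.
  move=> x y [Ax /=]; rewrite in_itv/= => /andP[x1 x2] [Ay /=]; rewrite in_itv/= => /andP[y1 y2].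
  rewrite ler_pdivlMr// mulrC; apply: (le_trans (hk _ _ Ax Ay)).
  by rewrite ler_distl; lra.
by rewrite lee_fin le_eqVlt; apply/orP; left; apply/eqP; field; rewrite gt_eqF.
Qed.

Lemma sloped_increasing (f f1 : R -> R) (a b s c C sg cf Cf x y : R) :
  curved f f1 a b s c C -> sloped f1 a b sg cf Cf -> a <= x <= b -> a <= y <= b -> x <= y ->
  cf * (y - x) <= sg * f y - sg * f x.
Proof.
move=> hcur [ss /andP[cf0 _] hs] xab yab xy; have [_ s1 c0 _ h] := hcur.
have e0 : 0 <= y - x by rewrite subr_ge0.
have /andP[h1 _] := h x y xab yab; have /andP[h2 _] := h y x yab xab.
have p1 : 0 <= c * (y - x) ^+ 2 by rewrite mulr_ge0 ?sqr_ge0// ltW.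
have p2 : 0 <= c * (x - y) ^+ 2 by rewrite mulr_ge0 ?sqr_ge0// ltW.
have /andP[k1 _] := hs x xab; have /andP[k2 _] := hs y yab.
have j1 := ler_wpM2r e0 k1; have j2 := ler_wpM2r e0 k2.
have E1 : sg * f y - sg * f x = sg * f1 x * (y - x) + sg * remainder f f1 x y.
  by rewrite /remainder; ring.
have E2 : sg * f y - sg * f x = sg * f1 y * (y - x) - sg * remainder f f1 y x.
  by rewrite /remainder; ring.
have [s_|s_] := curved_sign hcur; rewrite s_ in h1 h2.
  have /eqP : (sg - 1) * (sg + 1) = 0 by ring: ss.
  rewrite mulf_eq0 subr_eq0 addr_eq0 => /orP[/eqP sgE|/eqP sgE].
    by rewrite E1; rewrite sgE in j1 j2 *; lra.
  by rewrite E2; rewrite sgE in j1 j2 *; lra.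
have /eqP : (sg - 1) * (sg + 1) = 0 by ring: ss.
rewrite mulf_eq0 subr_eq0 addr_eq0 => /orP[/eqP sgE|/eqP sgE].
  by rewrite E2; rewrite sgE in j1 j2 *; lra.
by rewrite E1; rewrite sgE in j1 j2 *; lra.
Qed.

End divergence.

(** * The inverse function of a curved arc *)

Section inverse.
Context {R : realType}.
Local Notation mu := (@lebesgue_measure R).

(** [sg * f] increases, and the remainder of its inverse is, up to sign, that of [f] divided by sg
    f'. Bi-Lipschitz bounds exchange (w - v)^2 for (y - x)^2. *)
Lemma inverse_curved (f f1 : R -> R) (a b s c C sg cf Cf : R) :
  curved f f1 a b s c C -> sloped f1 a b sg cf Cf ->
  exists (g g1 : R -> R) (A B s' c' C' : R), [/\ curved g g1 A B s' c' C',
    (forall v, A <= v <= B -> `|g1 v| <= cf^-1) &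
    (forall x, a <= x <= b -> A <= sg * f x <= B /\ g (sg * f x) = x)].
Proof.
move=> hcur hslo; have inc := sloped_increasing hcur hslo.
have [ss /andP[cf0 cf1] hs] := hslo; have [ab s1 c0 /andP[_ C1] h] := hcur.
pose u x := sg * f x; pose Lam := Cf + C * (b - a).
have aab : a <= a <= b by rewrite lexx ltW.
have bab : a <= b <= b by rewrite lexx ltW.
have Cfcf : cf <= Cf by have := hs a aab; lra.
have Cba : 0 <= C * (b - a) by apply: mulr_ge0; lra.
have Lam0 : 0 < Lam by rewrite /Lam; lra.
have lip x y : a <= x <= b -> a <= y <= b -> `|u y - u x| <= Lam * `|y - x|.
  move=> xab yab; rewrite /u -mulrBr normrM.
  have -> : `|sg| = 1 by apply/eqP; rewrite -(@eqrXn2 _ 2)// expr1n -normrX expr2 ss normr1.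
  rewrite mul1r; apply: (curved_lipschitz hcur) => // z zab.
  by have /andP[] := slope_abs hslo zab.
have uab : u a < u b.
  have := inc a b aab bab (ltW ab); rewrite -/(u a) -/(u b).
  have : 0 < cf * (b - a) by rewrite mulr_gt0// subr_gt0.
  lra.
have H v : exists x, u a <= v <= u b -> a <= x <= b /\ u x = v.
  have [vab|nv] := boolP (u a <= v <= u b); last by exists 0.
  have cont : {within `[a, b], continuous u}.
    apply/subspace_continuousP => x; rewrite /= in_itv/= => xab.
    apply/cvgrPdist_lt => e e0; rewrite /within/=; apply/nbhs_ballP.
    exists (e / Lam) => /=; first exact: divr_gt0.
    move=> t; rewrite /ball/= => xt; rewrite in_itv/= => tab.
    apply: (le_lt_trans (lip _ _ tab xab)).
    by rewrite mulrC -ltr_pdivlMr.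
  have mm : Order.min (u a) (u b) <= v <= Order.max (u a) (u b).
    by rewrite (min_idPl (ltW uab)) (max_idPr (ltW uab)).
  have [x xab ux] := IVT (ltW ab) cont mm.
  by exists x; move: xab; rewrite in_itv.
have [g hg] := choice H.
have inj x y : a <= x <= b -> a <= y <= b -> u x = u y -> x = y.
  wlog xy : x y / x <= y.
    move=> wl xab yab e; have [/wl|/ltW/wl] := leP x y; first exact.
    by move=> w; apply/esym; apply: w.
  move=> xab yab e; have := inc x y xab yab xy; rewrite -/(u x) -/(u y) e subrr.
  rewrite pmulr_rle0// subr_le0 => yx; by apply/eqP; rewrite eq_le xy yx.
have range x : a <= x <= b -> u a <= u x <= u b.
  move=> xab; case/andP: (xab) => ax xb.
  have := inc a x aab xab ax; have := inc x b xab bab xb.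
  rewrite -/(u a) -/(u x) -/(u b).
  have : 0 <= cf * (x - a) by rewrite mulr_ge0 ?(ltW cf0)// subr_ge0.
  have : 0 <= cf * (b - x) by rewrite mulr_ge0 ?(ltW cf0)// subr_ge0.
  lra.
pose g1 v := (sg * f1 (g v))^-1.
exists g, g1, (u a), (u b), (- (s * sg)), (Order.min 1 (c / (Cf * Lam ^+ 2))), (Order.max 1 (C / cf ^+ 3)).
split; last 2 first.
- move=> v /hg[gv _]; have /andP[h1 _] := hs _ gv.
  have p0 : 0 < sg * f1 (g v) by lra.
  by rewrite /g1 normfV (gtr0_norm p0) lef_pV2 ?posrE.
- move=> x xab; have ur := range x xab; split => //.
  by have [g1' g2] := hg _ ur; apply: (inj _ _ g1' xab); rewrite g2.
have Cf0 : 0 < Cf by lra.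
split => //.
- by rewrite mulrNN mulrACA s1 ss mulr1.
- by rewrite lt_min ltr01 divr_gt0// mulr_gt0// exprn_gt0.
- by rewrite ge_min lexx/= le_max lexx.
move=> v w /hg[xab uv] /hg[yab uw].
set x := g v in xab uv; set y := g w in yab uw.
have /andP[D1 D2] := hs x xab; set D := sg * f1 x in D1 D2.
have D0 : 0 < D by lra.
have E : - (s * sg) * remainder g g1 v w = s * remainder f f1 x y / D.
  have f1E : f1 x = sg * D by rewrite /D mulrA ss mul1r.
  have wv : w - v = sg * remainder f f1 x y + D * (y - x).
    rewrite -uw -uv /u /remainder /D; ring.
  rewrite {1}/remainder -/x -/y /g1 -/x -/D wv.
  have -> : - (s * sg) * (y - x - D^-1 * (sg * remainder f f1 x y + D * (y - x))) =
    (sg * sg) * (s * remainder f f1 x y / D) by field; rewrite gt_eqF.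
  by rewrite ss mul1r.
rewrite E; have /andP[r1 r2] := h x y xab yab.
have e2 : (w - v) ^+ 2 <= Lam ^+ 2 * (y - x) ^+ 2.
  rewrite -uw -uv -real_normK ?num_real// -[(y - x) ^+ 2]real_normK ?num_real// -exprMn.
  by rewrite ler_pXn2r ?nnegrE ?mulr_ge0 ?(ltW Lam0)//; exact: lip.
have e1 : cf ^+ 2 * (y - x) ^+ 2 <= (w - v) ^+ 2.
  rewrite -uw -uv -[leRHS]real_normK ?num_real// -[(y - x) ^+ 2]real_normK ?num_real// -exprMn.
  rewrite ler_pXn2r ?nnegrE ?mulr_ge0 ?(ltW cf0)//.
  wlog xy : x y xab yab {uv uw D D1 D2 D0 E r1 r2 e2} / x <= y.
    move=> wl; have [xy|/ltW yx] := leP x y; first exact: wl.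
    by rewrite distrC [leRHS]distrC; exact: wl.
  rewrite ger0_norm ?subr_ge0//; apply: (le_trans (inc x y xab yab xy)).
  by rewrite -/(u x) -/(u y) ler_norm.
have q0 : 0 <= (y - x) ^+ 2 by exact: sqr_ge0.
have w0 : 0 <= (w - v) ^+ 2 by exact: sqr_ge0.
have Lam20 : 0 < Lam ^+ 2 by rewrite exprn_gt0.
apply/andP; split.
- apply: (@le_trans _ _ (c / (Cf * Lam ^+ 2) * (w - v) ^+ 2)).
    by apply: ler_wpM2r => //; rewrite ge_min lexx orbT.
  apply: (@le_trans _ _ (c * (y - x) ^+ 2 / Cf)).
    have -> : c * (y - x) ^+ 2 / Cf = c / (Cf * Lam ^+ 2) * (Lam ^+ 2 * (y - x) ^+ 2).
      by field; rewrite !gt_eqF.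
    by apply: ler_wpM2l => //; rewrite divr_ge0 ?mulr_ge0 ?ltW.
  apply: ler_pM => //; [by rewrite mulr_ge0// ltW|by rewrite invr_ge0 ltW|].
  by rewrite lef_pV2 ?posrE.
- apply: (@le_trans _ _ (C / cf ^+ 3 * (w - v) ^+ 2)); last first.
    by apply: ler_wpM2r => //; rewrite le_max lexx orbT.
  apply: (@le_trans _ _ (C * (y - x) ^+ 2 / cf)).
    apply: ler_pM => //; [|by rewrite invr_ge0 ltW|by rewrite lef_pV2 ?posrE].
    by apply: le_trans r1; rewrite mulr_ge0// ltW.
  have -> : C * (y - x) ^+ 2 / cf = C / cf ^+ 3 * (cf ^+ 2 * (y - x) ^+ 2).
    by field; rewrite gt_eqF.
  by apply: ler_wpM2l => //; rewrite divr_ge0 ?exprn_ge0 ?(ltW cf0)//; lra.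
Qed.

End inverse.

(** * Divergence on one arc *)

Section local_divergence.
Context {R : realType}.
Local Notation mu := (@lebesgue_measure R).

(** Condensation moves the divergence to the masses, records keep a third of it, and levels of mass
    below (3/4)^t have a finite sum. Among the rest, the levels with psi1 <= psi2 or the others
    still diverge; in the second case the coordinates are exchanged and the null set for the inverse
    of [sg * f] is pulled back. *)
Lemma divergence_local (f f1 : R -> R) (a b s c C sg cf Cf th1 th2 : R) (psi1 psi2 : nat -> R) :
  curved f f1 a b s c C -> sloped f1 a b sg cf Cf ->
  decreasing_to0 psi1 -> decreasing_to0 psi2 ->
  (forall B : R, exists n, B < \sum_(1 <= q < n) psi1 q * psi2 q) ->
  mu [set x | (a <= x <= b)%R /\ ~ forall n, exists2 q, (n <= q)%N & solvable psi1 psi2 th1 th2 x (f x) q] = 0%E.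
Proof.
move=> hcur hslo h1 h2 div.
have [p1pos p1dec _] := h1; have [p2pos p2dec _] := h2.
set M := maxpsi psi1 psi2; set m := minpsi psi1 psi2.
have t2 t : (0 < 2 ^ t)%N by rewrite expn_gt0.
pose phi q := psi1 q * psi2 q.
have phid k n : (0 < k)%N -> (k <= n)%N -> phi n <= phi k.
  move=> k0 kn; have n0 := leq_trans k0 kn.
  by apply: ler_pM; [exact: ltW (p1pos _ _)|exact: ltW (p2pos _ _)|exact: p1dec|exact: p2dec].
have phi0 q : (0 < q)%N -> 0 < phi q by move=> q0; rewrite mulr_gt0 ?p1pos ?p2pos.
have massE t : mass M m t = 2 ^+ t * phi (2 ^ t.+1)%N.
  by rewrite /mass /M /m /maxpsi /minpsi /phi /Order.min /Order.max; case: ifP => //; rewrite [psi2 _ * _]mulrC.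
have mass0 t : 0 <= mass M m t.
  by rewrite massE mulr_ge0 ?exprn_ge0// ltW// phi0.
have M0 t : 0 < M t by rewrite lt_max p1pos.
have m0 t : 0 < m t by rewrite lt_min p1pos// p2pos.
have mdec t : m t.+1 <= m t.
  have e : (2 ^ t.+1 <= 2 ^ t.+2)%N by rewrite leq_exp2l.
  by rewrite /m /minpsi le_min !ge_min p1dec//= p2dec// orbT.
have divm B : exists n, B < \sum_(0 <= t < n) mass M m t.
  have [n hn] := div (phi 1%N + 2 * B); exists n.
  have : \sum_(1 <= q < n) phi q <= \sum_(1 <= q < (2 ^ n.+1)%N) phi q.
    rewrite [leRHS](@big_cat_nat _ _ _ n.+1)//=; last by rewrite ltnW// ltn_expl.
    case: n hn => [|n] hn.
      rewrite [leLHS]big_geq//; apply: addr_ge0; rewrite big_nat_cond; apply: sumr_ge0 => i /andP[/andP[i1 _] _]; exact/ltW/phi0.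
    rewrite [X in _ <= X + _]big_nat_recr//= -addrA lerDl; apply: addr_ge0; first exact/ltW/phi0.
    by rewrite big_nat_cond sumr_ge0// => i /andP[/andP[i1 _] _]; apply/ltW/phi0; exact: leq_trans i1.
  move=> hle; have := le_trans hle (condensation_ge phid n.+1).
  rewrite big_nat_recl//= expr0 mul1r.
  have -> : \sum_(0 <= t < n) 2 ^+ t.+1 * phi (2 ^ t.+1)%N = 2 * \sum_(0 <= t < n) mass M m t.
    by rewrite mulr_sumr; apply: eq_bigr => t _; rewrite massE exprS; ring.
  rewrite expn0; move: hn; rewrite -/(phi _); lra.
have divr_ (B : R) : exists n, B < \sum_(0 <= t < n | record M t) mass M m t.
  have [n hn] := divm (3 * B); exists n.
  have := record_mass M0 m0 mdec n; lra.
have divb : forall B : R, exists n, B < \sum_(0 <= t < n | record M t && ((3 / 4) ^+ t <= mass M m t)) mass M m t.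
  apply: contrapT => nb.
  have [n] := sum_pred_split divr_ nb 4.
  apply/negP; rewrite -leNgt.
  apply: (@le_trans _ _ (\sum_(0 <= t < n) (3 / 4) ^+ t)); last first.
    apply: (le_trans (@geometric_sum_le R (3 / 4) n ltac:(lra) ltac:(lra))).
    have -> : 1 - 3 / 4 = 1 / 4 :> R by lra.
    by rewrite div1r invrK.
  rewrite big_mkcond; apply: ler_sum => t _; case: ifP => [/andP[_]|_].
    by rewrite -ltNge => /ltW.
  by apply: exprn_ge0; lra.
have [dt|ndt] := pselect (forall B : R, exists n, B < \sum_(0 <= t < n | (record M t && ((3 / 4) ^+ t <= mass M m t)) &&
    (psi1 (2 ^ t.+1)%N <= psi2 (2 ^ t.+1)%N)) mass M m t).
  have hCf x : a <= x <= b -> `|f1 x| <= Cf by move=> xab; have /andP[] := slope_abs hslo xab.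
  apply: (divergence_type th1 th2 hcur hCf h1 h2 _ dt).
  by move=> t; rewrite -andbA => /and3P[].
have dn := sum_pred_split divb ndt.
have [g [g1 [A [B [s' [c' [C' [hg bg gK]]]]]]]] := inverse_curved hcur hslo.
have ME : maxpsi psi2 psi1 = M by apply/funext => t; rewrite /M /maxpsi maxC.
have mE : minpsi psi2 psi1 = m by apply/funext => t; rewrite /m /minpsi minC.
have hTT t : (record M t && ((3 / 4) ^+ t <= mass M m t)) &&
    ~~ (psi1 (2 ^ t.+1)%N <= psi2 (2 ^ t.+1)%N) ->
    [/\ record M t, (3 / 4) ^+ t <= mass M m t & psi2 (2 ^ t.+1)%N <= psi1 (2 ^ t.+1)%N].
  by rewrite -andbA -ltNge => /and3P[r1 r2 /ltW r3].
have := @divergence_type R g g1 A B s' c' C' cf^-1 (sg * th2) th1 psi2 psi1 _ hg bg h2 h1.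
rewrite ME mE => /(_ _ hTT dn) N0.
have [ss /andP[cf0 cf1] hs] := hslo.
apply: (@null_preimage R _ (fun x => sg * f x) cf cf0).
  move=> x y [xab _] [yab _]; rewrite -mulrBr normrM.
  have -> : `|sg| = 1 by apply/eqP; rewrite -(@eqrXn2 _ 2)// expr1n -normrX expr2 ss normr1.
  by rewrite mul1r; exact: (sloped_expand hcur hslo).
apply/eqP; rewrite -measure_le0 -N0; apply: mu_le => _ [x [xab nx] <-].
have [vab gx] := gK x xab; split => //.
apply: contra_not nx => hx n; have [q nq [u [v [a1 a2]]]] := hx n.
exists q => //; rewrite gx in a2.
have sgz : exists z : int, z%:~R = sg /\ z * z = 1.
  have /eqP : (sg - 1) * (sg + 1) = 0 by ring: ss.
  by rewrite mulf_eq0 subr_eq0 addr_eq0 => /orP[/eqP ->|/eqP ->]; [exists 1|exists (-1)].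
have [z [zE zz]] := sgz.
(* The sign is an integer, so multiplying by it turns approximations of sg f with shift sg th2 into
   approximations of f with shift th2. *)
exists v, (z * u); split => //.
have -> : (z * u)%:~R + th2 - q%:R * f x = sg * (u%:~R + sg * th2 - q%:R * (sg * f x)).
  rewrite intrM zE !mulrDr mulrN mulrA ss.
  have -> : sg * (q%:R * (sg * f x)) = (sg * sg) * (q%:R * f x) by ring.
  by rewrite ss !mul1r.
rewrite normrM.
have -> : `|sg| = 1 by apply/eqP; rewrite -(@eqrXn2 _ 2)// expr1n -normrX expr2 ss normr1.
by rewrite mul1r.
Qed.

End local_divergence.

Import HBNNSimple.

(** * From the definitions to sums and null sets *)

Section approximable_sets.
Context {R : realType}.
Local Notation mu := (@lebesgue_measure R).

(** An increasing psi would stay above psi 1 > 0 and could not tend to 0. *)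
Lemma approximating_decreasing (psi : nat -> R) :
  approximating_function psi -> decreasing_to0 psi.
Proof.
move=> [pos mono /cvgrPdist_lt h0].
have lim0 e : 0 < e -> exists n, forall q, (n <= q)%N -> psi q < e.
  move=> e0; have [n _ hn] := h0 e e0; exists n => q nq.
  by have := hn q nq; rewrite /= sub0r normrN; apply: le_lt_trans; exact: ler_norm.
split=> //; case: mono => // inc m n m0 mn.
have [k hk] := lim0 (psi 1%N) (pos 1%N isT).
have := hk (maxn 1 k) (leq_maxr _ _).
by rewrite ltNge (inc 1%N (maxn 1 k))// leq_maxl.
Qed.

Lemma dist_int_lt (t p : R) : dist_int t < p <-> exists m : int, `|t - m%:~R| < p.
Proof.
split=> [h|[m h]].
  have [|_ [m _ <-] hm] := inf_lt _ h; last by exists m.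
  by exists `|t - 0%:~R|; exists 0.
apply: le_lt_trans h; apply: ge_inf; last by exists m.
by exists 0 => _ [k _ <-].
Qed.

Lemma infinite_natP (A : set nat) :
  infinite_set A <-> forall n, exists2 q, (n <= q)%N & A q.
Proof.
split=> [infA n|h /finite_seqP[s As]].
  apply: contrapT => nex; apply: infA; apply: (@sub_finite_set _ _ `I_n); last exact: finite_II.
  by move=> q Aq /=; rewrite ltnNge; apply/negP => nq; apply: nex; exists q.
have [q qs Aq] := h (\max_(i <- s) i).+1.
move: Aq qs; rewrite As /= => qs; rewrite ltnNge => /negP; apply.
by apply: (@leq_bigmax_seq _ s xpredT id).
Qed.

Lemma approximable_solvable (psi1 psi2 : nat -> R) (theta : R * R) (x y : R) :
  approximable psi1 psi2 theta (x, y) <->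
  forall n, exists2 q, (n <= q)%N & solvable psi1 psi2 theta.1 theta.2 x y q.
Proof.
have E (t th q p : R) : (exists m : int, `|q * t - th - m%:~R| < p) <->
    exists m : int, `|m%:~R + th - q * t| < p.
  have e (m : int) : `|q * t - th - m%:~R| = `|m%:~R + th - q * t|.
    by rewrite -normrN; congr `|_|; ring.
  by split=> -[m h]; exists m; [rewrite -e|rewrite e].
rewrite /approximable/=; split=> [/(proj1 (infinite_natP _)) h n|h].
  have [q nq /=[q0 /dist_int_lt/E[a ha] /dist_int_lt/E[b hb]]] := h n.
  by exists q => //; exists a, b.
apply: (proj2 (infinite_natP _)) => n; have [q nq [a [b [ha hb]]]] := h n.+1.
exists q; first exact: ltnW.
split=> /=; [exact: leq_ltn_trans nq| |]; apply/dist_int_lt/E; [by exists a|by exists b].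
Qed.

Lemma bounded_partial_sums (u : nat -> R) : (forall q, (0 < q)%N -> 0 <= u q) ->
  (\sum_(1 <= q <oo) (u q)%:E < +oo)%E -> exists B, forall n, \sum_(1 <= q < n) u q <= B.
Proof.
move=> u0 fin.
have u0' n : (1 <= n)%N -> true -> (0 <= (u n)%:E)%E by move=> n1 _; rewrite lee_fin u0.
set S := (X in (X < _)%E) in fin.
have S0 : (0 <= S)%E by exact: nneseries_ge0.
exists (fine S) => n; rewrite -lee_fin fineK; last by rewrite ge0_fin_numE.
by rewrite -sumEFin; exact: nneseries_lim_ge.
Qed.

Lemma unbounded_partial_sums (u : nat -> R) : (forall q, (0 < q)%N -> 0 <= u q) ->
  (\sum_(1 <= q <oo) (u q)%:E = +oo)%E -> forall B, exists n, B < \sum_(1 <= q < n) u q.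
Proof.
move=> u0 inf B; apply: contrapT => nb.
have : (\sum_(1 <= q <oo) (u q)%:E <= B%:E)%E; last by rewrite inf.
apply: lime_le.
  by apply: is_cvg_nneseries => n n1 _; rewrite lee_fin u0.
apply: nearW => n; rewrite sumEFin lee_fin leNgt; apply/negP => h; apply: nb; by exists n.
Qed.

(** [D] may fail to be Borel, so the integral is treated as a supremum over simple functions below
    [g] extended by 0: their level sets for positive values lie in [D]. *)
Lemma integral_null_set (D : set R) (g : R -> R) : mu D = 0%E -> (forall x, 0 <= g x) ->
  (\int[mu]_(x in D) (g x)%:E = 0)%E.
Proof.
move=> D0 g0; apply/eqP; rewrite eq_le; apply/andP; split; last first.
  by apply: integral_ge0 => x _; rewrite lee_fin.
rewrite ge0_integralE; last by move=> x _; rewrite lee_fin.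
apply: ub_ereal_sup => _ [h hg <-]; rewrite sintegralEnnsfun fsbig1// => r /= r0.
suff -> : mu (h @^-1` [set r]) = 0%E by rewrite mule0.
apply/eqP; rewrite -measure_le0 -D0; apply: mu_le => x /= hx.
apply: contrapT => nDx; have := hg x.
by rewrite patchE memNset//= lee_fin hx leNgt r0.
Qed.

Lemma measure_le_integral (D E : set R) (g : R -> R) : measurable E -> E `<=` D ->
  (forall x, 1 <= g x) -> (mu E <= \int[mu]_(x in D) (g x)%:E)%E.
Proof.
move=> mE ED g1; rewrite ge0_integralE; last by move=> x _; rewrite lee_fin (le_trans ler01).
apply: ereal_sup_ubound.
have mE' : measurable (E : set (g_sigma_algebraType (R.-ocitv.-measurable))) by [].
exists (indic_nnsfun R mE'); last exact: sintegral_indic.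
move=> x /=; have -> : indic_nnsfun R mE' x = \1_E x by [].
rewrite patchE indicE; have [xE|xE] := boolP (x \in E).
  by rewrite mem_set ?lee_fin//; apply: ED; exact: set_mem.
by case: ifP => _; rewrite lee_fin// (le_trans ler01).
Qed.

Lemma mu_subsingleton (D : set R) : (forall x y, D x -> D y -> x = y) -> mu D = 0%E.
Proof.
move=> h; have [->|/set0P[x Dx]] := eqVneq D set0; first exact: measure0.
apply/eqP; rewrite -measure_le0 -(lebesgue_measure_set1 x); apply: mu_le => y Dy /=.
exact: h.
Qed.

Lemma mu_countable_union (T : countType) (F : T -> set R) :
  (forall t, mu (F t) = 0%E) -> mu (\bigcup_t F t) = 0%E.
Proof.
move=> F0; pose G n := if unpickle n is Some t then F t else set0.
apply/eqP; rewrite -measure_le0; apply: (@le_trans _ _ (mu (\bigcup_n G n))).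
  by apply: mu_le => x [t _ Ft]; exists (pickle t) => //; rewrite /G pickleK.
apply: (le_trans (mu_bigcup _)); rewrite eseries0// => n _ _; rewrite /G.
by case: unpickle => // *; exact: measure0.
Qed.

Lemma mu_setU_null (A B : set R) : mu A = 0%E -> mu B = 0%E -> mu (A `|` B) = 0%E.
Proof.
move=> A0 B0; apply/eqP; rewrite -measure_le0.
by apply: (le_trans (mu_setU _ _)); rewrite A0 B0 adde0.
Qed.

End approximable_sets.

(** * From derivatives to curved arcs *)

Section calculus.
Context {R : realType}.

Lemma is_derive_lincomb (f g : R -> R) (s p t df dg : R) :
  is_derive t 1 f df -> is_derive t 1 g dg ->
  is_derive t 1 (fun u => s * f u + p * g u) (s * df + p * dg).
Proof.
move=> hf hg; have -> : (fun u => s * f u + p * g u) = (s \*: f) + (p \*: g) by apply/funext.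
exact: (is_deriveD (is_deriveZ s hf) (is_deriveZ p hg)).
Qed.

(** The mean value theorem is used twice: [g1] is nondecreasing, and the remainder equals (g1 w - g1
    x)(y - x) with w in between. *)
Lemma convex_remainder (g g1 g2 : R -> R) (A B x y : R) :
  (forall t, A <= t <= B -> is_derive t 1 g (g1 t)) ->
  (forall t, A <= t <= B -> is_derive t 1 g1 (g2 t)) ->
  (forall t, A <= t <= B -> 0 <= g2 t) ->
  A <= x <= B -> A <= y <= B -> 0 <= remainder g g1 x y.
Proof.
move=> dg dg1 g20 xAB yAB.
have mvt (h h1 : R -> R) u v : (forall t, A <= t <= B -> is_derive t 1 h (h1 t)) ->
    A <= u -> u < v -> v <= B -> exists2 w, u < w < v & h v - h u = h1 w * (v - u).
  move=> dh Au uv vB; have [||w] := @MVT R h h1 u v uv.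
  - by move=> t; rewrite in_itv/= => tuv; apply: dh; lra.
  - apply: derivable_within_continuous => t; rewrite in_itv/= => tuv.
    by have [] := dh t ltac:(lra).
  by rewrite in_itv/= => wuv E; exists w.
have mono u v : A <= u -> u <= v -> v <= B -> g1 u <= g1 v.
  move=> Au; rewrite le_eqVlt => /predU1P[-> //|uv] vB.
  have [w wuv E] := mvt _ _ u v dg1 Au uv vB.
  have : 0 <= g2 w * (v - u) by apply: mulr_ge0; [apply: g20; lra|lra].
  lra.
rewrite /remainder; have [xy|yx|->] := ltgtP x y; last by lra.
- have [w wxy ->] := mvt _ _ x y dg ltac:(lra) xy ltac:(lra).
  rewrite -mulrBl; apply: mulr_ge0; last lra.
  by rewrite subr_ge0; apply: mono; lra.
- have [w wxy E] := mvt _ _ y x dg ltac:(lra) yx ltac:(lra).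
  have gx : g x = g y + g1 w * (x - y) by lra.
  have -> : g y - g x - g1 x * (y - x) = (g1 x - g1 w) * (x - y) by rewrite gx; ring.
  apply: mulr_ge0; last lra.
  by rewrite subr_ge0; apply: mono; lra.
Qed.

(** Convexity is applied to s f - (k/2) t^2 and to (K/2) t^2 - s f. *)
Lemma curved_of_derive2 (f f1 f2 : R -> R) (A B s k K : R) :
  A < B -> s * s = 1 -> 0 < k ->
  (forall t, A <= t <= B -> is_derive t 1 f (f1 t)) ->
  (forall t, A <= t <= B -> is_derive t 1 f1 (f2 t)) ->
  (forall t, A <= t <= B -> k <= s * f2 t <= K) ->
  curved f f1 A B s (Order.min 1 (k / 2)) (Order.max 1 (K / 2)).
Proof.
move=> AB ss k0 df df1 hk.
have dsq (t : R) : is_derive t 1 (fun u : R => u * u) (2 * t).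
  have -> : 2 * t = id t *: (1 : R) + id t *: (1 : R) by rewrite /GRing.scale/=; ring.
  exact: (is_deriveM (is_derive_id t 1) (is_derive_id t 1)).
have dlin (t : R) : is_derive t 1 (fun u : R => 2 * u) 2.
  have h : is_derive t 1 (2 \*: (@id R)) (2 *: (1 : R)) := is_deriveZ 2 (is_derive_id t 1).
  by move: h; rewrite /GRing.scale/= mulr1.
have key (e p : R) : (forall t, A <= t <= B -> 0 <= e * f2 t + p * 2) ->
    forall x y, A <= x <= B -> A <= y <= B -> 0 <= e * remainder f f1 x y + p * (y - x) ^+ 2.
  move=> h x y xAB yAB.
  have -> : e * remainder f f1 x y + p * (y - x) ^+ 2 =
      remainder (fun u => e * f u + p * (u * u)) (fun u => e * f1 u + p * (2 * u)) x y.
    by rewrite /remainder; ring.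
  refine (@convex_remainder _ _ (fun u => e * f2 u + p * 2) A B x y _ _ h xAB yAB) => t tAB.
    exact: (is_derive_lincomb e p (df t tAB) (dsq t)).
  exact: (is_derive_lincomb e p (df1 t tAB) (dlin t)).
split => //.
- by rewrite lt_min ltr01/=; lra.
- by rewrite ge_min lexx/= le_max lexx.
move=> x y xAB yAB.
have lo := key s (- (k / 2)) ltac:(move=> t tAB; have := hk t tAB; lra) x y xAB yAB.
have hi := key (- s) (K / 2) ltac:(move=> t tAB; have := hk t tAB; lra) x y xAB yAB.
have q0 := sqr_ge0 (y - x); set q := (y - x) ^+ 2 in q0 lo hi *.
have m1 : Order.min 1 (k / 2) * q <= k / 2 * q by apply: ler_wpM2r => //; rewrite ge_min lexx orbT.
have m2 : K / 2 * q <= Order.max 1 (K / 2) * q by apply: ler_wpM2r => //; rewrite le_max lexx orbT.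
by lra.
Qed.

Lemma interior_derive (I : set R) (f : R -> R) (x : R) :
  I° x -> derivable_in I f x -> is_derive x 1 f (deriv_in I f x).
Proof.
move=> Ix cv; set l := deriv_in I f x.
have cv' : diff_quot f x @ within I x^' --> l by exact: cv.
have H : (fun h : R => h^-1 *: (f (h *: 1 + x) - f x)) @ 0^' --> l.
  apply/cvgrPdist_lt => e e0; move/cvgrPdist_lt: cv' => /(_ e e0).
  rewrite /within/dnbhs/= => /nbhs_ballP[d /= d0 hd].
  have /nbhs_ballP[d' /= d'0 hd'] : nbhs x I by exact: Ix.
  apply/nbhs_ballP; exists (Order.min d d') => /=; first by rewrite lt_min d0.
  move=> h; rewrite /ball/= sub0r normrN lt_min => /andP[hd1 hd2] h0.
  have b1 : `|x - (h + x)| = `|h| by rewrite -normrN; congr `|_|; ring.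
  have hx : h *: 1 + x = h + x by rewrite /GRing.scale/= mulr1.
  have -> : h^-1 *: (f (h *: 1 + x) - f x) = diff_quot f x (h + x).
    by rewrite hx /diff_quot addrK mulrC.
  apply: hd.
  - by rewrite /ball/= b1.
  - by rewrite -subr_eq0 addrK.
  - by apply: hd'; rewrite /ball/= b1.
apply: DeriveDef; first by apply: cvgP H.
exact: cvg_lim H.
Qed.

Lemma is_derive_continuous_eps (g : R -> R) (x l e : R) : is_derive x 1 g l -> 0 < e ->
  exists2 d, 0 < d & forall y, `|y - x| < d -> `|g y - g x| < e.
Proof.
move=> [dg _] e0.
have cg : {for x, continuous g} by apply: differentiable_continuous; exact/derivable1_diffP.
have /cvgrPdist_lt/(_ e e0)/nbhs_ballP[d /= d0 hd] := cg.
by exists d => // y yd; rewrite distrC; apply: hd; rewrite /ball/= distrC.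
Qed.

Lemma interior_ball (I : set R) (x : R) : I° x ->
  exists2 d, 0 < d & forall y, `|y - x| < d -> I° y.
Proof.
move=> Ix; have /nbhs_ballP[d /= d0 hd] : nbhs x I° by apply: open_nbhs_nbhs; split=> //; exact: open_interior.
by exists d => // y yd; apply: hd; rewrite /ball/= distrC.
Qed.

Lemma nonzero_sign (u : R) : u != 0 -> exists2 s, s * s = 1 & 0 < s * u.
Proof.
move=> u0; have [up|un|/esym/eqP] := ltgtP 0 u; last by rewrite (negbTE u0).
  by exists 1; rewrite ?mul1r.
by exists (-1); [ring|rewrite mulN1r oppr_gt0].
Qed.

Lemma sign_near (s u v : R) : s * s = 1 -> 0 < s * u -> `|v - u| < s * u / 2 ->
  s * u / 2 <= s * v <= s * u * 2.
Proof.
move=> ss su; have /eqP : (s - 1) * (s + 1) = 0 by ring: ss.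
rewrite mulf_eq0 subr_eq0 addr_eq0 ltr_distl => /orP[/eqP E|/eqP E]; rewrite E in su *; lra.
Qed.

Lemma local_curved (I : set R) (f : R -> R) (x : R) (f1 := deriv_in I f) :
  Ck_in 3 I f -> I° x -> derivn_in I 2 f x != 0 ->
  exists2 d, 0 < d & forall A B, x - d < A -> A < x -> x < B -> B < x + d ->
    (exists s c C, curved f f1 A B s c C) /\
    (f1 x != 0 -> exists sg cf Cf, sloped f1 A B sg cf Cf).
Proof.
move=> [hD _] Ix; set f2 := derivn_in I 2 f => nz.
have dI (i : nat) t : (i < 3)%N -> I° t -> is_derive t 1 (derivn_in I i f) (derivn_in I i.+1 f t).
  move=> i3 It; apply: interior_derive => //; apply: hD => //; exact: interior_subset It.
have [r r0 hr] := interior_ball Ix.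
have [s ss su] := nonzero_sign nz.
have [d2 d20 h2] := is_derive_continuous_eps (dI 2%N x isT Ix) (divr_gt0 su (ltr0n R 2)).
have [d1 d10 h1] : exists2 d1, 0 < d1 & f1 x != 0 -> exists2 sg, sg * sg = 1 &
    0 < sg * f1 x /\ forall y, `|y - x| < d1 -> `|f1 y - f1 x| < sg * f1 x / 2.
  have [->|nz1] := eqVneq (f1 x) 0; first by exists 1.
  have [sg ssg sgu] := nonzero_sign nz1.
  have [d1 d10 h1] := is_derive_continuous_eps (dI 1%N x isT Ix) (divr_gt0 sgu (ltr0n R 2)).
  by exists d1 => // _; exists sg.
exists (Order.min r (Order.min d1 d2)); first by rewrite !lt_min r0 d10.
move=> A B xA Ax xB Bx.
have near t : A <= t <= B -> [/\ `|t - x| < r, `|t - x| < d1 & `|t - x| < d2].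
  move=> tAB; have : `|t - x| < Order.min r (Order.min d1 d2) by rewrite ltr_distl; lra.
  by rewrite !lt_min => /and3P[].
split.
  have k0 : 0 < s * f2 x / 2 by rewrite divr_gt0.
  have df t : A <= t <= B -> is_derive t 1 f (f1 t).
    by move=> /near[/hr It _ _]; exact: (dI 0%N t isT It).
  have df1 t : A <= t <= B -> is_derive t 1 f1 (f2 t).
    by move=> /near[/hr It _ _]; exact: (dI 1%N t isT It).
  have bd t : A <= t <= B -> s * f2 x / 2 <= s * f2 t <= s * f2 x * 2.
    by move=> /near[_ _ /h2]; exact: sign_near.
  exists s, (Order.min 1 (s * f2 x / 2 / 2)), (Order.max 1 (s * f2 x * 2 / 2)).
  exact: (curved_of_derive2 (lt_trans Ax xB) ss k0 df df1 bd).
move=> /h1[sg ssg [sgu hsg]].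
exists sg, (Order.min 1 (sg * f1 x / 2)), (sg * f1 x * 2); split; [exact: ssg| |].
  by rewrite lt_min ltr01 divr_gt0//= ge_min lexx.
move=> t /near[_ /hsg tt _]; have /andP[k1 k2] := sign_near ssg sgu tt.
by rewrite k2 andbT; apply: le_trans k1; rewrite ge_min lexx orbT.
Qed.

End calculus.

(** * From single arcs to the whole curve *)

Section curves.
Context {R : realType}.
Local Notation mu := (@lebesgue_measure R).

Lemma speed_ge1 (I : set R) (f : R -> R) x : 1 <= speed I f x.
Proof. by rewrite /speed -[leLHS]sqrtr1 ler_wsqrtr// lerDl sqr_ge0. Qed.

(** A point with points of the interval on both sides is interior, so only a least and a greatest
    element remain. *)
Lemma mu_boundary_interval (I : set R) : is_interval I -> mu (I `\` I°) = 0%E.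
Proof.
move=> hI.
pose lo := [set x | I x /\ forall y, I y -> x <= y].
pose hi := [set x | I x /\ forall y, I y -> y <= x].
have lo0 : mu lo = 0%E.
  by apply: mu_subsingleton => x y [Ix hx] [Iy hy]; apply/eqP; rewrite eq_le hx// hy.
have hi0 : mu hi = 0%E.
  by apply: mu_subsingleton => x y [Ix hx] [Iy hy]; apply/eqP; rewrite eq_le hx// hy.
apply/eqP; rewrite -measure_le0 -(mu_setU_null lo0 hi0); apply: mu_le => x [Ix nIx].
apply: contrapT => /not_orP[nlo nhi].
have [u Iu ux] : exists2 u, I u & u < x.
  apply: contrapT => h; apply: nlo; split=> // y Iy; rewrite leNgt; apply/negP => yx.
  by apply: h; exists y.
have [v Iv xv] : exists2 v, I v & x < v.
  apply: contrapT => h; apply: nhi; split=> // y Iy; rewrite leNgt; apply/negP => yx.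
  by apply: h; exists y.
apply: nIx; apply/nbhs_ballP; exists (Order.min (x - u) (v - x)) => /=.
  by rewrite lt_min !subr_gt0 ux.
move=> y; rewrite /ball/= lt_min ltr_distlC ltr_distlC => /andP[/andP[y1 y2] /andP[y3 y4]].
by apply: (hI u v) => //; lra.
Qed.

(** Arc length dominates length, the speed being at least 1. The set is the interior minus an open
    set, hence measurable, as this comparison requires. *)
Lemma flat_points_null (I : set R) (f : R -> R) : Ck_in 3 I f -> nondegenerate I f ->
  mu [set x | I° x /\ derivn_in I 2 f x = 0] = 0%E.
Proof.
move=> [hD _] hC; set E := [set x | _].
have oU : open (I° `&` [set x | derivn_in I 2 f x != 0]).
  rewrite openE => x [Ix /= nz].
  have [r r0 hr] := interior_ball Ix.
  have dx := interior_derive Ix (hD 2%N isT x (interior_subset Ix)).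
  have e0 : 0 < `|derivn_in I 2 f x| by rewrite normr_gt0.
  have [d d0 hd] := is_derive_continuous_eps dx e0.
  apply/nbhs_ballP; exists (Order.min r d) => /=; first by rewrite lt_min r0.
  move=> y; rewrite /ball/= distrC lt_min => /andP[/hr Iy /hd yd]; split; first exact: Iy.
  change (is_true (derivn_in I 2 f y != 0)); apply/eqP => z.
  by move: yd; rewrite z sub0r normrN ltxx.
have mE : measurable E.
  have -> : E = I° `\` (I° `&` [set x | derivn_in I 2 f x != 0]).
    apply/seteqP; split=> x [Ix h]; split; [exact: Ix| |exact: Ix|].
      by move=> [_ nz]; have /eqP : derivn_in I 2 f x != 0 := nz.
    by apply: contrapT => nz; apply: h; split=> //; exact/eqP.
  by apply: measurableD; apply: open_measurable => //; exact: open_interior.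
apply/eqP; rewrite -measure_le0 -hC /curve_measure; apply: measure_le_integral => //.
  move=> x [Ix z]; have Ix' := interior_subset Ix; split=> //=.
  by exists x => //; split=> //; rewrite /curvature z normr0 mul0r.
exact: speed_ge1.
Qed.

(** Near a point with f' and f'' nonzero there is a curved and sloped interval with rational
    endpoints. On a curved interval f' is injective, so each such interval contains at most one zero
    of f'. *)
Lemma curve_null (I W : set R) (f : R -> R) (f1 := deriv_in I f) :
  is_interval I -> Ck_in 3 I f -> nondegenerate I f ->
  (forall A B s c C sg cf Cf, curved f f1 A B s c C -> sloped f1 A B sg cf Cf ->
     mu [set x | (A <= x <= B)%R /\ W x] = 0%E) ->
  mu (I `&` W) = 0%E.
Proof.
move=> hI hf hC hW.
pose cur (p : rat * rat) := exists s c C, curved f f1 (ratr p.1) (ratr p.2) s c C.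
pose slo (p : rat * rat) := exists sg cf Cf, sloped f1 (ratr p.1) (ratr p.2) sg cf Cf.
pose Z p : set R := [set x | [/\ ratr p.1 <= x <= ratr p.2, cur p & f1 x = 0]].
pose G p : set R := [set x | [/\ ratr p.1 <= x <= ratr p.2, cur p, slo p & W x]].
have Z0 : mu (\bigcup_p Z p) = 0%E.
  apply: mu_countable_union => p; apply: mu_subsingleton => x y [xp [s [c [C hc]]] x0] [yp _ y0].
  have /andP[] := curved_slope_abs hc xp yp; have [_ _ c0 _ _] := hc.
  rewrite x0 y0 subrr normr0 pmulr_rle0; last by rewrite mulr_gt0.
  by rewrite normr_le0 subr_eq0 => /eqP.
have G0 : mu (\bigcup_p G p) = 0%E.
  apply: mu_countable_union => p.
  have [[[s [c [C hc]]] [sg [cf [Cf hs]]]]|np] := pselect (cur p /\ slo p).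
    apply/eqP; rewrite -measure_le0 -(hW _ _ _ _ _ _ _ _ hc hs).
    by apply: mu_le => x [xp _ _ wx].
  apply: mu_subsingleton => x y [_ cp sp _]; by case: np.
have := mu_setU_null (mu_setU_null (mu_boundary_interval hI) (flat_points_null hf hC))
  (mu_setU_null Z0 G0) => N0.
apply/eqP; rewrite -measure_le0 -N0; apply: mu_le => x [Ix Wx].
have [Iix|nIx] := pselect (I° x); last by left; left.
have [z|nz] := eqVneq (derivn_in I 2 f x) 0; first by left; right.
right; have [d d0 hd] := local_curved hf Iix nz.
have [p hp] := @rat_in_itvoo R (x - d) x ltac:(lra).
have [q hq] := @rat_in_itvoo R x (x + d) ltac:(lra).
move: hp hq; rewrite !in_itv/= => /andP[p1 p2] /andP[q1 q2].
have [hc hs] := hd _ _ p1 p2 q1 q2.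
have xpq : ratr p <= x <= ratr q by lra.
have [z1|nz1] := eqVneq (f1 x) 0; [left|right]; exists (p, q) => //; split=> //.
exact: hs.
Qed.

End curves.

Theorem theorem2 (R : realType) (psi1 psi2 : nat -> R) (theta : R * R)
    (I : set R) (f : R -> R)
    (hpsi1 : approximating_function psi1)
    (hpsi2 : approximating_function psi2)
    (hI : is_interval I)
    (hf : Ck_in 3 I f)
    (hC : nondegenerate I f) :
  ((\sum_(1 <= q <oo) (psi1 q * psi2 q)%:E < +oo)%E ->
     curve_measure I f (curve I f `&` approximable psi1 psi2 theta) = 0%E) /\
  ((\sum_(1 <= q <oo) (psi1 q * psi2 q)%:E = +oo)%E ->
     curve_measure I f (curve I f `\` approximable psi1 psi2 theta) = 0%E).
Proof.
have d1 := approximating_decreasing hpsi1; have d2 := approximating_decreasing hpsi2.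
have p0 q : (0 < q)%N -> 0 <= psi1 q * psi2 q.
  by have [a _ _] := d1; have [b _ _] := d2 => q0; rewrite mulr_ge0 ?ltW ?a ?b.
(* Both claims reduce to null sets of abscissae, over which the integral of [speed] vanishes. *)
have null (S : set (R * R)) : lebesgue_measure (I `&` [set x | S (x, f x)]) = 0%E ->
    curve_measure I f S = 0%E.
  move=> S0; have s0 x : 0 <= speed I f x by exact: le_trans ler01 (speed_ge1 I f x).
  exact: (integral_null_set S0 s0).
have curveE x : I x -> curve I f (x, f x) by move=> Ix; exists x.
split=> sum; apply: null.
- have [B hB] := bounded_partial_sums p0 sum.
  apply: (curve_null hI hf hC) => A B' s c C sg cf Cf hc hs.
  apply/eqP; rewrite -measure_le0 -(convergence_local theta.1 theta.2 hc hs d1 d2 hB).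
  by apply: mu_le => x [xAB [_ /approximable_solvable hx]].
- have hB := unbounded_partial_sums p0 sum.
  apply: (curve_null hI hf hC) => A B' s c C sg cf Cf hc hs.
  apply/eqP; rewrite -measure_le0 -(divergence_local theta.1 theta.2 hc hs d1 d2 hB).
  by apply: mu_le => x [xAB [_ nx]]; split=> // hx; apply: nx; apply/approximable_solvable.
Qed.
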